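(* Let $Y$ be any smooth proper connected curve of genus $2$ over $\mathbb{C}$. Then there exists a finite \'etale cover $f: X \to Y$, with $X$ a smooth proper connected curve, which is Prill exceptional, i.e. $h^0(X, \mathscr{O}_X(f^{-1}(y))) \geq 2$ for every point $y \in Y$.
   Context: Work over the complex numbers. A finite cover $f: X \to Y$ of smooth proper geometrically connected curves is called Prill exceptional if $h^0(X, \mathscr{O}_X(f^{-1}(y))) \geq 2$ for every point $y \in Y$, where $f^{-1}(y)$ denotes the scheme-theoretic fiber viewed as an effective divisor on $X$. *)

(* Defs.v *)
(* Smooth proper connected curves over C are encoded through
   their function fields (the standard equivalence of categories between
   smooth proper connected curves over C with finite morphisms and function
   fields of transcendence degree 1 over C with C-embeddings).  Points of a
   curve are the places (normalized discrete valuations trivial on C) of its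
   function field. *)
From mathcomp Require Import all_boot all_algebra.
From mathcomp Require Import reals Rstruct complex.

Set Implicit Arguments.
Unset Strict Implicit.
Unset Printing Implicit Defensive.

Import GRing.Theory Num.Theory.
Local Open Scope ring_scope.

Definition CC : closedFieldType := Rdefinitions.R[i].

Section FunctionFields.
Variable K : fieldType.
Variable iota : {rmorphism CC -> K}.

Definition transcendental (t : K) : Prop :=
  forall p : {poly CC}, (map_poly iota p).[t] = 0 -> p = 0.

(* K is a function field of one variable over C (finitely generated of
   transcendence degree 1): there is a transcendental t such that K is a
   finite-dimensional vector space over C(t). *)
Definition function_field : Prop :=
  exists t : K, transcendental t /\
  exists (n : nat) (b : 'I_n -> K),
    forall x : K, exists (q : {poly CC}) (p : 'I_n -> {poly CC}),
      (map_poly iota q).[t] != 0 /\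
      x * (map_poly iota q).[t] = \sum_(i < n) (map_poly iota (p i)).[t] * b i.

(* A place = a point of the curve: a normalized discrete valuation of K
   trivial on C (values on 0 are irrelevant). *)
Definition is_place (v : K -> int) : Prop :=
  [/\ forall x y, x != 0 -> y != 0 -> v (x * y) = v x + v y,
      forall x y, x != 0 -> y != 0 -> x + y != 0 ->
         Num.min (v x) (v y) <= v (x + y),
      forall c : CC, c != 0 -> v (iota c) = 0
    & forall n : int, exists x, x != 0 /\ v x = n].

Definition same_place (v w : K -> int) : Prop :=
  forall x, x != 0 -> v x = w x.

Definition lin_indep (n : nat) (xs : 'I_n -> K) : Prop :=
  forall c : 'I_n -> CC, \sum_(i < n) iota (c i) * xs i = 0 -> forall i, c i = 0.

Definition eff_divisor (A : seq ((K -> int) * nat)) : Prop :=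
  (forall i, (i < size A)%N -> is_place (nth (fun _ => 0, 0%N) A i).1) /\
  (forall i j, (i < size A)%N -> (j < size A)%N -> i <> j ->
     ~ same_place (nth (fun _ => 0, 0%N) A i).1 (nth (fun _ => 0, 0%N) A j).1).

Definition deg_eff (A : seq ((K -> int) * nat)) : nat := \sum_(a <- A) a.2.

(* Riemann-Roch space L(A) = { x | x = 0 or div(x) + A >= 0 }.  All places of
   a function field over the algebraically closed C have degree 1. *)
Definition in_LA (A : seq ((K -> int) * nat)) (x : K) : Prop :=
  x = 0 \/
  forall P, is_place P ->
    0 <= P x \/ exists i, (i < size A)%N /\ same_place P (nth (fun _ => 0, 0%N) A i).1 /\
       0 <= P x + ((nth (fun _ => 0, 0%N) A i).2%:Z).

Definition h0_ge (A : seq ((K -> int) * nat)) (n : nat) : Prop :=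
  exists xs : 'I_n -> K, (forall i, in_LA A (xs i)) /\ lin_indep xs.

(* genus (Stichtenoth, Def. 1.4.15): g = max_A (deg A + 1 - l(A)); it suffices
   to range over effective divisors.  genus_eq g says this maximum is g. *)
Definition genus_eq (g : nat) : Prop :=
  (forall A, eff_divisor A -> h0_ge A (deg_eff A + 1 - g)) /\
  (exists A, eff_divisor A /\ (g <= deg_eff A + 1)%N /\
     ~ h0_ge A (deg_eff A + 1 - g).+1).

End FunctionFields.

Section Covers.
Variables (KY KX : fieldType) (iY : {rmorphism CC -> KY}) (iX : {rmorphism CC -> KX}).
Variable phi : {rmorphism KY -> KX}.

Definition over_CC : Prop := forall c, phi (iY c) = iX c.

Definition finite_ext : Prop :=
  exists (n : nat) (b : 'I_n -> KX), forall x : KX,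
    exists a : 'I_n -> KY, x = \sum_(i < n) phi (a i) * b i.

Definition lies_over (P : KX -> int) (y : KY -> int) (e : nat) : Prop :=
  (0 < e)%N /\ forall a, a != 0 -> P (phi a) = (e%:Z) * y a.

Definition etale : Prop :=
  forall P, is_place iX P -> exists y, is_place iY y /\ lies_over P y 1.

(* x \in H^0(X, O_X(f^{-1}(y))), where f^{-1}(y) = sum_{P | y} e(P|y) P *)
Definition in_L_fiber (y : KY -> int) (x : KX) : Prop :=
  x = 0 \/
  forall P, is_place iX P ->
    0 <= P x \/ exists e, lies_over P y e /\ 0 <= P x + (e%:Z).

Definition prill_exceptional : Prop :=
  forall y, is_place iY y ->
    exists x1 x2 : KX, in_L_fiber y x1 /\ in_L_fiber y x2 /\
      forall c1 c2 : CC, iX c1 * x1 + iX c2 * x2 = 0 -> c1 = 0 /\ c2 = 0.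

End Covers.

(* Main.v *)
(* A curve Y of genus 2 is u^2 = f(s) (s - c) (s - e) with f a cubic without square term:
   the genus enters only by counting, which shows that at some place the possible pole
   orders of functions regular elsewhere are 2, 4, 5, 6, ...
   Adjoining r with r^2 = (s - c) (s - e) gives a cover mapping to the elliptic curve
   E : Y^2 = f(s) by Y = u / r.  Pull it back along E -> E, (x, y) |-> (c, d) + 3 (x, y),
   where d^2 = f(c), and adjoin w with w^2 = psi(x), psi the 3-division polynomial.
   The zeros of psi(x) lie over (c, d), and there w has the same order as r, so the
   resulting cover X -> Y is etale.
   For each point q of Y there is a nonzero function G in C(x, y, r), built from Y, r and
   the slopes of the chords through (c, d), 3 (x, y) and through (x, y), 2 (x, y), such that
   y G / w has at most simple poles, all of them in the fibre over q.  It is not constant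
   because w is not in C(x, y, r), so 1 and y G / w are independent sections. *)
Require Import Defs.
From HB Require Import structures.
From mathcomp Require Import all_boot all_order all_algebra all_field.
From mathcomp Require Import boolp Rstruct complex.
From mathcomp Require Import zify ring lra.

Set Implicit Arguments.
Unset Strict Implicit.
Unset Printing Implicit Defensive.

Import Order.TTheory GRing.Theory Num.Theory.
Local Open Scope ring_scope.

(** * Valuations *)

(** The slopes come from the Weierstrass zeta function. Let z be the parameter of (x, y) and t that
    of (c, d). The chord through the points of parameters a and b has slope zeta(a + b) - zeta(a) -
    zeta(b), so [l - n] is zeta(t) + zeta(z) + zeta(2 z) - zeta(t + 3 z): the term zeta(3 z), with a
    pole at every 3-torsion point, has cancelled. Poles remain where t + 3 z = 0, that is over
    infinity; at the 2-torsion points, where y vanishes; and at the origin, where y / w vanishes. At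
    a nonzero 3-torsion point, where w vanishes, the expression is 0, because 2 z = - z there. So y
    (l - n) / w is the section for the point at infinity, and 1 + 2 = 3 is the reason for tripling.
    For every other point the rule is the same: G has to vanish to the order of w over the nonzero
    3-torsion points. Degrees of the adjunctions are never computed. That w is new follows from
    orders at the origin of the curve y^2 = f(x) and from a simple root of psi. Places are
    normalized, so etaleness amounts to this: the elements of the field of Y already take all
    integer orders at each place of X. *)

Lemma CC_nat_neq0 (n : nat) : (n.+1)%:R != 0 :> CC.
Proof. by rewrite (pnatr_eq0 Rdefinitions.R[i] n.+1). Qed.

Section Valuations.
Variables (K : fieldType) (iota : {rmorphism CC -> K}).
Implicit Types (v w : K -> int) (x y z : K) (p q : {poly CC}) (c : CC).

Local Notation "p `@ x" := ((map_poly iota p).[x]) (at level 10).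

Lemma evD p q x : (p + q) `@ x = p `@ x + q `@ x.
Proof. by rewrite rmorphD hornerD. Qed.
Lemma evN p x : (- p) `@ x = - (p `@ x).
Proof. by rewrite rmorphN hornerN. Qed.
Lemma evB p q x : (p - q) `@ x = p `@ x - q `@ x.
Proof. by rewrite evD evN. Qed.
Lemma evM p q x : (p * q) `@ x = p `@ x * q `@ x.
Proof. by rewrite rmorphM hornerM. Qed.
Lemma evXn p n x : (p ^+ n) `@ x = (p `@ x) ^+ n.
Proof. by rewrite rmorphXn horner_exp. Qed.
Lemma evC c x : c%:P `@ x = iota c.
Proof. by rewrite map_polyC hornerC. Qed.
Lemma evX x : 'X `@ x = x.
Proof. by rewrite map_polyX hornerX. Qed.
Lemma ev0 x : 0 `@ x = 0.
Proof. by rewrite rmorph0 horner0. Qed.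
Lemma ev1 x : 1 `@ x = 1.
Proof. by rewrite rmorph1 hornerC. Qed.
Lemma evMn p n x : (p *+ n) `@ x = (p `@ x) *+ n.
Proof. by rewrite rmorphMn hornerMn. Qed.
Lemma evXC c x : ('X - c%:P) `@ x = x - iota c.
Proof. by rewrite evB evX evC. Qed.
Lemma ev_coefE p x : p `@ x = \sum_(i < size p) iota p`_i * x ^+ i.
Proof.
rewrite horner_coef size_map_poly; apply: eq_bigr => i _; by rewrite coef_map.
Qed.
Lemma ev_prod (I : Type) (r : seq I) (P : pred I) (F : I -> {poly CC}) x :
  (\prod_(i <- r | P i) F i) `@ x = \prod_(i <- r | P i) (F i) `@ x.
Proof. by rewrite rmorph_prod horner_prod. Qed.
Lemma ev_sum (I : Type) (r : seq I) (P : pred I) (F : I -> {poly CC}) x :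
  (\sum_(i <- r | P i) F i) `@ x = \sum_(i <- r | P i) (F i) `@ x.
Proof. by rewrite rmorph_sum horner_sum. Qed.

Definition evE := (evMn, evXn, evD, evN, evM, evC, evX, ev0, ev1).

Lemma iota_eq0 c : (iota c == 0) = (c == 0).
Proof. exact: fmorph_eq0. Qed.
Lemma natK_neq0 (n : nat) : (n.+1)%:R != 0 :> K.
Proof. by rewrite -(rmorph_nat iota) iota_eq0 CC_nat_neq0. Qed.

Lemma transcendental_ev_neq0 x p : transcendental iota x -> p != 0 -> p `@ x != 0.
Proof. by move=> tx; apply: contraNneq => /tx ->. Qed.

Lemma poly_linear_factors p : p != 0 ->
  exists (rs : seq CC) c, c != 0 /\ p = c%:P * \prod_(r <- rs) ('X - r%:P).
Proof.
move=> p0; have [rs Hrs] := closed_field_poly_normal p.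
by exists rs, (lead_coef p); rewrite lead_coef_eq0 p0 mul_polyC -Hrs.
Qed.

(** [CC] is algebraically closed: a nonzero polynomial killing [x] splits, so one of its linear
    factors kills [x]. *)
Lemma nonconst_transcendental x :
  (forall c, x != iota c) -> transcendental iota x.
Proof.
move=> nc p px; apply/eqP/negPn/negP => p0.
have [rs [c [c0 pE]]] := poly_linear_factors p0.
move/eqP: px; rewrite pE evM evC ev_prod mulf_eq0 iota_eq0 (negPf c0) /=.
rewrite prodf_seq_eq0 => /hasP[r _ /=].
by rewrite evXC subr_eq0 (negPf (nc r)).
Qed.

Lemma transcendental_nonconst x c : transcendental iota x -> x != iota c.
Proof.
move=> tx; apply/eqP => xE.
have := tx ('X - c%:P); rewrite evXC xE subrr => /(_ erefl)/eqP.
by rewrite polyXsubC_eq0.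
Qed.

(** The surjectivity clause of [is_place] is dropped, so that the rules below also apply to a
    valuation whose normalization is still to be proved, as in [ramified_place]. *)
Definition is_val v : Prop :=
  [/\ forall x y, x != 0 -> y != 0 -> v (x * y) = v x + v y,
      forall x y, x != 0 -> y != 0 -> x + y != 0 ->
         Num.min (v x) (v y) <= v (x + y)
    & forall c : CC, c != 0 -> v (iota c) = 0].

Lemma place_val v : is_place iota v -> is_val v.
Proof. by case=> ? ? ? _; split. Qed.

(* [vge] gives 0 every order, whatever junk value [v 0] is. *)
Definition vge v (k : int) x : bool := (x == 0) || (k <= v x).

Section OneValuation.
Variable v : K -> int.
Hypothesis vv : is_val v.

Lemma nuM x y : x != 0 -> y != 0 -> v (x * y) = v x + v y.
Proof. by case: vv => H _ _; apply: H. Qed.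
Lemma nuC c : c != 0 -> v (iota c) = 0.
Proof. by case: vv => _ _; apply. Qed.
Lemma nu1 : v 1 = 0.
Proof. by rewrite -(rmorph1 iota) nuC ?oner_eq0. Qed.
Lemma nuN x : v (- x) = v x.
Proof.
have [->|x0] := eqVneq x 0; first by rewrite oppr0.
rewrite -mulN1r nuM ?oppr_eq0 ?oner_eq0 //.
by rewrite -(rmorph1 iota) -rmorphN nuC ?add0r // oppr_eq0 oner_eq0.
Qed.
Lemma nuV x : x != 0 -> v x^-1 = - v x.
Proof.
move=> x0; have := nu1; rewrite -(mulfV x0) nuM ?invr_eq0 //; lia.
Qed.
Lemma nuf x y : x != 0 -> y != 0 -> v (x / y) = v x - v y.
Proof. by move=> x0 y0; rewrite nuM ?invr_eq0 // nuV. Qed.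
Lemma nuX x n : x != 0 -> v (x ^+ n) = (n%:Z) * v x.
Proof.
move=> x0; elim: n => [|n IH]; first by rewrite expr0 nu1 mul0r.
by rewrite exprS nuM ?expf_neq0 // IH; lia.
Qed.
Lemma nu_natr n : v (n.+1)%:R = 0.
Proof. by rewrite -(rmorph_nat iota) nuC // CC_nat_neq0. Qed.

Lemma vge0 k : vge v k 0.
Proof. by rewrite /vge eqxx. Qed.
Lemma vgeE k x : x != 0 -> vge v k x = (k <= v x).
Proof. by rewrite /vge => /negPf ->. Qed.
Lemma vgeC c : vge v 0 (iota c).
Proof.
have [->|c0] := eqVneq c 0; first by rewrite rmorph0 vge0.
by rewrite /vge nuC // lexx orbT.
Qed.
Lemma vge1 : vge v 0 1.
Proof. by rewrite -(rmorph1 iota) vgeC. Qed.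
Lemma vgeN k x : vge v k (- x) = vge v k x.
Proof. by rewrite /vge oppr_eq0 nuN. Qed.
Lemma vgeW k l x : k <= l -> vge v l x -> vge v k x.
Proof. by rewrite /vge => kl /orP[->//|lx]; rewrite (le_trans kl lx) orbT. Qed.
Lemma vgeD k x y : vge v k x -> vge v k y -> vge v k (x + y).
Proof.
have [->|x0] := eqVneq x 0; first by rewrite add0r.
have [->|y0] := eqVneq y 0; first by rewrite addr0.
have [->|s0] := eqVneq (x + y) 0; first by rewrite vge0.
rewrite !vgeE // => kx ky.
by case: vv => _ H _; apply: le_trans (H _ _ x0 y0 s0); rewrite le_min kx.
Qed.
Lemma vgeB k x y : vge v k x -> vge v k y -> vge v k (x - y).
Proof. by move=> kx ky; rewrite vgeD ?vgeN. Qed.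
Lemma vgeM k l x y : vge v k x -> vge v l y -> vge v (k + l) (x * y).
Proof.
have [->|x0] := eqVneq x 0; first by rewrite mul0r !vge0.
have [->|y0] := eqVneq y 0; first by rewrite mulr0 !vge0.
rewrite !vgeE ?mulf_neq0 // nuM //; lia.
Qed.
Lemma vgeM0 x y : vge v 0 x -> vge v 0 y -> vge v 0 (x * y).
Proof. exact: vgeM. Qed.
Lemma vgeMl k x y : vge v 0 x -> vge v k y -> vge v k (x * y).
Proof. by move=> x0 ky; rewrite -[k]add0r vgeM. Qed.
Lemma vgeX k x n : vge v k x -> vge v (n%:Z * k) (x ^+ n).
Proof.
move=> kx; elim: n => [|n IH]; first by rewrite expr0 mul0r vge1.
by rewrite exprS (_ : n.+1%:Z * k = k + n%:Z * k) ?vgeM //; lia.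
Qed.
Lemma vgeX0 x n : vge v 0 x -> vge v 0 (x ^+ n).
Proof. by move=> /(vgeX n); rewrite mulr0. Qed.
Lemma vge_sum (I : Type) (r : seq I) (P : pred I) (F : I -> K) k :
  (forall i, P i -> vge v k (F i)) -> vge v k (\sum_(i <- r | P i) F i).
Proof.
move=> H; elim/big_ind: _ => //; [exact: vge0|exact: vgeD].
Qed.
Lemma vge_ev p x : vge v 0 x -> vge v 0 (p `@ x).
Proof.
move=> x0; rewrite ev_coefE; apply: vge_sum => i _.
by rewrite vgeM0 ?vgeC ?vgeX0.
Qed.
Lemma vge_refl x : vge v (v x) x.
Proof. by rewrite /vge lexx orbT. Qed.
Lemma vge_div k x y : y != 0 -> vge v (k + v y) x -> vge v k (x / y).
Proof.
move=> y0 H; have := vgeM H (vge_refl y^-1); rewrite nuV //.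
by rewrite addrK.
Qed.
Lemma vge_mulK k x y : y != 0 -> vge v (k + v y) (x * y) -> vge v k x.
Proof. by move=> y0 H; rewrite -(mulfK y0 x) vge_div. Qed.
Lemma vge_sqr k x : vge v (2 * k) (x ^+ 2) = vge v k x.
Proof.
have [->|x0] := eqVneq x 0; first by rewrite expr0n !vge0.
by rewrite !vgeE ?expf_neq0 // nuX //; lia.
Qed.

Lemma val_addl x y : x != 0 -> vge v (v x + 1) y -> x + y != 0 /\ v (x + y) = v x.
Proof.
move=> x0; have [->|y0] := eqVneq y 0; first by rewrite addr0.
rewrite vgeE // => xy.
have s0 : x + y != 0.
  apply/negP; rewrite addrC addr_eq0 => /eqP yE.
  by move: xy; rewrite yE nuN; lia.
split=> //; apply/le_anti/andP; split.
  have H : vge v (v (x + y)) (x + y) by exact: vge_refl.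
  rewrite leNgt; apply/negP => lt.
  have : vge v (v x + 1) (x + y - y).
    by apply: vgeB; [rewrite vgeE //; lia|rewrite vgeE].
  by rewrite addrK vgeE //; lia.
have : vge v (v x) (x + y) by rewrite vgeD ?vge_refl // vgeE //; lia.
by rewrite vgeE.
Qed.

Lemma val_unit_const c x : c != 0 -> vge v 1 (x - iota c) -> x != 0 /\ v x = 0.
Proof.
move=> c0 H; have c0' : iota c != 0 by rewrite iota_eq0.
have := @val_addl (iota c) (x - iota c) c0'.
by rewrite nuC // add0r addrCA subrr addr0; apply.
Qed.

Lemma res_uniq x c c' : vge v 1 (x - iota c) -> vge v 1 (x - iota c') -> c = c'.
Proof.
move=> h1 h2; apply/eqP; rewrite -subr_eq0; apply/negPn/negP => cc.
have := vgeB h2 h1.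
have -> : x - iota c' - (x - iota c) = iota (c - c') by rewrite rmorphB; ring.
by rewrite vgeE ?iota_eq0 // nuC.
Qed.

Lemma resD x y c d : vge v 1 (x - iota c) -> vge v 1 (y - iota d) ->
  vge v 1 (x + y - iota (c + d)).
Proof.
move=> hx hy; have -> : x + y - iota (c + d) = (x - iota c) + (y - iota d).
  by rewrite rmorphD; ring.
exact: vgeD.
Qed.
Lemma res_reg x c : vge v 1 (x - iota c) -> vge v 0 x.
Proof. by move=> h; rewrite -(subrK (iota c) x) vgeD ?vgeC // (vgeW _ h). Qed.
Lemma resM x y c d : vge v 1 (x - iota c) -> vge v 1 (y - iota d) ->
  vge v 1 (x * y - iota (c * d)).
Proof.
move=> hx hy.
have -> : x * y - iota (c * d) = (x - iota c) * y + iota c * (y - iota d).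
  by rewrite rmorphM; ring.
by rewrite vgeD ?[_ * y]mulrC ?vgeMl ?vgeC ?(res_reg hy).
Qed.

Lemma res_ev p x c : vge v 1 (x - iota c) -> vge v 1 (p `@ x - iota p.[c]).
Proof.
move=> hx.
have /factor_theorem[q pE] : root (p - p.[c]%:P) c.
  by rewrite /root !hornerE subrr.
have -> : p `@ x - iota p.[c] = q `@ x * (x - iota c).
  by rewrite -evXC -evM -pE evB evC.
by rewrite vgeMl ?vge_ev ?(res_reg hx).
Qed.

Lemma val_ev_unit p x c : vge v 1 (x - iota c) -> p.[c] != 0 ->
  p `@ x != 0 /\ v (p `@ x) = 0.
Proof. by move=> /(res_ev p) h pc; apply: val_unit_const h. Qed.

(** The cofactor of ['X - c%:P] takes at [c] the value of the derivative of [p], so it is a unit at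
    [v]. *)
Lemma val_ev_simple p x c : x != iota c -> vge v 1 (x - iota c) ->
  p.[c] = 0 -> p^`().[c] != 0 ->
  p `@ x != 0 /\ v (p `@ x) = v (x - iota c).
Proof.
move=> xc hx /eqP/factor_theorem[q pE].
rewrite pE derivM !hornerE subrr mulr0 add0r derivXsubC hornerC mulr1 => qc.
have [q0 vq] := val_ev_unit hx qc.
by rewrite evM evXC mulf_neq0 ?subr_eq0 // nuM ?subr_eq0 // vq add0r.
Qed.

(** The leading term has strictly the lowest order; the scheme of Horner shows this one coefficient
    at a time. *)
Lemma val_ev_pole p x : x != 0 -> v x < 0 -> p != 0 ->
  p `@ x != 0 /\ v (p `@ x) = ((size p).-1)%:Z * v x.
Proof.
move=> x0 vx; elim/poly_ind: p => [|p c IH]; first by rewrite eqxx.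
have [->|p0 _] := eqVneq p 0.
  rewrite mul0r add0r => c0; rewrite size_polyC.
  move: c0; rewrite polyC_eq0 => c0; by rewrite c0 evC iota_eq0 nuC //= mul0r.
have [px0 pxE] := IH p0.
rewrite evD evM evX evC -cons_poly_def size_cons_poly nil_poly (negPf p0) /=.
have px'0 : p `@ x * x != 0 by rewrite mulf_neq0.
have vE : v (p `@ x * x) = (size p)%:Z * v x.
  rewrite nuM // pxE; move: p0; rewrite -size_poly_gt0.
  by case: (size p) => // m _; rewrite intS mulrDl mul1r addrC.
rewrite -vE; apply: val_addl => //; apply: (@vgeW _ 0); last exact: vgeC.
by rewrite vE; have := p0; rewrite -size_poly_gt0; nia.
Qed.

End OneValuation.

Lemma place_uniformizer v (n : int) : is_place iota v -> exists2 x, x != 0 & v x = n.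
Proof. by case=> _ _ _ /(_ n)[x [x0 xn]]; exists x. Qed.

(* The relation is found by bordering with a zero column the coefficient
   matrix of 1, x, ..., x^n over the n generators of K over C(t). *)
Lemma algebraic_relation (t : K) :
  transcendental iota t ->
  (exists (n : nat) (b : 'I_n -> K),
    forall x : K, exists (q : {poly CC}) (p : 'I_n -> {poly CC}),
      q `@ t != 0 /\ x * q `@ t = \sum_(i < n) (p i) `@ t * b i) ->
  forall x, exists (m : nat) (r : 'I_m -> {poly CC}),
    (exists j, r j != 0) /\ \sum_(j < m) (r j) `@ t * x ^+ j = 0.
Proof.
move=> tt [n [b hb]] x.
have /choice[qp hqp] : forall j : 'I_n.+1, exists qp : {poly CC} * ('I_n -> {poly CC}),
    qp.1 `@ t != 0 /\ x ^+ j * qp.1 `@ t = \sum_(i < n) (qp.2 i) `@ t * b i.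
  by move=> j; have [q [p hp]] := hb (x ^+ j); exists (q, p).
pose A : 'M[{poly CC}]_n.+1 := \matrix_(j, i) oapp (qp j).2 0 (unlift ord_max i).
have : \det A == 0.
  rewrite (expand_det_col _ ord_max) big1 // => j _.
  by rewrite mxE unlift_none mul0r.
move=> /det0P[w w0 wA].
exists n.+1, (fun j => w 0 j * (qp j).1); split.
  have /rV0Pn[j wj] := w0; exists j; rewrite mulf_neq0 //.
  by have [+ _] := hqp j; apply: contraNneq => ->; rewrite ev0.
have -> : \sum_(j < n.+1) (w 0 j * (qp j).1) `@ t * x ^+ j
   = \sum_(i < n) (\sum_(j < n.+1) (w 0 j * (qp j).2 i)) `@ t * b i.
  transitivity (\sum_(j < n.+1) \sum_(i < n) (w 0 j * (qp j).2 i) `@ t * b i).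
    apply: eq_bigr => j _; have [_ h] := hqp j.
    rewrite evM -mulrA [(qp j).1 `@ t * _]mulrC h mulr_sumr.
    by apply: eq_bigr => i _; rewrite evM mulrA.
  rewrite exchange_big; apply: eq_bigr => i _.
  by rewrite ev_sum mulr_suml.
rewrite big1 // => i _.
have /rowP/(_ (lift ord_max i)) := wA; rewrite !mxE => wi.
rewrite (_ : \sum_(j < n.+1) _ = 0) ?ev0 ?mul0r //.
rewrite -[RHS]wi; apply: eq_bigr => j _; congr (_ * _).
by rewrite mxE liftK.
Qed.

End Valuations.

(** * Residues at a place *)

Section Residues.
Variables (K : fieldType) (iota : {rmorphism CC -> K}).
Local Notation "p `@ x" := ((map_poly iota p).[x]) (at level 10).
Local Notation is_val := (is_val iota).
Implicit Types (v w : K -> int) (x y z : K) (p q : {poly CC}) (c : CC).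

(** The least order is attained by a single term, so it is the order of the sum. *)
Lemma val_sum_neq0 v (I : finType) (P : pred I) (F : I -> K) (i0 : I) :
  is_val v -> P i0 -> (forall i, P i -> F i != 0) ->
  (forall i j, P i -> P j -> v (F i) = v (F j) -> i = j) ->
  \sum_(i | P i) F i != 0.
Proof.
move=> vv Pi0 F0 inj.
case: (arg_minP (fun i => v (F i)) Pi0) => m Pm mmin.
rewrite (bigD1 m) //=.
have [] // := @val_addl _ _ v vv (F m) (\sum_(i | P i && (i != m)) F i) (F0 _ Pm).
apply: (vge_sum vv) => i /andP[Pi im]; rewrite vgeE ?F0 //.
have := mmin i Pi; rewrite le_eqVlt => /orP[/eqP e|]; last by lia.
by move: im; rewrite (inj _ _ Pm Pi e) eqxx.
Qed.

Lemma val_ev_trivial v x q : is_val v ->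
  (forall c, x != iota c /\ v (x - iota c) = 0) -> q != 0 ->
  q `@ x != 0 /\ v (q `@ x) = 0.
Proof.
move=> vv xc q0; have [rs [c [c0 ->]]] := poly_linear_factors q0.
rewrite evM evC.
suff [h1 h2] : (\prod_(r <- rs) ('X - r%:P)) `@ x != 0 /\
   v ((\prod_(r <- rs) ('X - r%:P)) `@ x) = 0.
  by rewrite mulf_neq0 ?iota_eq0 // (nuM vv) ?iota_eq0 // (nuC vv) // h2.
elim: rs => [|r rs [h1 h2]]; first by rewrite big_nil ev1 oner_eq0 (nu1 vv).
have [xr vr] := xc r.
by rewrite big_cons evM evXC mulf_neq0 ?subr_eq0 // (nuM vv) ?subr_eq0 // h2 vr.
Qed.

(** The valuation is trivial on [C(x)], so the nonzero terms of the relation have the orders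
    [j * v y]. Unless [v y = 0] these are pairwise distinct, and such terms cannot cancel. *)
Lemma val_algebraic_trivial v x y m (r : 'I_m -> {poly CC}) : is_val v ->
  (forall c, x != iota c /\ v (x - iota c) = 0) ->
  (exists j, r j != 0) -> \sum_(j < m) (r j) `@ x * y ^+ j = 0 ->
  y != 0 -> v y = 0.
Proof.
move=> vv xc [j0 rj0] rel y0; apply/eqP/negPn/negP => vy.
move/eqP: rel; rewrite (bigID (fun j => r j == 0)) /= big1 ?add0r; last first.
  by move=> j /eqP ->; rewrite ev0 mul0r.
apply/negP; apply: (@val_sum_neq0 v _ _ _ j0) => // [j rj|i j ri rj].
  by rewrite mulf_neq0 ?expf_neq0 //; case: (val_ev_trivial vv xc rj).
have [i1 i2] := val_ev_trivial vv xc ri; have [j1 j2] := val_ev_trivial vv xc rj.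
rewrite !(nuM vv) ?expf_neq0 // i2 j2 !add0r !(nuX vv) // => /(mulIf vy) ij.
by apply: val_inj; case: ij.
Qed.

(** Without a residue every [z - c] would have order 0 and [v] would be trivial on [C(z)]. It would
    then be trivial on the elements [t - c], which are algebraic over [C(z)], hence on [C(t)] and on
    all of [K], against the existence of a uniformizer. *)
Lemma residue_exists v z : function_field iota -> is_place iota v ->
  vge v 0 z -> exists c, vge v 1 (z - iota c).
Proof.
move=> [t [tt span]] pv z0; have vv := place_val pv.
apply: contrapT => /forallNP nores.
have zc c : z != iota c /\ v (z - iota c) = 0.
  have zc : z != iota c.
    by apply/eqP => zE; apply: (nores c); rewrite zE subrr vge0.
  split=> //; have := nores c; rewrite vgeE ?subr_eq0 // => /negP.
  have : vge v 0 (z - iota c) by rewrite (vgeB vv) // (vgeC vv).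
  by rewrite vgeE ?subr_eq0 //; lia.
have [m [r [[j0 rj0] rel]]] := algebraic_relation tt span z.
have tc c : t != iota c /\ v (t - iota c) = 0.
  split; first exact: transcendental_nonconst.
  (* The relation of [z] over [C(t)] is expanded in powers of [t - c]. With the roles exchanged it
     is a relation of [t - c] over [C(z)], with coefficients [q i]. *)
  pose r' j := r j \Po ('X + c%:P).
  have r'E j : r j `@ t = r' j `@ (t - iota c).
    rewrite /r' map_comp_poly horner_comp; congr (_.[_]).
    by rewrite evD evX evC subrK.
  pose B := \max_(j < m) size (r' j).
  pose q (i : 'I_B) := \poly_(j < m) oapp (fun j => (r' j)`_i) 0 (insub j).
  have r'j0 : r' j0 != 0 by rewrite /r' comp_poly_eq0 // size_XaddC.
  apply: (@val_algebraic_trivial v z _ B q) => //; last first.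
  - by rewrite subr_eq0 transcendental_nonconst.
  - rewrite -[RHS]rel.
    transitivity (\sum_(i < B) \sum_(j < m) iota (r' j)`_i * z ^+ j * (t - iota c) ^+ i).
      apply: eq_bigr => i _; rewrite -mulr_suml; congr (_ * _).
      rewrite (@horner_coef_wide _ m); last first.
        by rewrite size_map_poly size_poly.
      apply: eq_bigr => j _; rewrite coef_map coef_poly ltn_ord.
      by rewrite valK.
    rewrite exchange_big; apply: eq_bigr => j _.
    rewrite r'E (@horner_coef_wide _ B); last first.
      by rewrite size_map_poly /B (leq_bigmax j).
    rewrite mulr_suml; apply: eq_bigr => i _; rewrite coef_map.
    by rewrite -!mulrA; congr (_ * _); rewrite mulrC.
  have szB : ((size (r' j0)).-1 < B)%N.
    by apply: leq_trans (leq_bigmax j0); rewrite prednK // size_poly_gt0.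
  exists (Ordinal szB); apply: contraNneq r'j0 => /polyP/(_ j0).
  rewrite coef_poly ltn_ord valK coef0 /=.
  by move=> h; rewrite -lead_coef_eq0 lead_coefE h.
have [u u0 vu] := place_uniformizer 1 pv.
have [m' [r' [r'0 rel']]] := algebraic_relation tt span u.
by have := val_algebraic_trivial vv tc r'0 rel' u0; rewrite vu.
Qed.

End Residues.

(** * Subfields, extensions by square roots, and the orders of their elements *)

Section Subfields.
Variables (K : fieldType) (iota : {rmorphism CC -> K}).
Local Notation "p `@ x" := ((map_poly iota p).[x]) (at level 10).
Local Notation is_val := (is_val iota).
Implicit Types (S : K -> Prop) (v w : K -> int) (x y z : K) (p q : {poly CC}) (c : CC).

Definition subfield S : Prop :=
  [/\ forall c, S (iota c), forall x y, S x -> S y -> S (x - y),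
      forall x y, S x -> S y -> S (x * y) & forall x, S x -> S x^-1].

Definition Cx x z : Prop := exists A E : {poly CC}, E `@ x != 0 /\ z = A `@ x / E `@ x.

(** Extensions by square roots are predicates inside one field, so that a valuation of that field
    applies to their elements directly. *)
Definition quad S r z : Prop := exists a b, [/\ S a, S b & z = a + b * r].

Section Closure.
Variable S : K -> Prop.
Hypothesis sS : subfield S.

Lemma sfC c : S (iota c). Proof. by case: sS => + _ _ _; apply. Qed.
Lemma sfB x y : S x -> S y -> S (x - y). Proof. by case: sS => _ + _ _; apply. Qed.
Lemma sfM x y : S x -> S y -> S (x * y). Proof. by case: sS => _ _ + _; apply. Qed.
Lemma sfV x : S x -> S x^-1. Proof. by case: sS => _ _ _; apply. Qed.
Lemma sf0 : S 0. Proof. by rewrite -(rmorph0 iota); apply: sfC. Qed.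
Lemma sf1 : S 1. Proof. by rewrite -(rmorph1 iota); apply: sfC. Qed.
Lemma sfN x : S x -> S (- x).
Proof. by move=> Sx; rewrite -sub0r; apply: sfB => //; apply: sf0. Qed.
Lemma sfD x y : S x -> S y -> S (x + y).
Proof. by move=> Sx Sy; rewrite -(opprK y); apply/sfB/sfN. Qed.
Lemma sf_div x y : S x -> S y -> S (x / y).
Proof. by move=> Sx Sy; apply/sfM/sfV. Qed.
Lemma sfX x n : S x -> S (x ^+ n).
Proof.
by move=> Sx; elim: n => [|n IH]; [apply: sf1|rewrite exprS; apply: sfM].
Qed.
Lemma sf_nat n : S n%:R.
Proof. by rewrite -(rmorph_nat iota); apply: sfC. Qed.
Lemma sf_ev p x : S x -> S (p `@ x).
Proof.
move=> Sx; rewrite ev_coefE; elim/big_ind: _ => [|y z Sy Sz|i _]; first exact: sf0.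
  exact: sfD.
by apply: sfM; [apply: sfC|apply: sfX].
Qed.

Lemma Cx_sub x z : S x -> Cx x z -> S z.
Proof. by move=> Sx [A [E [E0 ->]]]; apply: sf_div; apply: sf_ev. Qed.

Lemma quad_sub x r z : S r -> (forall y, Cx x y -> S y) -> quad (Cx x) r z -> S z.
Proof. by move=> Sr CS [a [b [Ca Cb ->]]]; apply/sfD/sfM/Sr; apply: CS. Qed.

Lemma quad_base r z : S z -> quad S r z.
Proof. by move=> Sz; exists z, 0; rewrite mul0r addr0; split=> //; apply: sf0. Qed.

Lemma quad_gen r : quad S r r.
Proof. by exists 0, 1; rewrite mul1r add0r; split=> //; [apply: sf0|apply: sf1]. Qed.

Lemma quad_subfield r : S (r ^+ 2) -> subfield (quad S r).
Proof.
move=> Sr; split=> [c|x y [a [b [Sa Sb ->]]] [a' [b' [Sa' Sb' ->]]]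
   |x y [a [b [Sa Sb ->]]] [a' [b' [Sa' Sb' ->]]]|x [a [b [Sa Sb ->]]]].
- by apply: quad_base; apply: sfC.
- by exists (a - a'), (b - b'); split; [exact: sfB|exact: sfB|ring].
- exists (a * a' + b * b' * r ^+ 2), (a * b' + b * a'); split; last ring.
    by apply: sfD; [exact: sfM|apply: sfM => //; exact: sfM].
  by apply: sfD; apply: sfM.
(* Since [r] may belong to [S], the norm can vanish; the element is then [2 a] or 0. *)
have [e|ne] := eqVneq (a - b * r) 0.
  have -> : a + b * r = a *+ 2 by rewrite -(subr0_eq e) mulr2n.
  by apply: quad_base; apply: sfV; rewrite mulr2n; apply: sfD.
have [e|ne'] := eqVneq (a + b * r) 0.
  by rewrite e invr0; apply: quad_base; apply: sf0.
have SN : S ((a ^+ 2 - b ^+ 2 * r ^+ 2)^-1).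
  by apply: sfV; apply: sfB; [exact: sfX|apply: sfM => //; exact: sfX].
exists (a * (a ^+ 2 - b ^+ 2 * r ^+ 2)^-1), (- b * (a ^+ 2 - b ^+ 2 * r ^+ 2)^-1).
split; [exact: sfM|by apply: sfM => //; apply: sfN|].
have -> : a ^+ 2 - b ^+ 2 * r ^+ 2 = (a + b * r) * (a - b * r) by ring.
by field; rewrite ne ne'.
Qed.

End Closure.

Lemma Cx_subfield x : subfield (Cx x).
Proof.
split=> [c|y z [A [E [E0 ->]]] [A' [E' [E'0 ->]]]|y z [A [E [E0 ->]]] [A' [E' [E'0 ->]]]
  |y [A [E [E0 ->]]]].
- by exists c%:P, 1; rewrite ev1 oner_eq0 evC divr1.
- exists (A * E' - A' * E), (E * E'); rewrite !evE mulf_neq0 //; split=> //.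
  by field; rewrite E0 E'0.
- exists (A * A'), (E * E'); rewrite !evE mulf_neq0 //; split=> //.
  by field; rewrite E0 E'0.
have [A0|A0] := eqVneq (A `@ x) 0.
  by exists 0, 1; rewrite ev1 oner_eq0 ev0 !mul0r A0 mul0r invr0.
by exists E, A; split=> //; rewrite invf_div.
Qed.

Lemma Cx_gen x : Cx x x.
Proof. by exists 'X, 1; rewrite ev1 oner_eq0 evX divr1. Qed.

Lemma quad_Cx_common x r z : quad (Cx x) r z ->
  exists A B E : {poly CC}, E `@ x != 0 /\ z * E `@ x = A `@ x + B `@ x * r.
Proof.
move=> [a [b [[A [E [E0 ->]]] [B [E' [E'0 ->]]] ->]]].
exists (A * E'), (B * E), (E * E'); rewrite !evE mulf_neq0 //; split=> //.
by field; rewrite E0 E'0.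
Qed.

Definition int_subgroup (V : int -> Prop) : Prop :=
  V 0 /\ forall m n, V m -> V n -> V (m - n).

Lemma sgN V m : int_subgroup V -> V m -> V (- m).
Proof. by move=> [V0 VB] Vm; rewrite -sub0r; apply: VB. Qed.
Lemma sgD V m n : int_subgroup V -> V m -> V n -> V (m + n).
Proof.
move=> sV Vm Vn; rewrite -(opprK n); have [_ VB] := sV; apply: VB => //.
exact: sgN.
Qed.
Lemma sgM V m (n : nat) : int_subgroup V -> V m -> V (n%:Z * m).
Proof.
move=> sV Vm; elim: n => [|n IH]; first by rewrite mul0r; case: sV.
by rewrite intS mulrDl mul1r; apply: sgD.
Qed.

(* If the conjugates a + b r and a - b r have different orders, the smaller one
   is the order of a; if they have the same order it is that of a or of b r. *)
Lemma quad_orders S V v r z : subfield S -> int_subgroup V -> is_val v ->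
  S (r ^+ 2) -> (forall a, S a -> a != 0 -> V (v a)) -> (r != 0 -> V (v r)) ->
  quad S r z -> z != 0 -> V (v z).
Proof.
move=> sS sV vv Sr VS Vr [a [b [Sa Sb ->]]].
have [->|a0] := eqVneq a 0.
  rewrite add0r mulf_eq0 negb_or => /andP[b0 r0].
  by rewrite (nuM vv) //; apply: sgD => //; [apply: VS|apply: Vr].
have [->|b0] := eqVneq b 0; first by rewrite mul0r addr0 => _; apply: VS.
have [r0|r0] := eqVneq r 0; first by rewrite r0 mulr0 addr0 => _; apply: VS.
clear z; set z := a + b * r => z0; pose z' := a - b * r.
have b20 : b * r != 0 by rewrite mulf_neq0.
have Vb : V (v (b * r)) by rewrite (nuM vv) //; apply: sgD => //; [apply: VS|apply: Vr].
have two0 : 2%:R != 0 :> K by exact: natK_neq0 iota 1.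
have [e|z'0] := eqVneq z' 0.
  have -> : z = a * 2%:R by rewrite -[z]addr0 -e /z /z'; ring.
  by rewrite (nuM vv) ?(nu_natr vv 1) ?addr0 //; apply: VS.
have Vzz' : V (v z + v z').
  rewrite -(nuM vv) //.
  have zz' : z * z' = a ^+ 2 - b ^+ 2 * r ^+ 2 by rewrite /z /z'; ring.
  have : z * z' != 0 by rewrite mulf_neq0.
  rewrite zz'; apply: VS; apply: (sfB sS); first exact: (sfX sS).
  by apply: (sfM sS) => //; apply: (sfX sS).
have va : v a = v (z + z').
  have -> : z + z' = a * 2%:R by rewrite /z /z'; ring.
  by rewrite (nuM vv) ?(nu_natr vv 1) ?addr0.
have Va : V (v a) by apply: VS.
have Vmin : V (v z) \/ V (v z').
  have [lt|gt|e] := ltgtP (v z) (v z').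
  - left; have [] := val_addl vv (y := z') z0; first by rewrite vgeE //; lia.
    by move=> _ <-; rewrite -va.
  - right; have [] := val_addl vv (y := z) z'0; first by rewrite vgeE //; lia.
    by move=> _; rewrite addrC => <-; rewrite -va.
  have h1 : v z <= v a.
    have : vge v (v z) (z + z') by rewrite (vgeD vv) // vgeE // ?e.
    by rewrite vgeE // ?va // /z /z' addrACA subrr addr0 -mulr2n -mulr_natl mulf_neq0.
  have h2 : v z <= v (b * r).
    have : vge v (v z) (z - z') by rewrite (vgeB vv) // vgeE // ?e.
    have -> : z - z' = (b * r) * 2%:R by rewrite /z /z'; ring.
    by rewrite vgeE ?mulf_neq0 // (nuM vv) ?mulf_neq0 // (nu_natr vv 1) addr0.
  have [ea|na] := eqVneq (v z) (v a); first by left; rewrite ea.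
  have [eb|nb] := eqVneq (v z) (v (b * r)); first by left; rewrite eb.
  have : vge v (v z + 1) z by rewrite {2}/z (vgeD vv) // vgeE //; lia.
  by rewrite vgeE //; lia.
case: Vmin => // Vz'.
by have := sV; case=> _ VB; have := VB _ _ Vzz' Vz'; rewrite addrK.
Qed.

Lemma ev_orders_finite V v x c p : int_subgroup V -> is_val v ->
  x != iota c -> vge v 1 (x - iota c) -> V (v (x - iota c)) ->
  p `@ x != 0 -> V (v (p `@ x)).
Proof.
move=> sV vv xc hx Vx px.
have p0 : p != 0 by apply: contraNneq px => ->; rewrite ev0.
have [m [q]] := multiplicity_XsubC p c; rewrite p0 /= => qc pE.
have [q0 vq] := val_ev_unit vv hx qc.
rewrite pE evM evXn evXC (nuM vv) ?expf_neq0 ?subr_eq0 // vq add0r (nuX vv) ?subr_eq0 //.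
exact: sgM.
Qed.

Lemma ev_orders_pole V v x p : int_subgroup V -> is_val v ->
  x != 0 -> v x < 0 -> V (v x) -> p `@ x != 0 -> V (v (p `@ x)).
Proof.
move=> sV vv x0 vx Vx px.
have p0 : p != 0 by apply: contraNneq px => ->; rewrite ev0.
by have [_ ->] := val_ev_pole vv x0 vx p0; apply: sgM.
Qed.

Lemma Cx_orders V v x z : int_subgroup V -> is_val v ->
  (forall p, p `@ x != 0 -> V (v (p `@ x))) -> Cx x z -> z != 0 -> V (v z).
Proof.
move=> sV vv H [A [E [E0 ->]]]; rewrite mulf_eq0 negb_or => /andP[A0 _].
by rewrite (nuf vv) //; have [_ VB] := sV; apply: VB; apply: H.
Qed.

End Subfields.

Section SubfieldType.
Variables (K : fieldType) (iota : {rmorphism CC -> K}) (S : K -> Prop).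
Hypothesis sS : subfield iota S.

Definition sf_pred : {pred K} := fun x => `[< S x >].
Lemma sf_divring_closed : divring_closed sf_pred.
Proof.
split=> [|x y /asboolP h /asboolP k|x y /asboolP h /asboolP k]; apply/asboolP.
- exact: sf1 sS.
- exact: (sfB sS).
exact: (sf_div sS).
Qed.
HB.instance Definition _ := GRing.isDivringClosed.Build K sf_pred sf_divring_closed.

Record sf_sub := SfSub { sf_val :> K; sf_valP : sf_val \in sf_pred }.
HB.instance Definition _ := [isSub for sf_val].
HB.instance Definition _ := [Choice of sf_sub by <:].
HB.instance Definition _ := [SubChoice_isSubComUnitRing of sf_sub by <:].
HB.instance Definition _ := [SubComUnitRing_isSubIntegralDomain of sf_sub by <:].
HB.instance Definition _ := [SubIntegralDomain_isSubField of sf_sub by <:].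

Lemma sf_iotaP c : iota c \in sf_pred.
Proof. by apply/asboolP; apply: sfC sS _. Qed.
Definition sf_iota (c : CC) : sf_sub := SfSub (sf_iotaP c).
Lemma sf_iota_zmod : zmod_morphism sf_iota.
Proof. by move=> x y; apply: val_inj; rewrite /= !rmorphB. Qed.
Lemma sf_iota_monoid : monoid_morphism sf_iota.
Proof. by split=> [|x y]; apply: val_inj; rewrite /= ?rmorph1 ?rmorphM. Qed.
HB.instance Definition _ := GRing.isZmodMorphism.Build CC sf_sub sf_iota sf_iota_zmod.
HB.instance Definition _ := GRing.isMonoidMorphism.Build CC sf_sub sf_iota sf_iota_monoid.

(** Makes a field type out of a predicate, so that results stated for whole fields apply to [C(t)]
    in [integral_over_Cx] and to [C(x, y)] in [E1_at_infinity]. *)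
Lemma subfield_type : exists (E : fieldType) (iE : {rmorphism CC -> E})
  (j : {rmorphism E -> K}), (forall c, j (iE c) = iota c) /\
  (forall z, S z -> exists e, z = j e) /\ (forall e, S (j e)).
Proof.
exists sf_sub, sf_iota, (val : {rmorphism sf_sub -> K}); split=> //; split.
  by move=> z /asboolP h; exists (SfSub h).
by move=> e; apply/asboolP; apply: sf_valP.
Qed.
End SubfieldType.

Lemma min_sub_le (a b m d : nat) : (minn a b <= m)%N ->
  Num.min (a%:Z - d%:Z) (b%:Z - d%:Z) <= m%:Z - d%:Z.
Proof. by lia. Qed.

(** * Construction of a place ramified over a simple root of the discriminant *)

Section RamifiedPlace.
Variables (K : fieldType) (iota : {rmorphism CC -> K}).
Local Notation "p `@ x" := ((map_poly iota p).[x]) (at level 10).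
Variables (t r : K) (c : CC) (D D1 : {poly CC}).
Hypothesis tt : transcendental iota t.
Hypothesis D1c : D1.[c] != 0.
Hypothesis DE : D = ('X - c%:P) * D1.
Hypothesis rD : r ^+ 2 = D `@ t.
Hypothesis gen : forall z, quad (Cx iota t) r z.

Local Notation pi := ('X - c%:P : {poly CC}).
Let pi0 : pi != 0. Proof. by rewrite polyXsubC_eq0. Qed.
Let nrm (A B : {poly CC}) := A ^+ 2 - B ^+ 2 * D.

Let dvd_root (p : {poly CC}) : p.[c] = 0 -> pi %| p.
Proof. by move=> h; rewrite dvdp_XsubCl /root h. Qed.

(** [D] has a simple zero at [c], so there [A ^+ 2] has even and [B ^+ 2 * D] odd order. The two
    orders never tie, and a power of [pi] divides the norm only if it divides both terms. *)
Lemma norm_dvdP k (A B : {poly CC}) : pi ^+ k %| nrm A B ->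
  (pi ^+ (uphalf k) %| A) /\ (pi ^+ k./2 %| B).
Proof.
have [n] := ubnP k; elim: n => // n IH in k A B *.
case: k => [|[|k]] kn h; first by rewrite !expr0 !dvd1p.
  split; last by rewrite dvd1p.
  apply: dvd_root; move: h; rewrite expr1 dvdp_XsubCl /root /nrm DE !(hornerD, hornerN, horner_exp, hornerM, hornerXsubC, hornerX, hornerC) subrr.
  by rewrite mul0r mulr0 subr0 expf_eq0 => /eqP.
have /dvdpP[A' AE] : pi %| A.
  apply: dvd_root; have := dvdp_trans (dvdp_exp2l pi (isT : (1 <= k.+2)%N)) h.
  rewrite expr1 dvdp_XsubCl /root /nrm DE !(hornerD, hornerN, horner_exp, hornerM, hornerXsubC, hornerX, hornerC) subrr.
  by rewrite mul0r mulr0 subr0 expf_eq0 => /eqP.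
have h1 : pi ^+ k.+1 %| A' ^+ 2 * pi - B ^+ 2 * D1.
  rewrite -(@dvdp_mul2r _ pi) // -exprSr.
  by apply: dvdp_trans h _; rewrite /nrm AE DE (_ : _ - _ = (A' ^+ 2 * pi - B ^+ 2 * D1) * pi) //; ring.
have /dvdpP[B' BE] : pi %| B.
  apply: dvd_root; have := dvdp_trans (dvdp_exp2l pi (isT : (1 <= k.+1)%N)) h1.
  rewrite expr1 dvdp_XsubCl /root !(hornerD, hornerN, horner_exp, hornerM, hornerXsubC, hornerX, hornerC) subrr mulr0 sub0r oppr_eq0.
  by rewrite mulf_eq0 (negPf D1c) orbF expf_eq0 => /eqP.
have h2 : pi ^+ k %| nrm A' B'.
  rewrite -(@dvdp_mul2r _ pi) // -exprSr.
  apply: dvdp_trans h1 _; rewrite BE /nrm DE.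
  by rewrite (_ : _ - _ = (A' ^+ 2 - B' ^+ 2 * (pi * D1)) * pi) //; ring.
have [//|hA hB] := IH k A' B' _ h2; first by lia.
by rewrite AE BE /= !exprSr !dvdp_mul2r.
Qed.

Lemma dvd_normP k (A B : {poly CC}) :
  (pi ^+ (uphalf k) %| A) -> (pi ^+ k./2 %| B) -> pi ^+ k %| nrm A B.
Proof.
move=> /dvdpP[A' ->] /dvdpP[B' ->]; rewrite /nrm.
apply: dvdp_sub.
  apply: dvdp_trans (dvdp_exp2l pi (_ : k <= (uphalf k).*2)%N) _; first by lia.
  by rewrite exprMn -exprM muln2 dvdp_mulIr.
apply: dvdp_trans (dvdp_exp2l pi (_ : k <= (k./2).*2.+1)%N) _; first by lia.
rewrite exprMn -exprM muln2 DE.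
rewrite exprS; move: (pi ^+ _.*2) => q.
by rewrite (_ : B' ^+ 2 * _ * _ = (B' ^+ 2 * D1) * (pi * q)) ?dvdp_mulIr //; ring.
Qed.

Lemma norm_eq0 (A B : {poly CC}) : nrm A B = 0 -> A = 0 /\ B = 0.
Proof.
move=> N0.
suff H (p : {poly CC}) : (forall k, pi ^+ k %| p) -> p = 0.
  by split; apply: H => k; have := @norm_dvdP k.*2 A B;
    rewrite N0 dvdp0 uphalf_double doubleK => /(_ isT) [].
move=> H; apply/eqP/negPn/negP => p0.
have := dvdp_leq p0 (H (size p)).
by rewrite size_exp_XsubC ltnn.
Qed.

(** Only one place lies over [c] and it is ramified, so the order there of [(A + B r) / E] is the
    order at [c] of the norm of [A + B r], with [E] counted twice. *)
Let value (A B E : {poly CC}) : int := (mup c (nrm A B))%:Z - ((mup c E).*2)%:Z.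

Let represents (z : K) (f : {poly CC} * {poly CC} * {poly CC}) : Prop :=
  f.2 != 0 /\ z * f.2 `@ t = f.1.1 `@ t + f.1.2 `@ t * r.

Let ev_eq0 p : p `@ t = 0 -> p = 0. Proof. exact: tt. Qed.

Let ev_norm A B : (nrm A B) `@ t = (A `@ t + B `@ t * r) * (A `@ t - B `@ t * r).
Proof. by rewrite /nrm !evE -rD; ring. Qed.

Let rep_neq0 z A B E : represents z (A, B, E) -> z != 0 -> nrm A B != 0.
Proof.
move=> [/= E0 zE] z0; apply/eqP => /norm_eq0[A0 B0].
move: zE; rewrite A0 B0 !ev0 mul0r addr0 => /eqP.
by rewrite mulf_eq0 (negPf z0) (negPf (transcendental_ev_neq0 tt E0)).
Qed.

Let rep_uniq z A B E A' B' E' : represents z (A, B, E) -> represents z (A', B', E') ->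
  A * E' = A' * E /\ B * E' = B' * E.
Proof.
move=> [/= E0 zE] [/= E'0 zE'].
have : (A * E' - A' * E) `@ t + (B * E' - B' * E) `@ t * r = 0.
  rewrite !evE; transitivity ((A `@ t + B `@ t * r) * E' `@ t
     - (A' `@ t + B' `@ t * r) * E `@ t); first ring.
  by rewrite -zE -zE'; ring.
move=> h; have : nrm (A * E' - A' * E) (B * E' - B' * E) = 0.
  by apply: ev_eq0; rewrite ev_norm h mul0r.
by move/norm_eq0 => [/subr0_eq -> /subr0_eq ->].
Qed.

Let value_uniq z A B E A' B' E' : z != 0 ->
  represents z (A, B, E) -> represents z (A', B', E') -> value A B E = value A' B' E'.
Proof.
move=> z0 h h'; have [eA eB] := rep_uniq h h'.
have N0 := rep_neq0 h z0; have N'0 := rep_neq0 h' z0.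
have [/= E0 _] := h; have [/= E'0 _] := h'.
have : nrm A B * E' ^+ 2 = nrm A' B' * E ^+ 2.
  transitivity ((A * E') ^+ 2 - (B * E') ^+ 2 * D); first by rewrite /nrm; ring.
  by rewrite eA eB /nrm; ring.
move/(congr1 (mup c)); rewrite !expr2 !mupM ?mulf_neq0 // /value; lia.
Qed.

Let exists_rep z : exists f, represents z f.
Proof.
have [A [B [E [E0 zE]]]] := quad_Cx_common (gen z).
exists (A, B, E); split=> //=; by apply: contraNneq E0 => ->; rewrite ev0.
Qed.

Let rep_poly A B : represents (A `@ t + B `@ t * r) (A, B, 1).
Proof. by split; [exact: oner_neq0|rewrite ev1 mulr1]. Qed.

Lemma ramified_place : exists P, is_place iota P /\ P (t - iota c) = 2.
Proof.
have /choice[f hf] := exists_rep.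
pose P z := value (f z).1.1 (f z).1.2 (f z).2.
have PE z A B E : z != 0 -> represents z (A, B, E) -> P z = value A B E.
  move=> z0 h; apply: (@value_uniq z) => //.
  by have := hf z; case: (f z) => [[? ?] ?].
have rep z : exists A B E, represents z (A, B, E).
  by have := hf z; case: (f z) => [[A B] E]; exists A, B, E.
have PM x y : x != 0 -> y != 0 -> P (x * y) = P x + P y.
  move=> x0 y0; have [A [B [E hx]]] := rep x; have [A' [B' [E' hy]]] := rep y.
  have hxy : represents (x * y) (A * A' + B * B' * D, A * B' + A' * B, E * E').
    case: hx => /= [E0 xE]; case: hy => /= [E'0 yE]; split=> /=; first by rewrite mulf_neq0.
    rewrite !evE -rD; transitivity (x * E `@ t * (y * E' `@ t)); first ring.
    by rewrite xE yE; ring.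
  rewrite (PE _ _ _ _ x0 hx) (PE _ _ _ _ y0 hy) (PE _ _ _ _ _ hxy) ?mulf_neq0 // /value.
  have -> : nrm (A * A' + B * B' * D) (A * B' + A' * B) = nrm A B * nrm A' B'.
    by rewrite /nrm; ring.
  have [/= E0 _] := hx; have [/= E'0 _] := hy.
  rewrite !mupM ?(rep_neq0 hx) ?(rep_neq0 hy) //; lia.
have PD x y : x != 0 -> y != 0 -> x + y != 0 -> Num.min (P x) (P y) <= P (x + y).
  move=> x0 y0 xy0; have [A [B [E hx]]] := rep x; have [A' [B' [E' hy]]] := rep y.
  have [/= E0 xE] := hx; have [/= E'0 yE] := hy.
  have hx' : represents x (A * E', B * E', E * E').
    by split=> /=; rewrite ?mulf_neq0 // !evE mulrA xE; ring.
  have hy' : represents y (A' * E, B' * E, E * E').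
    by split=> /=; rewrite ?mulf_neq0 // !evE mulrCA yE; ring.
  have hxy : represents (x + y) (A * E' + A' * E, B * E' + B' * E, E * E').
    split=> /=; first by rewrite mulf_neq0.
    by rewrite !evE; transitivity (x * E `@ t * E' `@ t + y * E' `@ t * E `@ t);
       [ring|rewrite xE yE; ring].
  rewrite (PE _ _ _ _ x0 hx') (PE _ _ _ _ y0 hy') (PE _ _ _ _ xy0 hxy) /value.
  have N1 := rep_neq0 hx' x0; have N2 := rep_neq0 hy' y0; have N3 := rep_neq0 hxy xy0.
  set m1 := mup c (nrm (A * E') _); set m2 := mup c (nrm (A' * E) _).
  have : (minn m1 m2 <= mup c (nrm (A * E' + A' * E) (B * E' + B' * E)))%N; last first.
    exact: min_sub_le.
  rewrite mup_geq //.
  (* The norm is not additive, but by [norm_dvdP] and [dvd_normP] its divisibility by a power of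
     [pi] is a divisibility condition on each coordinate, and these conditions are stable under
     addition. *)
  have [u1 u2] : (pi ^+ (uphalf (minn m1 m2)) %| A * E') /\ (pi ^+ (minn m1 m2)./2 %| B * E').
    by apply: norm_dvdP; rewrite -mup_geq // geq_minl.
  have [w1 w2] : (pi ^+ (uphalf (minn m1 m2)) %| A' * E) /\ (pi ^+ (minn m1 m2)./2 %| B' * E).
    by apply: norm_dvdP; rewrite -mup_geq // geq_minr.
  by apply: dvd_normP; apply: dvdp_add.
have PC a : a != 0 -> P (iota a) = 0.
  move=> a0; rewrite (@PE _ a%:P 0 1) ?iota_eq0 //.
    rewrite /value /nrm expr0n mul0r subr0 -rmorphXn mupNroot ?mupNroot ?rootC ?oner_eq0 //.
    by rewrite expf_neq0.
  by have := rep_poly a%:P 0; rewrite evC ev0 mul0r addr0.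
have PT : P (t - iota c) = 2.
  have h0 : t - iota c != 0 by rewrite subr_eq0 transcendental_nonconst.
  rewrite (@PE _ pi 0 1) //.
    rewrite /value /nrm expr0n mul0r subr0 mup_XsubCX eqxx /= mupNroot //.
    by rewrite rootC oner_eq0.
  by have := rep_poly pi 0; rewrite evXC ev0 mul0r addr0.
have r0 : r != 0.
  apply/eqP => r0; have : (D `@ t) != 0.
    rewrite DE; apply: transcendental_ev_neq0 => //; rewrite mulf_neq0 //.
    by apply: contraNneq D1c => ->; rewrite horner0.
  by rewrite -rD r0 expr0n eqxx.
have PR : P r = 1.
  rewrite (@PE _ 0 1 1) //.
    rewrite /value; have -> : nrm 0 1 = (-1)%:P * D by rewrite /nrm rmorphN; ring.
    have m1 : mup c (1 : {poly CC}) = 0%N by rewrite mupNroot // rootC oner_neq0.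
    have mpi : mup c pi = 1%N by have := @mup_XsubCX _ 1 c c; rewrite expr1 eqxx.
    have c1 : ~~ root (-1)%:P c by rewrite rootC oppr_eq0 oner_neq0.
    by rewrite m1 mupMr // DE mupMl // mpi.
  have h := rep_poly 0 1; have e : 0 `@ t + 1 `@ t * r = r by rewrite ev1 mul1r ev0 add0r.
  by rewrite e in h; exact: h.
exists P; split=> //.
have vP : is_val iota P by [].
split=> // -[n|n].
  by exists (r ^+ n); rewrite expf_neq0 // (nuX vP) // PR mulr1.
exists ((r ^+ n.+1)^-1); rewrite invr_eq0 expf_neq0 //; split=> //.
by rewrite (nuV vP) ?expf_neq0 // (nuX vP) // PR mulr1 NegzE.
Qed.

End RamifiedPlace.

(** * Places of a quadratic extension of C(s), determined by their centre *)

Section PlaceUniqueness.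
Variables (K : fieldType) (iota : {rmorphism CC -> K}).
Local Notation "p `@ x" := ((map_poly iota p).[x]) (at level 10).
Implicit Types (v w : K -> int) (c : CC).

(* A place is normalized, so it is determined by integers k(z) such that it maps
   z to k(z) v(t): then v(t) = 1. *)
Lemma places_with_uniformizer (Q : (K -> int) -> Prop) (t : K) :
  (forall v, Q v -> is_place iota v /\ 0 < v t) ->
  (forall z, z != 0 -> exists k : int, forall v, Q v -> v z = k * v t) ->
  (forall v, Q v -> v t = 1) /\ (forall v w, Q v -> Q w -> same_place v w).
Proof.
move=> QP Qk.
have Q1 v : Q v -> v t = 1.
  move=> Qv; have [pv vt] := QP v Qv.
  have [x x0 vx] := place_uniformizer 1 pv.
  have [k hk] := Qk x x0; have := hk v Qv; rewrite vx => e.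
  have kp : 0 < k by rewrite -(pmulr_lgt0 _ vt) -e.
  by nia.
split=> // v w Qv Qw z z0.
by have [k hk] := Qk z z0; rewrite (hk v Qv) (hk w Qw) !Q1.
Qed.

Variables (s u : K) (D : {poly CC}).
Hypothesis st : transcendental iota s.
Hypothesis uD : u ^+ 2 = D `@ s.
Hypothesis gen : forall z, quad (Cx iota s) u z.

Lemma from_poly_elements (Q : (K -> int) -> Prop) (t : K) :
  (forall v, Q v -> is_place iota v) ->
  (forall A B, A `@ s + B `@ s * u != 0 ->
     exists k : int, forall v, Q v -> v (A `@ s + B `@ s * u) = k * v t) ->
  forall z, z != 0 -> exists k : int, forall v, Q v -> v z = k * v t.
Proof.
move=> QP H z z0; have [A [B [E [E0 zE]]]] := quad_Cx_common (gen z).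
have n0 : A `@ s + B `@ s * u != 0 by rewrite -zE mulf_neq0.
have [k hk] := H A B n0.
have [|k' hk'] := H E 0; first by rewrite ev0 mul0r addr0.
exists (k - k') => v Qv; have vv := place_val (QP v Qv).
have := hk' v Qv; rewrite ev0 mul0r addr0 => e'.
have := hk v Qv; rewrite -zE (nuM vv) // e' => e.
by rewrite mulrBl -e addrK.
Qed.

Let xc c : s - iota c != 0.
Proof. by rewrite subr_eq0 transcendental_nonconst. Qed.

Section Unramified.
Variables (c u0 : CC).
Hypothesis u00 : u0 != 0.

Definition centred v := [/\ is_place iota v, vge v 1 (s - iota c) & vge v 1 (u - iota u0)].

(* Either A + B u is a unit at the centre, or s - c divides A and B, or A - B u is a
   unit and A + B u has the order of the norm A^2 - B^2 D. *)
Lemma centred_orders (A B : {poly CC}) : A `@ s + B `@ s * u != 0 ->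
   exists k : int, forall v, centred v -> v (A `@ s + B `@ s * u) = k * v (s - iota c).
Proof.
have [n] := ubnP (size A + size B); elim: n => // n IH in A B * => szn z0.
have unit_val v A' B' : centred v -> A'.[c] + B'.[c] * u0 != 0 ->
    A' `@ s + B' `@ s * u != 0 /\ v (A' `@ s + B' `@ s * u) = 0.
  move=> [pv vs vu] g0; have vv := place_val pv.
  apply: (val_unit_const vv g0).
  by apply: (resD vv); [|apply: (resM vv) => //]; apply: (res_ev vv).
have [g0|g0] := eqVneq (A.[c] + B.[c] * u0) 0; last first.
  by exists 0 => v Qv; rewrite mul0r; case: (unit_val v A B Qv g0).
have [B0|B0] := eqVneq B.[c] 0.
  have /factor_theorem[A' AE] : root A c.
    by rewrite /root; move: g0; rewrite B0 mul0r addr0 => ->.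
  have /factor_theorem[B' BE] : root B c by rewrite /root B0.
  have zE : A `@ s + B `@ s * u = (A' `@ s + B' `@ s * u) * (s - iota c).
    by rewrite AE BE !evM !evXC; ring.
  have z'0 : A' `@ s + B' `@ s * u != 0.
    by apply: contraNneq z0; rewrite zE => ->; rewrite mul0r.
  have [||k hk] := IH A' B' _ _ => //.
    have szM (p : {poly CC}) : p != 0 -> size (p * ('X - c%:P)) = (size p).+1.
      by move=> p0; rewrite size_Mmonic ?monicXsubC // size_XsubC addn2.
    have [A'0|A'0] := eqVneq A' 0; have [B'0|B'0] := eqVneq B' 0.
    - by move: z'0; rewrite A'0 B'0 !ev0 mul0r addr0 eqxx.
    - by move: szn; rewrite AE BE A'0 mul0r size_poly0 szM //; lia.
    - by move: szn; rewrite AE BE B'0 mul0r size_poly0 szM //; lia.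
    by move: szn; rewrite AE BE !szM //; lia.
  exists (k + 1) => v Qv; have [pv _ _] := Qv; have vv := place_val pv.
  by rewrite zE (nuM vv) // hk // mulrDl mul1r.
have conj0 : A.[c] + (- B).[c] * u0 != 0.
  rewrite hornerN (_ : A.[c] = - (B.[c] * u0)); last by apply/eqP; rewrite -addr_eq0 g0.
  rewrite mulNr -opprD oppr_eq0 -mulr2n -mulr_natl !mulf_neq0 //.
  exact: (CC_nat_neq0 1).
have [zbar0|zbar0] := eqVneq (A `@ s + (- B) `@ s * u) 0.
  exists 0 => v Qv; case: (unit_val v A (- B) Qv conj0).
  by rewrite zbar0 eqxx.
pose N := A ^+ 2 - B ^+ 2 * D.
have NE : N `@ s = (A `@ s + B `@ s * u) * (A `@ s + (- B) `@ s * u).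
  by rewrite /N !evE -uD; ring.
have N0 : N != 0.
  by apply/eqP => N0; have := mulf_neq0 z0 zbar0; rewrite -NE N0 ev0 eqxx.
have [m [q]] := multiplicity_XsubC N c; rewrite N0 /= => qc NqE.
exists m%:Z => v Qv; have [pv vs vu] := Qv; have vv := place_val pv.
have [_ vbar] := unit_val v A (- B) Qv conj0.
have := congr1 v NE; rewrite (nuM vv) // vbar addr0 => <-.
have [q0 vq] := val_ev_unit vv vs qc.
by rewrite NqE evM evXn evXC (nuM vv) ?expf_neq0 // vq add0r (nuX vv).
Qed.

Lemma unramified_centre :
  (forall v, centred v -> v (s - iota c) = 1) /\
  (forall v w, centred v -> centred w -> same_place v w).
Proof.
apply: places_with_uniformizer => [v [pv vs _]|].
  by split=> //; move: vs; rewrite vgeE //; lia.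
by apply: from_poly_elements => [v []|]; last exact: centred_orders.
Qed.
End Unramified.

(** Even and odd multiples of [v t] never tie, so the order of the sum is [v t] times a number
    computed from [a] and [b] alone. That number is then the same for all places with the given
    centre, as [places_with_uniformizer] requires. *)
Lemma parity_sum v (x y t : K) (a b : int) : is_val iota v ->
  (x != 0 -> v x = (2 * a) * v t) -> (y != 0 -> v y = (2 * b + 1) * v t) -> 0 < v t ->
  x + y != 0 ->
  v (x + y) = (if x == 0 then 2 * b + 1 else if y == 0 then 2 * a
    else Num.min (2 * a) (2 * b + 1)) * v t.
Proof.
move=> vv hx hy t0; have [->|x0] := eqVneq x 0; first by rewrite add0r => /hy.
have [->|y0] := eqVneq y 0; first by rewrite addr0 => _; apply: hx.
move=> _; have [lt|ge] := ltP (2 * a) (2 * b + 1).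
  rewrite -(hx x0); have [] // := @val_addl _ _ _ vv x y x0.
  by rewrite vgeE // hx // hy //; nia.
rewrite -(hy y0) addrC; have [] // := @val_addl _ _ _ vv y x y0.
by rewrite vgeE // hx // hy //; nia.
Qed.

Section Branch.
Variables (c : CC).
Hypothesis (Dc : D.[c] = 0) (D'c : D^`().[c] != 0).

Lemma branch_orders v : is_place iota v -> vge v 1 (s - iota c) ->
  u != 0 /\ v (s - iota c) = 2 * v u.
Proof.
move=> pv vs; have vv := place_val pv.
have [D0 vD] := val_ev_simple vv (transcendental_nonconst c st) vs Dc D'c.
have u0 : u != 0 by apply: contraNneq D0; rewrite -uD => ->; rewrite expr0n.
by split=> //; rewrite -vD -uD (nuX vv).
Qed.

Lemma branch_centre :
  (forall v, is_place iota v -> vge v 1 (s - iota c) -> v u = 1) /\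
  (forall v w, is_place iota v -> vge v 1 (s - iota c) ->
     is_place iota w -> vge w 1 (s - iota c) -> same_place v w).
Proof.
pose Q v := is_place iota v /\ vge v 1 (s - iota c).
have [] := @places_with_uniformizer Q u.
- move=> v [pv vs]; split=> //; have [_ e] := branch_orders pv vs.
  by move: vs; rewrite vgeE // e; lia.
- apply: from_poly_elements => [v []//|A B z0].
  exists (if A `@ s == 0 then 2 * (mup c B)%:Z + 1 else
    if B `@ s * u == 0 then 2 * (mup c A)%:Z
    else Num.min (2 * (mup c A)%:Z) (2 * (mup c B)%:Z + 1)).
  move=> v [pv vs]; have vv := place_val pv.
  have [u0 e] := branch_orders pv vs.
  have t0 : 0 < v u by move: vs; rewrite vgeE // e; lia.
  have ord p : p `@ s != 0 -> v (p `@ s) = (2 * (mup c p)%:Z) * v u.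
    move=> ps; have p0 : p != 0 by apply: contraNneq ps => ->; rewrite ev0.
    have [m [q]] := multiplicity_XsubC p c; rewrite p0 /= => qc pE.
    have [q0 vq] := val_ev_unit vv vs qc.
    have -> : mup c p = m by rewrite pE mupMr // mup_XsubCX eqxx.
    by rewrite pE evM evXn evXC (nuM vv) ?expf_neq0 // vq add0r (nuX vv) // e; ring.
  apply: parity_sum => // [/ord //|].
  rewrite mulf_eq0 negb_or => /andP[B0 _].
  by rewrite (nuM vv) // ord //; ring.
by move=> h1 h2; split=> [v pv vs|v w pv vs pw ws]; [apply: h1|apply: h2].
Qed.
End Branch.

Section Infinity.
Variables (m : nat).
Hypothesis szD : size D = m.*2.+2.

(** [D] has odd degree [2 m + 1], so [2 * v u = (2 m + 1) * v s], and [s ^+ m / u] serves as local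
    parameter at infinity. *)
Lemma infinity_orders v : is_place iota v -> v s < 0 ->
  [/\ u != 0, v s = - 2 * v (s ^+ m / u) & v u = - (2 * m%:Z + 1) * v (s ^+ m / u)].
Proof.
move=> pv vs; have vv := place_val pv.
have s0 : s != 0 by have := xc 0; rewrite rmorph0 subr0.
have D0 : D != 0 by rewrite -size_poly_eq0 szD.
have [Ds0 vD] := val_ev_pole vv s0 vs D0.
have u0 : u != 0 by apply: contraNneq Ds0; rewrite -uD => ->; rewrite expr0n.
move: vD; rewrite -uD (nuX vv) // szD /= => e.
by split; rewrite // (nuf vv) ?expf_neq0 // (nuX vv) //; nia.
Qed.

Lemma infinity_centre :
  (forall v, is_place iota v -> v s < 0 -> v s = -2) /\
  (forall v w, is_place iota v -> v s < 0 -> is_place iota w -> w s < 0 -> same_place v w).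
Proof.
pose Q v := is_place iota v /\ v s < 0.
have [] := @places_with_uniformizer Q (s ^+ m / u).
- by move=> v [pv vs]; split=> //; have [_ e _] := infinity_orders pv vs; lia.
- apply: from_poly_elements => [v []//|A B z0].
  exists (if A `@ s == 0 then 2 * (- ((size B).-1)%:Z - m%:Z - 1) + 1 else
    if B `@ s * u == 0 then 2 * (- ((size A).-1)%:Z)
    else Num.min (2 * (- ((size A).-1)%:Z)) (2 * (- ((size B).-1)%:Z - m%:Z - 1) + 1)).
  move=> v [pv vs]; have vv := place_val pv.
  have [u0 es eu] := infinity_orders pv vs.
  have s0 : s != 0 by have := xc 0; rewrite rmorph0 subr0.
  have ord p : p `@ s != 0 -> v (p `@ s) = 2 * (- ((size p).-1)%:Z) * v (s ^+ m / u).
    move=> ps; have p0 : p != 0 by apply: contraNneq ps => ->; rewrite ev0.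
    by have [_ ->] := val_ev_pole vv s0 vs p0; rewrite es; ring.
  apply: parity_sum => // [/ord //||]; last by lia.
  rewrite mulf_eq0 negb_or => /andP[B0 _].
  by rewrite [v (B `@ s * u)](nuM vv) // ord // eu; ring.
move=> h1 h2; split=> [v pv vs|v w pv vs pw ws]; last by apply: h2.
by have [_ -> _] := infinity_orders pv vs; rewrite h1.
Qed.
End Infinity.

End PlaceUniqueness.

(** * Finite extensions of function fields *)

Section Extensions.

Lemma irreducible_divisor (F : fieldType) (p : {poly F}) : (1 < size p)%N ->
  exists q, irreducible_poly q /\ q %| p.
Proof.
have [n] := ubnP (size p); elim: n => // n IH in p * => szn p1.
have [irr|] := pselect (irreducible_poly p); first by exists p; split.
move=> nirr; have [q [q1 [qp nqp]]] : exists q : {poly F}, size q != 1 /\ q %| p /\ ~~ (q %= p).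
  apply: contrapT => h; apply: nirr; split=> // q q1 qp.
  by apply/negPn/negP => nqp; apply: h; exists q.
have p0 : p != 0 by rewrite -size_poly_gt0; lia.
have q0 : q != 0 by apply: contraTneq qp => ->; rewrite dvd0p.
have szq : (size q < size p)%N.
  have := dvdp_leq p0 qp; rewrite leq_eqVlt => /orP[/eqP e|//].
  by move: nqp; rewrite -(dvdp_size_eqp qp) e eqxx.
have [||r [ir rq]] := IH q; first by lia.
  by have := q0; rewrite -size_poly_gt0; lia.
by exists r; split=> //; apply: dvdp_trans rq qp.
Qed.

(** The root belongs to some irreducible factor of [p], so the degree is left open and may be 1.
    What the extension really adds is settled afterwards by orders, in [w_notin_E2]. *)
Lemma adjoin_root (F : fieldType) (p : {poly F}) : (1 < size p)%N ->
  exists (L : fieldType) (phi : {rmorphism F -> L}) (z : L),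
    [/\ root (map_poly phi p) z, finite_ext phi &
      forall x, exists q : {poly F}, x = (map_poly phi q).[z]].
Proof.
move=> p1; have [q [irq qp]] := irreducible_divisor p1.
have [L dimL [z rz zfull]] := irredp_FAdjoin irq.
pose phi : {rmorphism F -> L} := in_alg L.
exists L, phi, z; split.
- by apply: root_dvdp rz; rewrite dvdp_map.
- exists (\dim {:L}), (fun i => (vbasis {:L})`_i) => x.
  exists (fun i => coord (vbasis {:L}) i x).
  rewrite {1}(coord_vbasis (memvf x)); apply: eq_bigr => i _.
  by rewrite /phi /= mulr_algl.
move=> x; have : x \in <<1; z>>%VS by rewrite zfull memvf.
case/Fadjoin_polyP => q' /polyOver1P[q'' ->] ->; by exists q''.
Qed.

Lemma finite_ext_comp (F L M : fieldType) (f : {rmorphism F -> L}) (g : {rmorphism L -> M}) :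
  finite_ext f -> finite_ext g -> finite_ext (g \o f).
Proof.
move=> [n [b hb]] [m [b' hb']].
pose T : finType := ('I_m * 'I_n)%type.
exists #|T|, (fun k => let p : T := enum_val k in g (b p.2) * b' p.1) => x.
have [a ha] := hb' x.
have /choice[a' ha'] : forall j, exists a' : 'I_n -> F, a j = \sum_(i < n) f (a' i) * b i.
  by move=> j; apply: hb.
exists (fun k => let p : T := enum_val k in a' p.1 p.2).
transitivity (\sum_(p : T) g (f (a' p.1 p.2)) * (g (b p.2) * b' p.1)).
  rewrite ha -(pair_bigA _ (fun j i => g (f (a' j i)) * (g (b i) * b' j))) /=.
  apply: eq_bigr => j _; rewrite ha' rmorph_sum mulr_suml.
  by apply: eq_bigr => i _; rewrite rmorphM mulrA.
rewrite (reindex (@enum_val T T)) /=; last by apply: onW_bij; apply: enum_val_bij.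
by apply: eq_bigr => k _.
Qed.

Lemma function_field_ext (F L : fieldType) (iF : {rmorphism CC -> F})
    (iL : {rmorphism CC -> L}) (phi : {rmorphism F -> L}) :
  over_CC iF iL phi -> finite_ext phi -> function_field iF -> function_field iL.
Proof.
move=> ov [m [b' hb']] [t [tt [n [b hb]]]].
have ev_phi p z : (map_poly iL p).[phi z] = phi (map_poly iF p).[z].
  rewrite -horner_map -map_poly_comp; congr (_.[_]).
  by apply: eq_map_poly => c; rewrite /= ov.
exists (phi t); split.
  by move=> p; rewrite ev_phi => /eqP; rewrite fmorph_eq0 => /eqP /tt.
pose T : finType := ('I_m * 'I_n)%type.
exists #|T|, (fun k => let p : T := enum_val k in phi (b p.2) * b' p.1) => x.
have [a ha] := hb' x.
have /choice[f hf] : forall j, exists f : {poly CC} * ('I_n -> {poly CC}),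
    (map_poly iF f.1).[t] != 0 /\
    a j * (map_poly iF f.1).[t] = \sum_(i < n) (map_poly iF (f.2 i)).[t] * b i.
  by move=> j; have [q [p h]] := hb (a j); exists (q, p).
(* [Q] is a common denominator of the coordinates [a j], and [R j] is its quotient by the
   denominator of [a j]. *)
pose Q := \prod_(j < m) (f j).1; pose R j := \prod_(k < m | k != j) (f k).1.
exists Q, (fun k => let p : T := enum_val k in R p.1 * (f p.1).2 p.2); split.
  rewrite ev_phi fmorph_eq0 /Q ev_prod; apply/prodf_neq0 => j _.
  by case: (hf j).
transitivity (\sum_(p : T) phi (map_poly iF (R p.1 * (f p.1).2 p.2)).[t] * (phi (b p.2) * b' p.1)).
  rewrite -(pair_bigA _ (fun j i =>
    phi (map_poly iF (R j * (f j).2 i)).[t] * (phi (b i) * b' j))) /= ha mulr_suml.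
  apply: eq_bigr => j _; have [_ h] := hf j.
  have -> : Q = R j * (f j).1 by rewrite /Q (bigD1 j) //= mulrC.
  rewrite ev_phi evM mulrAC -rmorphM mulrCA h mulr_sumr rmorph_sum mulr_suml.
  apply: eq_bigr => i _.
  by rewrite evM !rmorphM; ring.
rewrite (reindex (@enum_val T T)) /=; last by apply: onW_bij; apply: enum_val_bij.
by apply: eq_bigr => k _; rewrite ev_phi.
Qed.

End Extensions.

(** * Lower bounds for dimensions of spaces of functions *)

Section Dimensions.
Variables (K : fieldType) (iota : {rmorphism CC -> K}).
Hypothesis ff : function_field iota.
Local Notation "p `@ x" := ((map_poly iota p).[x]) (at level 10).
Implicit Types (W : K -> Prop) (P Q v w : K -> int) (z : K) (c : CC).

(** Dimensions are only bounded from below, as in [h0_ge]; an upper bound is a negated instance. *)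
Definition dimge W (n : nat) : Prop :=
  exists xs : 'I_n -> K, (forall i, W (xs i)) /\ lin_indep iota xs.

Definition subspace W : Prop := forall c x y, W x -> W y -> W (x - iota c * y).

Lemma dimge_mono W W' n : (forall z, W z -> W' z) -> dimge W n -> dimge W' n.
Proof. by move=> WW' [xs [Wxs ind]]; exists xs; split=> // i; apply: WW'. Qed.

Lemma dimge_scale W W' a n : a != 0 -> (forall z, W z -> W' (z * a)) ->
  dimge W n -> dimge W' n.
Proof.
move=> a0 WW' [xs [Wxs ind]]; exists (fun i => xs i * a); split=> [i|c h]; first exact: WW'.
apply: ind; apply: (mulIf a0); rewrite mul0r -[RHS]h mulr_suml.
by apply: eq_bigr => i _; rewrite mulrA.
Qed.

Lemma dimge_elim W n (i0 : 'I_n.+1) (xs : 'I_n.+1 -> K) (rho : 'I_n.+1 -> CC) :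
  lin_indep iota xs -> (forall i, W (xs (lift i0 i) - iota (rho (lift i0 i)) * xs i0)) ->
  dimge W n.
Proof.
move=> ind Wxs; exists (fun i => xs (lift i0 i) - iota (rho (lift i0 i)) * xs i0).
split=> // d h i.
pose e (j : 'I_n.+1) := oapp d (- \sum_(k < n) d k * rho (lift i0 k)) (unlift i0 j).
have e0 : e i0 = - \sum_(k < n) d k * rho (lift i0 k) by rewrite /e unlift_none.
have eL k : e (lift i0 k) = d k by rewrite /e liftK.
have := ind e; rewrite (bigD1_ord i0) //= e0.
under eq_bigr do rewrite eL.
have -> : iota (- \sum_(k < n) d k * rho (lift i0 k)) * xs i0 +
     \sum_(k < n) iota (d k) * xs (lift i0 k) = 0.
  rewrite -[RHS]h rmorphN rmorph_sum mulNr mulr_suml addrC -sumrB.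
  by apply: eq_bigr => k _; rewrite rmorphM; ring.
by move=> /(_ erefl (lift i0 i)); rewrite eL.
Qed.

Lemma dimge_le W m n : (m <= n)%N -> dimge W n -> dimge W m.
Proof.
elim: n => [|n IH]; first by rewrite leqn0 => /eqP ->.
rewrite leq_eqVlt => /orP[/eqP -> //|mn] [xs [Wxs ind]]; apply: IH => //.
apply: (dimge_elim (i0 := ord0) (rho := fun=> 0) ind) => i.
by rewrite rmorph0 mul0r subr0.
Qed.

(** After division by an element [p] of order [k], the residue at [P] is a linear form on [W]. Its
    kernel consists of the elements of order at least [k + 1] and has codimension at most 1. *)
Lemma dimge_drop1 W P (k : int) n : is_place iota P -> subspace W ->
  (forall z, W z -> vge P k z) -> dimge W n.+1 ->
  dimge (fun z => W z /\ vge P (k + 1) z) n.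
Proof.
move=> pP sW Wk [xs [Wxs ind]]; have vP := place_val pP.
have [p p0 pk] := place_uniformizer k pP.
have /choice[c hc] : forall i, exists c, vge P (k + 1) (xs i - iota c * p).
  move=> i; have [|c hc] := residue_exists (z := xs i / p) ff pP.
    by rewrite (vge_div vP) // pk add0r; apply: Wk.
  exists c; rewrite -(mulfVK p0 (xs i)) -mulrBl addrC.
  by rewrite (vgeM vP) // -pk vge_refl.
(* [i0] is the pivot: a member of the family with nonzero residue, by which the others are
   corrected, or any member if all residues vanish. *)
have [i0 [rho hrho]] : exists i0 (rho : 'I_n.+1 -> CC), forall i, c i = rho i * c i0 \/ i = i0.
  have [/existsP[i0 ci0]|/existsPn call] := boolP [exists i, c i != 0].
    by exists i0, (fun i => c i / c i0) => i; left; rewrite mulfVK.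
  by exists ord0, (fun=> 0) => i; left; rewrite mul0r; apply/eqP; rewrite -[_ == _]negbK call.
apply: (dimge_elim (i0 := i0) (rho := rho) ind) => i; split; first exact: sW.
set j := lift i0 i; have [ej|ej] := hrho j; last first.
  by have := neq_lift i0 i; rewrite -/j ej eqxx.
have -> : xs j - iota (rho j) * xs i0 =
    (xs j - iota (c j) * p) - iota (rho j) * (xs i0 - iota (c i0) * p).
  by rewrite ej rmorphM; ring.
by rewrite (vgeB vP) // (vgeMl vP) // (vgeC vP).
Qed.

Lemma subspace_vge W P k : is_place iota P -> subspace W ->
  subspace (fun z => W z /\ vge P k z).
Proof.
move=> pP sW c x y [Wx Px] [Wy Py]; have vP := place_val pP; split; first exact: sW.
by rewrite (vgeB vP) // (vgeMl vP) // (vgeC vP).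
Qed.

Lemma dimge_dropn W P (k : int) (m n : nat) : is_place iota P -> subspace W ->
  (forall z, W z -> vge P k z) -> dimge W n ->
  dimge (fun z => W z /\ vge P (k + m%:Z) z) (n - m).
Proof.
move=> pP sW Wk; elim: m n => [|m IH] n Wn.
  by rewrite subn0 addr0; apply: dimge_mono Wn => z Wz; split=> //; apply: Wk.
case: n Wn => [|n] Wn.
  by exists (fun i => 0); split=> [[]//|? _ []].
have := IH _ Wn; have [mn|mn] := leqP m n; last first.
  have -> : (n.+1 - m.+1 = 0)%N by lia.
  by exists (fun i => 0); split=> [[]//|? _ []].
rewrite subSn // subSS => H.
have [|xs [h ind]] := dimge_drop1 (k := k + m%:Z) pP (subspace_vge pP sW) _ H.
  by move=> z [].
exists xs; split=> // i; have [[Wx _] hx] := h i; split=> //.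
by rewrite -addn1 PoszD addrA.
Qed.

Lemma dimge_drop_list W (Cs : seq (K -> int)) (a b : (K -> int) -> nat) n :
  all (fun Q => `[< is_place iota Q >]) Cs -> subspace W ->
  all (fun Q => a Q <= b Q)%N Cs ->
  (forall z, W z -> all (fun Q => vge Q (- (b Q)%:Z) z) Cs) -> dimge W n ->
  dimge (fun z => W z /\ all (fun Q => vge Q (- (a Q)%:Z) z) Cs)
    (n - \sum_(Q <- Cs) (b Q - a Q)).
Proof.
elim: Cs W n => [|Q Cs IH] W n /=.
  by move=> _ _ _ _ Wn; rewrite big_nil subn0; apply: dimge_mono Wn.
move=> /andP[/asboolP pQ pC] sW /andP[abQ abC] Wb Wn.
rewrite big_cons subnDA.
have Wn' := dimge_dropn (b Q - a Q) pQ sW (fun z Wz => (andP (Wb z Wz)).1) Wn.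
have := IH _ _ pC (subspace_vge pQ sW) abC (fun z Wz => (andP (Wb z Wz.1)).2) Wn'.
apply: dimge_mono => z [[Wz hz] hC]; split=> //; rewrite hC andbT.
by move: hz; rewrite (_ : - _ + _ = - (a Q)%:Z) //; lia.
Qed.

Lemma distinct_orders_indep P n (xs : 'I_n -> K) : is_val iota P ->
  (forall i, xs i != 0) -> (forall i j, P (xs i) = P (xs j) -> i = j) ->
  lin_indep iota xs.
Proof.
move=> vP x0 inj c h i; apply/eqP/negPn/negP => ci.
move/eqP: h; rewrite (bigID (fun j => c j == 0)) /= big1 ?add0r; last first.
  by move=> j /eqP ->; rewrite rmorph0 mul0r.
apply/negP; apply: (val_sum_neq0 (i0 := i) vP) => // [j cj|j k cj ck].
  by rewrite mulf_neq0 // iota_eq0.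
by rewrite !(nuM vP) ?iota_eq0 // !(nuC vP) // !add0r; apply: inj.
Qed.

End Dimensions.

Lemma sumn_subK (I : Type) (C : seq I) (a b : I -> nat) : all (fun i => a i <= b i)%N C ->
  (\sum_(i <- C) (b i - a i) + \sum_(i <- C) a i = \sum_(i <- C) b i)%N.
Proof.
elim: C => [|i C IH] /=; first by rewrite !big_nil.
by move=> /andP[h /IH e]; rewrite !big_cons; lia.
Qed.

(** * Function fields of genus two *)

Section PoleOrders.
Variables (K : fieldType) (iota : {rmorphism CC -> K}).
Hypothesis ff : function_field iota.
Local Notation "p `@ x" := ((map_poly iota p).[x]) (at level 10).
Implicit Types (W : K -> Prop) (P Q v w : K -> int) (z : K) (c : CC).
Local Notation place := (is_place iota).
Local Notation dimge := (dimge iota).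

Definition regular_off P z : Prop := forall Q, place Q -> same_place Q P \/ vge Q 0 z.
Definition Lspace P (n : nat) z : Prop := regular_off P z /\ vge P (- n%:Z) z.
(** These [n] form the Weierstrass semigroup of [P], and the other naturals are its gaps;
    [Lspace P n] is [L(n P)]. *)
Definition pole_order P (n : nat) : Prop := exists z, [/\ regular_off P z, z != 0 & P z = - n%:Z].

Lemma same_place_vge P Q k z : same_place Q P -> vge Q k z = vge P k z.
Proof.
by move=> h; rewrite /vge; have [->|z0] := eqVneq z 0; rewrite ?eqxx // (h z z0).
Qed.

Lemma regular_offB P x y : regular_off P x -> regular_off P y -> regular_off P (x - y).
Proof.
move=> hx hy Q pQ; have [h|h] := hx Q pQ; first by left.
have [h'|h'] := hy Q pQ; first by left.
by right; rewrite (vgeB (place_val pQ)).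
Qed.
Lemma regular_offM P x y : regular_off P x -> regular_off P y -> regular_off P (x * y).
Proof.
move=> hx hy Q pQ; have [h|h] := hx Q pQ; first by left.
have [h'|h'] := hy Q pQ; first by left.
by right; rewrite (vgeM0 (place_val pQ)).
Qed.
Lemma regular_offC P c : regular_off P (iota c).
Proof. by move=> Q pQ; right; rewrite (vgeC (place_val pQ)). Qed.
Lemma regular_offN P x : regular_off P x -> regular_off P (- x).
Proof.
by move=> hx; rewrite -sub0r -(rmorph0 iota); apply: regular_offB => //; apply: regular_offC.
Qed.
Lemma regular_offD P x y : regular_off P x -> regular_off P y -> regular_off P (x + y).
Proof. by move=> hx hy; rewrite -(opprK y); apply/regular_offB/regular_offN. Qed.
Lemma regular_offX P x n : regular_off P x -> regular_off P (x ^+ n).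
Proof.
move=> hx; elim: n => [|n IH]; last by rewrite exprS; apply: regular_offM.
by rewrite expr0 -(rmorph1 iota); apply: regular_offC.
Qed.
Lemma regular_off_ev P p x : regular_off P x -> regular_off P (p `@ x).
Proof.
move=> hx; elim/poly_ind: p => [|p c IH].
  by rewrite ev0 -(rmorph0 iota); apply: regular_offC.
rewrite evD evM evX evC; apply: regular_offD; last exact: regular_offC.
exact: regular_offM.
Qed.

Lemma subspace_Lspace P n : place P -> subspace iota (Lspace P n).
Proof.
move=> pP c x y [hx kx] [hy ky]; split.
  by apply: regular_offB => //; apply: regular_offM => //; apply: regular_offC.
have vP := place_val pP.
by rewrite (vgeB vP) // (vgeMl vP) // (vgeC vP).
Qed.

Lemma pole_order0 P : place P -> pole_order P 0.
Proof.
move=> pP; exists 1; rewrite oner_eq0 oppr0 (nu1 (place_val pP)); split=> //.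
by rewrite -(rmorph1 iota); apply: regular_offC.
Qed.

Lemma pole_orderD P m n : place P -> pole_order P m -> pole_order P n -> pole_order P (m + n).
Proof.
move=> pP [x [hx x0 Px]] [y [hy y0 Py]]; exists (x * y); rewrite mulf_neq0 //.
rewrite (nuM (place_val pP)) // Px Py PoszD opprD; split=> //; exact: regular_offM.
Qed.

Lemma pole_orderM P m k : place P -> pole_order P m -> pole_order P (k * m).
Proof.
move=> pP hm; elim: k => [|k IH]; first by apply: pole_order0.
by rewrite mulSn; apply: pole_orderD.
Qed.

Lemma gap_Lspace P n z : ~ pole_order P n.+1 -> Lspace P n.+1 z -> Lspace P n z.
Proof.
move=> gap [hz kz]; split=> //; have [->|z0] := eqVneq z 0; first by rewrite vge0.
move: kz; rewrite !vgeE // => kz.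
have : P z <> - n.+1%:Z by move=> e; apply: gap; exists z.
lia.
Qed.

Hypothesis genus_bound : forall A, eff_divisor iota A ->
  dimge (in_LA iota A) (deg_eff A + 1 - 2).
(** [A0] attains the maximum that defines the genus: [l(A0)] is only [deg A0 - 1]. This is what
    excludes a genus below 2. *)
Variable A0 : seq ((K -> int) * nat).
Hypothesis effA0 : eff_divisor iota A0.
Hypothesis special : ~ dimge (in_LA iota A0) (deg_eff A0).

(** A nonconstant [z] would be transcendental. Its powers would be independent elements of [L(A0)],
    more of them than [special] allows. *)
Lemma regular_const z : (forall Q, place Q -> vge Q 0 z) -> exists c, z = iota c.
Proof.
move=> hz; apply: contrapT => /forallNP nc.
have tz : transcendental iota z.
  by apply: nonconst_transcendental => c; apply/eqP/nc.
have z0 : z != 0 by have := transcendental_nonconst 0 tz; rewrite rmorph0.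
apply: special; exists (fun i => z ^+ i); split=> [i|c h i].
  right => P pP; left.
  by have := vgeX0 (place_val pP) i (hz P pP); rewrite vgeE ?expf_neq0.
have h' : (\poly_(i < deg_eff A0) oapp c 0 (insub i)) = 0.
  apply: tz; rewrite (@horner_coef_wide _ (deg_eff A0)) ?size_map_poly ?size_poly //.
  rewrite -[RHS]h; apply: eq_bigr => j _.
  by rewrite coef_map coef_poly ltn_ord valK.
have := congr1 (fun p : {poly CC} => p`_i) h'.
by rewrite coef_poly ltn_ord valK coef0.
Qed.

Lemma Lspace0_const P z : place P -> Lspace P 0 z -> exists c, z = iota c.
Proof.
move=> pP [hz kz]; apply: regular_const => Q pQ.
by have [h|//] := hz Q pQ; rewrite (same_place_vge _ _ h).
Qed.

Lemma Lspace0_dim W P : place P -> (forall z, W z -> Lspace P 0 z) -> ~ dimge W 2.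
Proof.
move=> pP WL [xs [Wxs ind]].
have [a ha] := Lspace0_const pP (WL _ (Wxs 0)).
have [b hb] := Lspace0_const pP (WL _ (Wxs 1)).
have h1 (c : 'I_2 -> CC) : \sum_(i < 2) iota (c i) * xs i = iota (c 0 * a + c 1 * b).
  rewrite big_ord_recl big_ord1 rmorphD !rmorphM -ha -hb; congr (_ + iota (c _) * xs _);
  exact: val_inj.
have [a0|a0] := eqVneq a 0.
  have := ind (fun i => if i == 0 then 1 else 0); rewrite h1 /= a0 mulr0 mul0r addr0 rmorph0.
  by move=> /(_ erefl 0)/eqP; rewrite /= oner_eq0.
have := ind (fun i => if i == 0 then b else - a).
rewrite h1 /= mulNr [b * a]mulrC subrr rmorph0 => /(_ erefl 1)/eqP.
by rewrite /= oppr_eq0 (negPf a0).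
Qed.

Lemma Lspace_dim_upper P n : place P -> ~ dimge (Lspace P n) (n + 2).
Proof.
move=> pP h.
have := dimge_dropn ff n pP (subspace_Lspace (n := n) pP) (fun z Lz => Lz.2) h.
rewrite addKn => h'; apply: (@Lspace0_dim _ P pP _ h') => z [[hz _] kz].
by split=> //; move: kz; rewrite addNr oppr0.
Qed.

Lemma Lspace_dim_lower P n : place P -> dimge (Lspace P n) (n - 1).
Proof.
move=> pP; pose A := [:: (P, n)].
have eA : eff_divisor iota A by split=> [[]//|[|i] [|j] //].
have := genus_bound eA; rewrite /deg_eff big_seq1 /= addn1 subSS.
apply: dimge_mono => z [->|hz].
  split; last by rewrite vge0.
  by rewrite -(rmorph0 iota); apply: regular_offC.
have [->|z0] := eqVneq z 0.
  by split; rewrite ?vge0 // -(rmorph0 iota); apply: regular_offC.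
split.
  move=> Q pQ; have [h|[i [/= i1 [sP _]]]] := hz Q pQ; first by right; rewrite vgeE.
  by case: i i1 sP => // _ sP; left.
rewrite vgeE //; have [h|[i [/= i1 [sP h]]]] := hz P pP; first by lia.
by case: i i1 sP h => // _ _ /= h; lia.
Qed.

(* Removing a gap costs no dimension, so three gaps contradict the genus bound. *)
Lemma pole_orders_3 P : place P -> ~ pole_order P 1 -> ~ pole_order P 2 ->
  forall n, pole_order P n.+3.
Proof.
move=> pP g1 g2 n; apply: contrapT => gn.
have h : dimge (Lspace P n.+2) n.+2.
  by have := Lspace_dim_lower n.+3 pP; rewrite subn1; apply: dimge_mono => z; apply: gap_Lspace.
have := dimge_dropn ff n pP (subspace_Lspace (n := n.+2) pP) (fun z Lz => Lz.2) h.
rewrite (_ : (n.+2 - n = 2)%N); last by lia.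
apply: Lspace0_dim pP _ => z [[hz _] kz].
apply: gap_Lspace g1 _; apply: gap_Lspace g2 _; split=> //.
by move: kz; rewrite (_ : - _ + _ = - 2%:Z) //; lia.
Qed.

(** The same count for the gaps 1, 3 and 5: up to 5 only the orders 0, 2 and 4 would remain, while
    [L(5 P)] has dimension at least 4. *)
Lemma pole_order_5 P : place P -> ~ pole_order P 1 -> ~ pole_order P 3 -> pole_order P 5.
Proof.
move=> pP g1 g3; apply: contrapT => g5.
have h : dimge (Lspace P 4) 4.
  by have := Lspace_dim_lower 5 pP; apply: dimge_mono => z; apply: gap_Lspace.
have h3 : dimge (Lspace P 2) 3.
  have := dimge_dropn ff 1 pP (subspace_Lspace (n := 4) pP) (fun z Lz => Lz.2) h.
  apply: dimge_mono => z [[hz _] kz]; apply: gap_Lspace g3 _; split=> //.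
have := dimge_dropn ff 1 pP (subspace_Lspace (n := 2) pP) (fun z Lz => Lz.2) h3.
apply: Lspace0_dim pP _ => z [[hz _] kz]; apply: gap_Lspace g1 _; split=> //.
Qed.

Lemma Lspace_dim_full P : place P -> (forall m, pole_order P m.+2) ->
  forall N, dimge (Lspace P N) N.
Proof.
move=> pP hm N; have vP := place_val pP.
have /choice[x hx] : forall i : 'I_N, exists z, [/\ regular_off P z, z != 0 &
    P z = - (if i == 0 :> nat then 0 else i.+1)%:Z].
  by move=> i; case: (i : nat) => [|m] /=; [apply: pole_order0|apply: hm].
exists x; split=> [i|].
  have [h z0 e] := hx i; split=> //; rewrite vgeE // e.
  by have := ltn_ord i; case: (i : nat) => [|m] /=; lia.
apply: (distinct_orders_indep vP) => [i|i j]; first by case: (hx i).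
have [_ _ ->] := hx i; have [_ _ ->] := hx j.
by case: i j => [[|i] hi] [[|j] hj] /= e; apply: val_inj => /=; lia.
Qed.

Section Saturated.
Variables (P : K -> int) (t : K) (k : nat).
Hypothesis (pP : place P) (k0 : (0 < k)%N) (Pt : P t = - k%:Z) (t0 : t != 0).
Hypothesis treg : regular_off P t.

Let vP := place_val pP.

Lemma pole_transcendental : transcendental iota t.
Proof.
apply: nonconst_transcendental => c; apply/eqP => tE.
have c0 : c != 0 by rewrite -(iota_eq0 iota) -tE.
by move: Pt; rewrite tE (nuC vP) //; lia.
Qed.

Let ev_pole q : q != 0 -> P (q `@ t) = - (k * (size q).-1)%:Z.
Proof.
move=> q0; have [|_ ->] := val_ev_pole vP t0 _ q0; rewrite Pt; first by lia.
by rewrite PoszM; ring.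
Qed.

Let nsame Q Q' := `[< ~ same_place Q Q' >].
Let dplaces (Cs : seq (K -> int)) :=
  all (fun Q => `[< place Q >]) Cs && pairwise nsame Cs.

Let zero_order q Q : nat := `| Q (q `@ t) |%N.

Let zero_orderE q Q : q != 0 -> place Q -> nsame Q P -> (zero_order q Q)%:Z = Q (q `@ t).
Proof.
move=> q0 pQ /asboolP nQ.
have [//|h] := regular_off_ev q treg pQ.
move: h; rewrite vgeE ?(transcendental_ev_neq0 pole_transcendental) // => h.
by rewrite /zero_order; lia.
Qed.

Let dplaces_eff Cs (m : (K -> int) -> nat) : dplaces Cs ->
  eff_divisor iota [seq (Q, m Q) | Q <- Cs].
Proof.
move=> /andP[/(all_nthP (fun=> 0)) hp /(pairwiseP (fun=> 0)) hd]; split.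
  move=> i; rewrite size_map => iC; rewrite (nth_map (fun=> 0)) //=.
  by have /asboolP := hp i iC.
move=> i j; rewrite !size_map => iC jC ij; rewrite !(nth_map (fun=> 0)) //= => s.
have [lt|gt|//] := ltngtP i j.
  by have /asboolP := hd i j iC jC lt; apply.
by have /asboolP := hd j i jC iC gt; apply => z z0; rewrite (s z z0).
Qed.

(* An element of L(3 sum_Q Q(q(t)) Q) times q(t)^3 lies in L(3 k (deg q) P); with the
   factor 3 the two dimension estimates leave no room for more zeros than poles. *)
Lemma zeros_bound q Cs : q != 0 -> dplaces Cs ->
  (\sum_(Q <- Cs | nsame Q P) zero_order q Q <= k * (size q).-1)%N.
Proof.
move=> q0 dC.
pose m Q := if nsame Q P then (3 * zero_order q Q)%N else 0%N.
have := genus_bound (dplaces_eff m dC).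
set A := [seq _ | Q <- Cs].
have degA : deg_eff A = (3 * \sum_(Q <- Cs | nsame Q P) zero_order q Q)%N.
  by rewrite /deg_eff big_map /= big_distrr /= [RHS]big_mkcond.
have qt0 : q `@ t != 0 by rewrite (transcendental_ev_neq0 pole_transcendental).
have q30 : (q `@ t) ^+ 3 != 0 by rewrite expf_neq0.
move=> /(dimge_scale (W' := Lspace P (3 * (k * (size q).-1))) q30) h.
have {h} : dimge (Lspace P (3 * (k * (size q).-1))) (deg_eff A + 1 - 2).
  apply: h => z [->|hz]; first by rewrite mul0r; split; rewrite ?vge0 // -(rmorph0 iota); apply: regular_offC.
  have [->|z0] := eqVneq z 0.
    by rewrite mul0r; split; rewrite ?vge0 // -(rmorph0 iota); apply: regular_offC.
  have szA : size A = size Cs by rewrite size_map.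
  have Azero : P z >= 0.
    have [//|[i [iA [sP]]]] := hz P pP.
    rewrite szA in iA; rewrite /A (nth_map (fun=> 0)) //= /m.
    case: ifP => [/asboolP h|_]; last by rewrite addr0.
    by case: h => x x0; rewrite (sP x x0) /A (nth_map (fun=> 0)).
  split; last by rewrite vgeE ?mulf_neq0 // (nuM vP) // (nuX vP) // ev_pole //; lia.
  move=> Q pQ; have [sQ|nQ] := pselect (same_place Q P); first by left.
  right; have vQ := place_val pQ.
  have nQ' : nsame Q P by apply/asboolP.
  rewrite vgeE ?mulf_neq0 // (nuM vQ) // (nuX vQ) //.
  rewrite -(zero_orderE q0 pQ nQ').
  have [h|[i [iA [sP]]]] := hz Q pQ; first by lia.
  rewrite szA in iA; rewrite /A (nth_map (fun=> 0)) //= /m.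
  have sQi : same_place Q (nth (fun=> 0) Cs i).
    by move=> x x0; rewrite (sP x x0) /A (nth_map (fun=> 0)).
  case: ifP => [_|/negP]; last first.
    move=> h; exfalso; apply: h; apply/asboolP => s; apply: nQ => x x0.
    by rewrite (sQi x x0) (s x x0).
  rewrite /zero_order -(sQi _ qt0) /=.
  by have := zero_orderE q0 pQ nQ'; rewrite /zero_order; lia.
move=> h; rewrite leqNgt; apply/negP => lt.
apply: (@Lspace_dim_upper P (3 * (k * (size q).-1)) pP); apply: dimge_le h.
rewrite degA; lia.
Qed.

Let dplaces_rcons Cs Q : dplaces Cs -> place Q ->
  ~~ has (fun Q' => `[< same_place Q Q' >]) Cs -> dplaces (rcons Cs Q).
Proof.
move=> /andP[pC dC] pQ nQ; rewrite /dplaces all_rcons pC pairwise_rcons dC !andbT /=.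
apply/andP; split; first exact/asboolP.
rewrite -all_predC in nQ; apply: sub_all nQ => Q' /= /asboolPn nQ'.
by apply/asboolP => s; apply: nQ' => x x0; rewrite (s x x0).
Qed.

(** [zeros_bound] limits the number of zeros of [q(t)] off [P], so adding the missing ones to the
    list one at a time comes to an end. *)
Lemma complete_zeros q As : q != 0 -> dplaces As -> exists Bs, dplaces (As ++ Bs) /\
  forall Q, place Q -> nsame Q P -> 0 < Q (q `@ t) ->
    has (fun Q' => `[< same_place Q Q' >]) (As ++ Bs).
Proof.
move=> q0 dA.
pose good Q := nsame Q P && (0 < zero_order q Q)%N.
have bound Bs : dplaces (As ++ Bs) -> all good Bs -> (size Bs <= k * (size q).-1)%N.
  move=> d g; apply: leq_trans (zeros_bound q0 d).
  rewrite big_cat /=; apply: leq_trans (leq_addl _ _).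
  elim: Bs g {d} => [|Q Bs IH] //= /andP[/andP[nQ zQ] g].
  by rewrite big_cons nQ -add1n leq_add // IH.
suff H n Bs : (k * (size q).-1 - size Bs <= n)%N -> dplaces (As ++ Bs) -> all good Bs ->
   exists Bs, dplaces (As ++ Bs) /\
    forall Q, place Q -> nsame Q P -> 0 < Q (q `@ t) ->
    has (fun Q' => `[< same_place Q Q' >]) (As ++ Bs).
  by apply: (H (k * (size q).-1)%N [::]); rewrite ?cats0 ?leq_subr.
elim: n Bs => [|n IH] Bs hn d g;
  (have [done|] := pselect (forall Q, place Q -> nsame Q P -> 0 < Q (q `@ t) ->
    has (fun Q' => `[< same_place Q Q' >]) (As ++ Bs)); [by exists Bs|]);
  move=> /existsNP[Q /not_implyP[pQ /not_implyP[nQ /not_implyP[zQ /negP hQ]]]];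
  have d' := dplaces_rcons d pQ hQ; rewrite rcons_cat in d';
  (have g' : all good (rcons Bs Q)
    by rewrite all_rcons g andbT /good nQ -ltz_nat zero_orderE);
  have := bound _ d' g'; rewrite size_rcons => b.
  by lia.
by apply: IH d' g'; rewrite size_rcons; lia.
Qed.

(** If all [L(N P)] were that large, [L(A0)] would be too large. Take a polynomial [q] in [t] whose
    zeros cover [A0] off [P], and start from the functions [z] with [z * q(t)] in [L((N + d) P)];
    their poles are bounded by [b]. Lowering the bound from [b] to the multiplicities [a] of [A0]
    costs at most [b - a] dimensions at each place. The sum of [b] is at most [N + d], so at least
    [deg A0] dimensions remain. *)
Lemma not_full : ~ forall N, dimge (Lspace P N) N.
Proof.
move=> full.
pose dflt : (K -> int) * nat := (fun=> 0, 0%N).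
pose a0 i := nth dflt A0 i.
have [pA dA] := effA0.
have /choice[a ha] : forall Q, exists n,
    (forall i, (i < size A0)%N -> same_place Q (a0 i).1 -> n = (a0 i).2) /\
    ((forall i, (i < size A0)%N -> ~ same_place Q (a0 i).1) -> n = 0%N).
  move=> Q; have [[i [iA sQ]]|no] :=
      pselect (exists i, (i < size A0)%N /\ same_place Q (a0 i).1).
    exists (a0 i).2; split=> [j jA sQ'|h]; last by case: (h i iA sQ).
    have [-> //|/eqP ij] := eqVneq i j; case: (dA i j iA jA ij) => x x0.
    by rewrite -/dflt -(sQ x x0) (sQ' x x0).
  by exists 0%N; split=> // i iA sQ; case: no; exists i.
pose As0 := map fst A0.
have dAs0 : dplaces As0.
  apply/andP; split.
    apply/(all_nthP (fun=> 0)) => i; rewrite size_map => iA.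
    by rewrite (nth_map dflt) //; apply/asboolP; apply: pA.
  apply/(pairwiseP (fun=> 0)) => i j; rewrite !inE !size_map => iA jA ij.
  rewrite !(nth_map dflt) //; apply/asboolP; apply: dA => // e.
  by rewrite e ltnn in ij.
(* [P] is put on the list even if it does not occur in [A0], because the functions in [W] may have a
   pole there. *)
have [As [dAs [hP sumAs]]] : exists As, dplaces As /\
    has (fun Q' => `[< same_place P Q' >]) As /\ (deg_eff A0 <= \sum_(Q <- As) a Q)%N.
  have sum0 : (deg_eff A0 <= \sum_(Q <- As0) a Q)%N.
    rewrite /deg_eff (big_nth dflt) [leqRHS](big_nth (fun=> 0)) size_map.
    rewrite !big_nat; apply: leq_sum => i /andP[_ iA].
    rewrite (nth_map dflt) //; have [h _] := ha (nth dflt A0 i).1.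
    by rewrite (h i iA).
  have [h|h] := boolP (has (fun Q' => `[< same_place P Q' >]) As0); first by exists As0.
  exists (rcons As0 P); split; first exact: dplaces_rcons; split.
    by rewrite has_rcons; apply/orP; left; apply/asboolP.
  by rewrite -cats1 big_cat /=; apply: leq_trans sum0 (leq_addr _ _).
have /choice[c hc] : forall i : 'I_(size A0), exists c, nsame (a0 i).1 P ->
    vge (a0 i).1 1 (t - iota c).
  move=> i; have pQ := pA i (ltn_ord i).
  have [/asboolP nQ|_] := boolP (nsame (a0 i).1 P); last by exists 0.
  have [s|h] := treg pQ; first by case: nQ.
  have [c hc] := residue_exists ff pQ h.
  by exists c.
have tt := pole_transcendental.
pose q := \prod_(i < size A0) ('X - (c i)%:P) ^+ (a0 i).2.
have q0 : q != 0 by apply/prodf_neq0 => i _; rewrite expf_neq0 // polyXsubC_eq0.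
have qt0 : q `@ t != 0 by rewrite (transcendental_ev_neq0 tt).
have tc c' : t - iota c' != 0 by rewrite subr_eq0 transcendental_nonconst.
have qA i : (i < size A0)%N -> nsame (a0 i).1 P -> ((a0 i).2%:Z <= (a0 i).1 (q `@ t)).
  move=> iA nQ; have pQ := pA i iA; have vQ := place_val pQ; rewrite -/dflt -/(a0 i) in pQ vQ.
  have : vge (a0 i).1 (a0 i).2%:Z (q `@ t); last by rewrite vgeE.
  rewrite /q ev_prod (bigD1 (Ordinal iA)) //= mulrC (vgeMl vQ) //.
    rewrite -ev_prod.
    have [s|//] := regular_off_ev (\prod_(j < size A0 | j != Ordinal iA)
      ('X - (c j)%:P) ^+ (a0 j).2) treg pQ.
    by move/asboolP: nQ.
  have h := hc (Ordinal iA) nQ; rewrite evXn evXC.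
  by have := vgeX vQ (a0 i).2 h; rewrite mulr1.
have [Bs [dC complete]] := complete_zeros q0 dAs.
set Cs := As ++ Bs in dC complete.
(* [N] is at least every multiplicity in [A0], so that [a <= b] holds at [P] as well. *)
pose N := (deg_eff A0 + \sum_(i < size A0) (a0 i).2)%N.
pose d := (k * (size q).-1)%N.
pose b Q : nat := if nsame Q P then zero_order q Q else N.
have aN Q : (a Q <= N)%N.
  have [h1 h2] := ha Q.
  have [[i [iA sQ]]|no] := pselect (exists i, (i < size A0)%N /\ same_place Q (a0 i).1).
    rewrite (h1 i iA sQ) /N (bigD1 (Ordinal iA)) //=; lia.
  by rewrite h2 // => i iA sQ; apply: no; exists i.
have ab Q : place Q -> (a Q <= b Q)%N.
  move=> pQ; rewrite /b; case: ifP => // nQ; have [h1 h2] := ha Q.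
  have [[i [iA sQ]]|no] := pselect (exists i, (i < size A0)%N /\ same_place Q (a0 i).1).
    rewrite (h1 i iA sQ) -lez_nat zero_orderE // (sQ _ qt0); apply: qA => //.
    apply/asboolP => s; move/asboolP: nQ; apply => x x0; by rewrite (sQ x x0) (s x x0).
  by rewrite h2 // => i iA sQ; apply: no; exists i.
have /andP[pC dCs] := dC.
have sumb : (\sum_(Q <- Cs) b Q <= N + d)%N.
  rewrite (bigID (fun Q => nsame Q P)) /= addnC leq_add //; last first.
    apply: leq_trans (zeros_bound q0 dC).
    by rewrite leq_eqVlt (eq_bigr (zero_order q)) ?eqxx // => Q; rewrite /b => ->.
  rewrite (eq_bigr (fun=> N)) => [|Q /negPf]; last by rewrite /b => ->.
  rewrite big_const_seq iter_addn_0 -[leqRHS]muln1 leq_mul2l; apply/orP; right.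
  move: dCs; elim: (Cs) => [|Q C IH] //= /andP[hQ /IH hC].
  case: (boolP (nsame Q P)) => //= /negP sQ; rewrite (_ : count _ C = 0%N) //.
  have h : all (fun Q' => nsame Q' P) C.
    apply: sub_all hQ => Q' /asboolP nQQ'; apply/asboolP => s; apply: sQ.
    by apply/asboolP => s'; apply: nQQ' => x x0; rewrite (s' x x0) (s x x0).
  have := count_predC (fun Q' => nsame Q' P) C; move: h; rewrite all_count => /eqP ->.
  by rewrite -[RHS]addn0 => /addnI.
pose W z := Lspace P (N + d) (z * q `@ t).
have WN : dimge W (N + d).
  have qi0 : (q `@ t)^-1 != 0 by rewrite invr_eq0.
  by apply: (dimge_scale qi0 _ (full (N + d)%N)) => z; rewrite /W mulfVK.
have sW : subspace iota W.
  by move=> e x y Wx Wy; rewrite /W mulrBl -mulrA; apply: subspace_Lspace.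
have aball : all (fun Q => a Q <= b Q)%N Cs.
  by apply: sub_all pC => Q /asboolP; apply: ab.
have Wb z : W z -> all (fun Q => vge Q (- (b Q)%:Z) z) Cs.
  move=> [hz kz]; apply: sub_all pC => Q /asboolP pQ; have vQ := place_val pQ.
  apply: (vge_mulK vQ qt0); rewrite /b; case: ifP => [nQ|/negP sQ].
    rewrite (zero_orderE q0 pQ nQ) addNr.
    by have [s|//] := hz Q pQ; move/asboolP: nQ.
  have sQP : same_place Q P by apply: contrapT => h; apply/sQ/asboolP.
  rewrite (same_place_vge _ _ sQP) (sQP _ qt0) ev_pole //.
  by move: kz; rewrite /d PoszD opprD.
have := dimge_drop_list ff pC sW aball Wb WN.
have sumab := sumn_subK aball.
have sumC : (deg_eff A0 <= \sum_(Q <- Cs) a Q)%N.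
  by rewrite big_cat /=; apply: leq_trans sumAs (leq_addr _ _).
move=> h; apply: special; apply: dimge_le (_ : _ <= N + d - \sum_(Q <- Cs) (b Q - a Q))%N _.
  rewrite leq_subRL; last by apply: leq_trans sumb; rewrite -sumab leq_addr.
  by apply: leq_trans sumb; rewrite -sumab leq_add2l.
apply: dimge_mono h => z [[hz kz] hC].
have [->|z0] := eqVneq z 0; [by left|right=> Q pQ].
have [hasQ|hasQ] := boolP (has (fun Q' => `[< same_place Q Q' >]) Cs); last first.
  left; have [sQ|nQ] := pselect (same_place Q P).
    exfalso; move/negP: hasQ; apply; rewrite has_cat; apply/orP; left.
    apply: sub_has hP => Q' /asboolP s; apply/asboolP => x x0.
    by rewrite (sQ x x0) (s x x0).
  have nQ' : nsame Q P by apply/asboolP.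
  have : ~~ (0 < Q (q `@ t)) by apply: contra hasQ => h'; apply: complete.
  rewrite -leNgt => hq; have [s|] := hz Q pQ; first by case: nQ.
  rewrite vgeE ?mulf_neq0 // (nuM (place_val pQ)) // => h'.
  by rewrite -[leRHS]addr0; apply: le_trans h' _; rewrite lerD2l.
have : vge Q (- (a Q)%:Z) z.
  move: hasQ hC; elim: (Cs) => [|Q' C IH] //= /orP[/asboolP s|/IH hI] /andP[h1 h2]; last exact: hI.
  rewrite (same_place_vge _ _ s) (_ : a Q = a Q') //.
  have [h3 h4] := ha Q; have [h5 h6] := ha Q'.
  have [[i [iA sQ]]|no] := pselect (exists i, (i < size A0)%N /\ same_place Q (a0 i).1).
    rewrite (h3 i iA sQ) (h5 i iA) // => x x0; by rewrite -(s x x0) (sQ x x0).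
  rewrite h4 ?h6 // => i iA sQ; apply: no; exists i => //; split=> // x x0.
  by rewrite (s x x0) (sQ x x0).
rewrite vgeE // => h1; have [h3 h4] := ha Q.
have [[i [iA sQ]]|no] := pselect (exists i, (i < size A0)%N /\ same_place Q (a0 i).1).
  right; exists i; split=> //; split; first exact: sQ.
  by rewrite -lerBlDr sub0r -[(nth _ _ _).2](h3 i iA sQ).
by left; move: h1; rewrite h4 ?oppr0 // => i iA sQ; apply: no; exists i.
Qed.

End Saturated.

Lemma not_all_pole_orders P : place P -> ~ forall m, pole_order P m.+2.
Proof.
move=> pP full; have [t [treg t0 Pt]] := full 0%N.
exact: (not_full pP (isT : (0 < 2)%N) Pt t0 treg (Lspace_dim_full pP full)).
Qed.

Lemma gap1 P : place P -> ~ pole_order P 1.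
Proof.
move=> pP h; apply: (not_all_pole_orders pP) => m.
by rewrite -[m.+2]muln1; apply: pole_orderM.
Qed.

(** 2 and 3 generate all orders from 2 on, which [not_all_pole_orders] forbids. *)
Lemma gap3 P : place P -> pole_order P 2 -> ~ pole_order P 3.
Proof.
move=> pP h2 h3; apply: (not_all_pole_orders pP) => m.
rewrite -(odd_double_half m); case: (odd m) => /=.
  rewrite (_ : _.+2 = m./2 * 2 + 3)%N; last by lia.
  by apply: pole_orderD => //; apply: pole_orderM.
rewrite (_ : _.+2 = m./2.+1 * 2)%N; last by lia.
exact: pole_orderM.
Qed.

(** An exchange argument. The relation of [t] over [C(t1)], reordered by powers of [t1], is
    nontrivial because [t] is transcendental; so [t1] is algebraic over [C(t)], and with it [z],
    which is algebraic over [C(t1)]. *)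
Lemma integral_over_Cx t z : transcendental iota t -> exists m (a : 'I_m -> K),
  (forall i, Cx iota t (a i)) /\ z ^+ m = \sum_(i < m) a i * z ^+ i.
Proof.
move=> tt; have [t1 [tt1 span]] := ff.
have [E [iE [j [jE [surj inS]]]]] := subfield_type (Cx_subfield iota t).
have [t' t'E] := surj _ (Cx_gen iota t).
have jev p : j (map_poly iE p).[t'] = p `@ t.
  rewrite -horner_map -map_poly_comp t'E; congr (_.[_]).
  by apply: eq_map_poly => c; rewrite /= jE.
have alg_t1 : integralOver j t1.
  apply/integral_algebraic.
  have [m [r [[j0 rj0] rel]]] := algebraic_relation tt1 span t.
  pose B := \max_(i < m) size (r i).
  pose q (i : nat) : {poly CC} := \poly_(k < m) oapp (fun k => (r k)`_i) 0 (insub k).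
  pose p : {poly E} := \poly_(i < B) (map_poly iE (q i)).[t'].
  exists p.
    apply/eqP => p0.
    have szB : ((size (r j0)).-1 < B)%N.
      by apply: leq_trans (leq_bigmax j0); rewrite prednK // size_poly_gt0.
    have := congr1 (fun f : {poly E} => j f`_((size (r j0)).-1)) p0.
    rewrite coef_poly szB coef0 rmorph0 jev => /tt/polyP/(_ j0).
    rewrite coef_poly ltn_ord valK coef0 /= => h.
    by move: rj0; rewrite -lead_coef_eq0 lead_coefE h eqxx.
  apply/rootP; rewrite (@horner_coef_wide _ B); last first.
    by rewrite size_map_poly size_poly.
  rewrite -[RHS]rel.
  transitivity (\sum_(i < B) \sum_(k < m) iota (r k)`_i * t ^+ k * t1 ^+ i).
    apply: eq_bigr => i _; rewrite coef_map coef_poly ltn_ord /= jev -mulr_suml.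
    congr (_ * _); rewrite (@horner_coef_wide _ m); last first.
      by rewrite size_map_poly size_poly.
    by apply: eq_bigr => k _; rewrite coef_map coef_poly ltn_ord valK.
  rewrite exchange_big; apply: eq_bigr => k _.
  rewrite (@horner_coef_wide _ B); last by rewrite size_map_poly /B (leq_bigmax k).
  rewrite mulr_suml; apply: eq_bigr => i _; rewrite coef_map.
  by rewrite -!mulrA; congr (_ * _); rewrite mulrC.
have : integralOver j z.
  have [m [r [[j0 rj0] rel]]] := algebraic_relation tt1 span z.
  pose p : {poly K} := \poly_(i < m) oapp (fun i => (r i) `@ t1) 0 (insub i).
  apply: (@integral_root _ _ _ p).
  - apply/eqP => /polyP/(_ j0); rewrite coef_poly ltn_ord valK coef0 /= => /tt1.
    by apply/eqP.
  - apply/rootP; rewrite horner_poly -[RHS]rel.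
    by apply: eq_bigr => i _; rewrite valK.
  apply/integral_poly => i; rewrite coef_poly; case: ifP => [im|_]; last exact: integral0.
  rewrite (insubT (fun i => (i < m)%N) im) /=.
  apply: integral_horner => //; apply/integral_poly => k.
  by rewrite coef_map /= -jE; apply: integral_id.
move=> [p pm /rootP rp]; exists (size p).-1, (fun i => - j p`_i); split=> [i|].
  by apply: (sfN (Cx_subfield iota t)); apply: inS.
have szp : size p = (size p).-1.+1 by rewrite prednK // size_poly_gt0 monic_neq0.
move: rp; rewrite (@horner_coef_wide _ (size p).-1.+1); last by rewrite size_map_poly -szp.
rewrite big_ord_recr /=.
rewrite coef_map /= -lead_coefE (monicP pm) rmorph1 mul1r addrC => /eqP.
rewrite addr_eq0 => /eqP ->; rewrite -sumrN; apply: eq_bigr => i _.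
by rewrite coef_map mulNr.
Qed.

Lemma common_denominator t m (a : 'I_m -> K) : transcendental iota t ->
  (forall i, Cx iota t (a i)) ->
  exists q, q != 0 /\ forall i, exists A : {poly CC}, a i * q `@ t = A `@ t.
Proof.
move=> tt /choice[A /choice[E hE]]; exists (\prod_i E i); split.
  by apply/prodf_neq0 => i _; have [+ _] := hE i; apply: contraNneq => ->; rewrite ev0.
move=> i; exists (A i * \prod_(k | k != i) E k); have [E0 ->] := hE i.
by rewrite (bigD1 i) //= !evM mulrA mulfVK.
Qed.

(** With [q] a common denominator of a monic relation of [z], the product [z * q(t)] is integral
    over [C[t]], hence regular wherever [t] is. *)
Lemma denominators P t : place P -> regular_off P t -> transcendental iota t ->
  forall z, exists q, q != 0 /\ regular_off P (z * q `@ t).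
Proof.
move=> pP treg tt z; have [m [a [Ca zE]]] := integral_over_Cx z tt.
have m0 : (0 < m)%N.
  by case: m a Ca zE => // a _ /eqP; rewrite big_ord0 expr0 oner_eq0.
have [q [q0 hq]] := common_denominator tt Ca.
exists q; split=> // Q pQ; have [s|nQ] := pselect (same_place Q P); first by left.
right; have vQ := place_val pQ.
have reg p : vge Q 0 (p `@ t) by case: (regular_off_ev p treg pQ).
set y := z * q `@ t.
have [->|y0] := eqVneq y 0; first by rewrite vge0.
have yE : y ^+ m = \sum_(i < m) (a i * q `@ t) * (q `@ t) ^+ (m - i.+1) * y ^+ i.
  rewrite /y exprMn zE mulr_suml; apply: eq_bigr => i _.
  have -> : (q `@ t) ^+ m = q `@ t * (q `@ t) ^+ (m - i.+1) * (q `@ t) ^+ i.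
    by rewrite -exprS -exprD; congr (_ ^+ _); have := ltn_ord i; lia.
  by rewrite exprMn; ring.
rewrite vgeE // leNgt; apply/negP => yneg.
have : vge Q ((m.-1)%:Z * Q y) (y ^+ m).
  rewrite yE; apply: (vge_sum vQ) => i _.
  have [A hA] := hq i; rewrite hA.
  apply: (vgeMl vQ); first by rewrite (vgeM0 vQ) ?(vgeX0 vQ).
  by rewrite vgeE ?expf_neq0 // (nuX vQ) //; have := ltn_ord i; nia.
by rewrite vgeE ?expf_neq0 // (nuX vQ) //; nia.
Qed.

End PoleOrders.

Lemma vge_some_nat (K : fieldType) (v : K -> int) x : exists N : nat, vge v (- N%:Z) x.
Proof. by exists `|v x|%N; rewrite /vge; apply/orP; right; lia. Qed.

Lemma three_terms (K : fieldType) (iota : {rmorphism CC -> K}) v (a b c : K) :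
  is_val iota v -> a + b + c = 0 ->
  (a != 0 -> b != 0 -> v a <> v b) -> (a != 0 -> c != 0 -> v a <> v c) ->
  (b != 0 -> c != 0 -> v b <> v c) -> [/\ a = 0, b = 0 & c = 0].
Proof.
move=> vv.
have two x y : x + y = 0 -> (x != 0 -> y != 0 -> v x <> v y) -> x = 0 /\ y = 0.
  move=> /eqP; rewrite addr_eq0 => /eqP ->; have [->|y0] := eqVneq y 0; first by rewrite oppr0.
  by rewrite oppr_eq0 (nuN vv) => /(_ y0 isT).
move=> e ab ac bc.
have [a0|a0] := eqVneq a 0.
  by move: e; rewrite a0 add0r => /two/(_ bc)[-> ->].
have [b0|b0] := eqVneq b 0.
  by move: e; rewrite b0 addr0 => /two/(_ ac)[-> ->].
have [c0|c0] := eqVneq c 0.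
  by move: e; rewrite c0 addr0 => /two/(_ ab)[-> ->].
have aE : a = - (b + c) by apply/eqP; rewrite -addr_eq0 addrA e.
have va : v a = v (b + c) by rewrite aE (nuN vv).
have [lt|gt|eq_bc] := ltgtP (v b) (v c).
- have [] := @val_addl _ _ _ vv b c b0; first by rewrite vgeE //; lia.
  by move=> _; rewrite -va => /(ab a0 b0).
- have [] := @val_addl _ _ _ vv c b c0; first by rewrite vgeE //; lia.
  by move=> _; rewrite addrC -va => /(ac a0 c0).
by case: (bc b0 c0).
Qed.

(** * The quintic model of a curve of genus two *)

Section GenusTwoModel.
Variables (K : fieldType) (iota : {rmorphism CC -> K}).
Hypothesis ff : function_field iota.
Local Notation "p `@ x" := ((map_poly iota p).[x]) (at level 10).
Local Notation place := (is_place iota).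
Local Notation dimge := (dimge iota).
Local Notation regular_off := (regular_off iota).
Local Notation Lspace := (Lspace iota).
Local Notation pole_order := (pole_order iota).
Local Notation Cx := (Cx iota).

Hypothesis genus_bound : forall A, eff_divisor iota A ->
  dimge (in_LA iota A) (deg_eff A + 1 - 2).
Variable A0 : seq ((K -> int) * nat).
Hypothesis effA0 : eff_divisor iota A0.
Hypothesis special : ~ dimge (in_LA iota A0) (deg_eff A0).

(** Subtracting a multiple of an element of [M] with the same pole order lowers the pole order; the
    induction ends at the constants. *)
Lemma filtration P (M : K -> Prop) N : place P -> (forall c, M (iota c)) ->
  (forall c x y, M x -> M y -> M (x + iota c * y)) ->
  (forall n, (0 < n <= N)%N -> pole_order P n ->
     exists w, [/\ M w, regular_off P w, w != 0 & P w = - n%:Z]) ->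
  forall z, Lspace P N z -> M z.
Proof.
move=> pP MC MD; have vP := place_val pP.
elim: N => [|N IH] Mw z Lz.
  by have [c ->] := Lspace0_const special pP Lz.
have IH' := IH (fun n h => Mw n (ltac:(lia))).
have [hN|gap] := pselect (pole_order P N.+1); last first.
  by apply: IH'; apply: gap_Lspace Lz.
have [hz kz] := Lz; have [->|z0] := eqVneq z 0; first by rewrite -(rmorph0 iota).
have [Pz|Pz] := eqVneq (P z) (- N.+1%:Z); last first.
  by apply: IH'; split=> //; move: kz; rewrite !vgeE //; lia.
have [|w [Mww hw w0 Pw]] := Mw N.+1 _ hN; first by lia.
have [|c hc] := residue_exists (z := z / w) ff pP.
  by rewrite vgeE ?mulf_neq0 ?invr_eq0 // (nuf vP) // Pz Pw subrr.
rewrite -(subrK (iota c * w) z); apply: MD => //; apply: IH'; split.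
  by apply: regular_offB => //; apply: regular_offM => //; apply: regular_offC.
rewrite -(mulfVK w0 z) -mulrBl.
have := vgeM vP hc (vge_refl P w); rewrite Pw.
by rewrite (_ : 1 + - N.+1%:Z = - N%:Z) //; lia.
Qed.

Lemma nonuniq_perm (T : eqType) (s : seq T) : ~~ uniq s ->
  exists r t, perm_eq s (r :: r :: t).
Proof.
elim: s => [//|x s IH] /=; rewrite negb_and negbK => /orP[xs|/IH[r [t h]]].
  by exists x, (rem x s); rewrite perm_cons perm_to_rem.
exists r, (x :: t); rewrite -(perm_cons x) in h; apply: perm_trans h _.
by rewrite -[x :: _]/([:: x] ++ [:: r; r] ++ t) perm_catCA perm_refl.
Qed.

Section Weierstrass.
Variable P : K -> int.
Hypotheses (pP : place P) (h2 : pole_order P 2).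

(** As 1 and 3 are gaps, the orders 2 and 5 of [s] and [u1] generate the semigroup, so the [s ^ i]
    and the [s ^ i * u1] span all functions regular off [P]. Expanding [u1 ^+ 2] in them and
    completing the square gives the equation. *)
Lemma weierstrass_model : exists (s u : K) (es : seq CC),
  [/\ transcendental iota s, size es = 5, uniq es,
      u ^+ 2 = (\prod_(e <- es) ('X - e%:P)) `@ s & forall z, quad (Cx s) u z].
Proof.
have vP := place_val pP.
have g1 := gap1 ff genus_bound effA0 special pP.
have g3 := gap3 ff genus_bound effA0 special pP h2.
have h5 := pole_order_5 ff genus_bound special pP g1 g3.
have [s [sreg s0 Ps]] := h2; have [u1 [u1reg u10 Pu1]] := h5.
have ts : transcendental iota s := pole_transcendental pP (isT : (0 < 2)%N) Ps s0.
(* Up to pole order [N] there are [N./2 + 1] powers [s ^ i] and [(N - 3)./2] products [s ^ i * u1];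
   these numbers bound the sizes of [A] and [B]. *)
pose M (alpha beta : nat) z := exists A B : {poly CC},
  [/\ (size A <= alpha)%N, (size B <= beta)%N & z = A `@ s + B `@ s * u1].
have MC alpha beta c : (0 < alpha)%N -> M alpha beta (iota c).
  exists c%:P, 0; rewrite size_poly0 evC ev0 mul0r addr0; split=> //.
  by apply: leq_trans (size_polyC_leq1 c) _.
have MD alpha beta c x y : M alpha beta x -> M alpha beta y -> M alpha beta (x + iota c * y).
  move=> [A [B [sA sB ->]]] [A' [B' [sA' sB' ->]]].
  exists (A + c *: A'), (B + c *: B'); split.
  - by rewrite (leq_trans (size_polyD _ _)) // geq_max sA (leq_trans (size_scale_leq _ _)).
  - by rewrite (leq_trans (size_polyD _ _)) // geq_max sB (leq_trans (size_scale_leq _ _)).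
  by rewrite -!mul_polyC !evE; ring.
have Mw N n : (0 < n <= N)%N -> pole_order P n ->
    exists w, [/\ M (N./2).+1 ((N - 3)./2) w, regular_off P w, w != 0 & P w = - n%:Z].
  move=> nN hn; have [odd_n|even_n] := boolP (odd n).
    have n5 : (5 <= n)%N.
      have : n <> 1%N by move=> e; move: hn; rewrite e.
      have : n <> 3%N by move=> e; move: hn; rewrite e.
      lia.
    exists (s ^+ ((n - 5)./2) * u1); split.
    - exists 0, 'X^((n - 5)./2); rewrite size_poly0 size_polyXn ev0 add0r !evE; split=> //; lia.
    - by apply: regular_offM => //; apply: regular_offX.
    - by rewrite mulf_neq0 ?expf_neq0.
    by rewrite (nuM vP) ?expf_neq0 // (nuX vP) // Ps Pu1; lia.
  exists (s ^+ (n./2)); split.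
  - exists 'X^(n./2), 0; rewrite size_poly0 size_polyXn ev0 mul0r addr0 !evE; split=> //; lia.
  - exact: regular_offX.
  - by rewrite expf_neq0.
  by rewrite (nuX vP) // Ps; lia.
have MR N z : Lspace P N z -> M (N./2).+1 ((N - 3)./2) z.
  by apply: (filtration pP _ (MD _ _) (Mw N)) => c; apply: MC.
have gen1 z : quad (Cx s) u1 z.
  have [q [q0 hq]] := denominators ff pP sreg ts z.
  have [N hN] := vge_some_nat P (z * q `@ s).
  have [A [B [_ _ e]]] := MR N _ (conj hq hN).
  have qs0 : q `@ s != 0 by apply: transcendental_ev_neq0.
  exists (A `@ s / q `@ s), (B `@ s / q `@ s); split.
  - by exists A, q.
  - by exists B, q.
  by rewrite -(mulfK qs0 z) e; field.
have [|A [B [sA sB u1E]]] := MR 10%N (u1 ^+ 2).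
  split; first exact: regular_offX.
  by rewrite vgeE ?expf_neq0 // (nuX vP) // Pu1.
pose B2 := (2%:R^-1 : CC) *: B; pose u := u1 - B2 `@ s.
have two0 : (2%:R : CC) != 0 by exact: (CC_nat_neq0 1).
have BE : B = B2 *+ 2 by rewrite /B2 -scaler_nat scalerA mulfV // scale1r.
pose D := A + B2 ^+ 2.
have uD : u ^+ 2 = D `@ s.
  by rewrite /u /D sqrrB u1E BE !evE; ring.
have sB2 : (size B2 <= 3)%N by rewrite (leq_trans (size_scale_leq _ _)).
have sD6 : (size D <= 6)%N.
  rewrite (leq_trans (size_polyD _ _)) // geq_max sA /= expr2.
  apply: (leq_trans (size_polyMleq _ _)); apply: leq_trans (_ : (3 + 3).-1 <= 6)%N => //.
  by rewrite -!subn1 leq_sub2r // leq_add.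
have evle (p : {poly CC}) m : (size p <= m)%N -> vge P (- (2 * m.-1)%:Z) (p `@ s).
  move=> sp; have [->|p0] := eqVneq p 0; first by rewrite ev0 vge0.
  have [|ps0 e] := val_ev_pole vP s0 _ p0; first by rewrite Ps.
  rewrite vgeE // e Ps; have : ((size p).-1 <= m.-1)%N by lia.
  by move: (size p).-1 m.-1 => i j; lia.
have [u0 Pu] : u != 0 /\ P u = - 5%:Z.
  rewrite -Pu1; apply: (val_addl vP) => //; rewrite (vgeN vP) Pu1.
  exact: (vgeW _ (evle _ _ sB2)).
(* A smaller degree could not produce the pole of order 10 of [u ^+ 2]. *)
have sD : size D = 6.
  apply/eqP; rewrite eqn_leq sD6 ltnNge; apply/negP => sD5.
  have := evle _ _ sD5; rewrite -uD vgeE ?expf_neq0 // (nuX vP) // Pu; lia.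
have ureg : regular_off P u by apply: regular_offB => //; apply: regular_off_ev.
have [rs DE] := closed_field_poly_normal D.
have D0 : D != 0 by rewrite -size_poly_eq0 sD.
have lD : lead_coef D != 0 by rewrite lead_coef_eq0.
have srs : size rs = 5.
  by move: sD; rewrite DE size_scale // size_prod_XsubC => -[].
(* A double root [r] would give [u / (s - r)] the pole order 5 - 2 = 3, a gap. *)
have urs : uniq rs.
  apply: contrapT => /negP/nonuniq_perm[r [t prm]].
  pose D1 := lead_coef D *: \prod_(e <- t) ('X - e%:P).
  have DE1 : D = ('X - r%:P) ^+ 2 * D1.
    by rewrite {1}DE (perm_big _ prm) /= !big_cons /D1 -scalerAr; congr (_ *: _); ring.
  have sr : s - iota r != 0 by rewrite subr_eq0 transcendental_nonconst.
  have wD : (u / (s - iota r)) ^+ 2 = D1 `@ s.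
    by rewrite expr_div_n uD DE1 evM evXn evXC mulrAC mulfV ?mul1r // expf_neq0.
  apply: g3; exists (u / (s - iota r)); split.
  - move=> Q pQ; have [|h] := regular_off_ev D1 sreg pQ; first by left.
    by right; rewrite -(vge_sqr (place_val pQ)) wD.
  - by rewrite mulf_neq0 ?invr_eq0.
  have Psr : P (s - iota r) = - 2%:Z.
    rewrite -Ps; have [] // := val_addl vP (y := - iota r) s0.
    by rewrite (vgeN vP) Ps (vgeW _ (vgeC vP r)).
  by rewrite (nuf vP) // Pu Psr.
have [l lE] : exists l, l ^+ 2 = lead_coef D.
  have [l hl] := @solve_monicpoly CC 2 (fun i => if i == 0%N then lead_coef D else 0) isT.
  by exists l; rewrite hl !big_ord_recl big_ord0 /= mulr1 mul0r !addr0.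
have l0 : l != 0 by apply: contraNneq lD => l0; rewrite -lE l0 expr0n.
have il0 : iota l != 0 by rewrite iota_eq0.
exists s, (u / iota l), rs; split=> //.
  by rewrite expr_div_n uD {1}DE -mul_polyC evM evC -lE rmorphXn mulrAC mulfV ?mul1r // expf_neq0.
have sf : subfield iota (quad (Cx s) (u / iota l)).
  apply: quad_subfield; first exact: Cx_subfield.
  rewrite expr_div_n uD; exists D, (lead_coef D)%:P.
  by split; rewrite evC ?iota_eq0 // -lE rmorphXn.
have Cq z : Cx s z -> quad (Cx s) (u / iota l) z.
  exact: (quad_base (Cx_subfield iota s)).
move=> z; apply: (quad_sub sf _ Cq (gen1 z)).
rewrite (_ : u1 = iota l * (u / iota l) + B2 `@ s); last first.
  by rewrite mulrCA mulfV // mulr1 /u subrK.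
apply: (sfD sf); last by apply: (sf_ev sf); apply: Cq; apply: Cx_gen.
by apply: (sfM sf); [apply: (sfC sf)|exact: (quad_gen (Cx_subfield iota s))].
Qed.

End Weierstrass.

(** Dividing [U] by [x - c] removes a double root [c] of [D]. This ends at a simple root, or at a
    constant [D], and then [U] is constant too. *)
Lemma reduce_discriminant (x U : K) (D : {poly CC}) : transcendental iota x ->
  U ^+ 2 = D `@ x -> (forall z, quad (Cx x) U z) ->
  (forall z, Cx x z) \/
  exists (U' : K) (D' D1 : {poly CC}) c, [/\ U' ^+ 2 = D' `@ x, D' = ('X - c%:P) * D1,
    D1.[c] != 0 & forall z, quad (Cx x) U' z].
Proof.
move=> tx; have [n] := ubnP (size D); elim: n => // n IH in D U * => szD UD gen.
have sC := Cx_subfield iota x.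
have [D1|D1] := leqP (size D) 1.
  left=> z; have [a [b [Ca Cb ->]]] := gen z.
  have [d hd] : exists d, U = iota d.
    have [l hl] := @solve_monicpoly CC 2 (fun i => if i == 0%N then D`_0 else 0) isT.
    move: hl; rewrite !big_ord_recl big_ord0 /= mulr1 mul0r !addr0 => hl.
    have : U ^+ 2 == iota l ^+ 2 by rewrite UD (size1_polyC D1) evC -rmorphXn hl.
    by rewrite eqf_sqr => /orP[]/eqP ->; [exists l|exists (- l); rewrite rmorphN].
  by apply: (sfD sC) => //; apply: (sfM sC) => //; rewrite hd; apply: (sfC sC).
have [c /factor_theorem[D2 DE]] := closed_rootP _ (ltac:(by rewrite neq_ltn D1 orbT) : size D != 1%N).
have [D2c|D2c] := eqVneq D2.[c] 0; last first.
  by right; exists U, D, D2, c; split=> //; rewrite mulrC.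
have /factor_theorem[D3 D2E] : root D2 c by rewrite /root D2c.
have xc : x - iota c != 0 by rewrite subr_eq0 transcendental_nonconst.
apply: (IH D3 (U / (x - iota c))).
- have D30 : D3 != 0 by apply: contraTneq D1 => D30; rewrite DE D2E D30 !mul0r size_poly0.
  have e : size D = (size D3).+2.
    by rewrite DE D2E -mulrA -expr2 size_Mmonic ?monic_exp ?monicXsubC // size_exp_XsubC !addnS addn0.
  by move: szD; rewrite e !ltnS; apply: ltnW.
- rewrite expr_div_n UD DE D2E !evM evXC.
  by field.
move=> z; have [a [b [Ca Cb ->]]] := gen z.
exists a, (b * (x - iota c)); split=> //; last by field.
by apply: (sfM sC) => //; apply: (sfB sC); [apply: Cx_gen|apply: (sfC sC)].
Qed.

(** [x - c] has a double zero at the ramified place over [c] and no other zero, so its inverse is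
    the function wanted. *)
Lemma simple_root_pole2 (x U : K) (D D1 : {poly CC}) c : transcendental iota x ->
  U ^+ 2 = D `@ x -> D = ('X - c%:P) * D1 -> D1.[c] != 0 ->
  (forall z, quad (Cx x) U z) -> exists P, place P /\ pole_order P 2.
Proof.
move=> tx UD DE D1c gen.
have [P [pP Px]] := ramified_place tx D1c DE UD gen.
have Dc : D.[c] = 0 by rewrite DE hornerM hornerXsubC subrr mul0r.
have D'c : D^`().[c] != 0.
  by rewrite DE derivM derivXsubC hornerD !hornerM hornerXsubC subrr mul0r addr0 hornerC mul1r.
have [_ uniqP] := branch_centre tx UD gen Dc D'c.
have xc : x - iota c != 0 by rewrite subr_eq0 transcendental_nonconst.
exists P; split=> //; exists (x - iota c)^-1; split; last 2 first.
- by rewrite invr_eq0.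
- by rewrite (nuV (place_val pP)) // Px.
move=> Q pQ; have [Qx|Qx] := ltP 0 (Q (x - iota c)).
  by left; apply: uniqP => //; rewrite vgeE // Px.
by right; rewrite vgeE ?invr_eq0 // (nuV (place_val pQ)) //; lia.
Qed.

Lemma rational_pole1 P (x : K) : place P -> transcendental iota x -> P x = -1 ->
  (forall z, Cx x z) -> pole_order P 1.
Proof.
move=> pP tx Px gen; have x0 : x != 0 by have := transcendental_nonconst 0 tx; rewrite rmorph0.
have ty : transcendental iota x^-1.
  apply: nonconst_transcendental => c; apply/eqP => e.
  have := transcendental_nonconst c^-1 tx; rewrite fmorphV -e invrK eqxx //.
have sC := Cx_subfield iota x^-1.
have Cx' : Cx x^-1 x by rewrite -{2}(invrK x); apply: (sfV sC); apply: Cx_gen.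
(* [C(x)] is treated as a quadratic extension with [u = 1] and [D = 1], so that [unramified_centre]
   applies at the zero of [1 / x]. *)
have gen' z : quad (Cx x^-1) 1 z by apply: (quad_base sC); apply: (Cx_sub sC Cx' (gen z)).
have one2 : (1 : K) ^+ 2 = 1 `@ x^-1 by rewrite ev1 expr1n.
have [_ uniqP] := unramified_centre ty one2 gen' 0 (oner_neq0 _).
exists x; split=> // Q pQ.
have centre R : place R -> R x < 0 -> centred iota x^-1 1 0 1 R.
  move=> pR Rx; split=> //; first by rewrite rmorph0 subr0 vgeE ?invr_eq0 // (nuV (place_val pR)) //; lia.
  by rewrite rmorph1 subrr vge0.
have [Qx|Qx] := ltP (Q x) 0; last by right; rewrite vgeE.
by left; apply: uniqP; apply: centre => //; rewrite Px.
Qed.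

(* If neither 1 nor 2 is a pole order at P, functions f, g, h with poles of order
   3, 4, 5 form a basis over C[f] of the functions regular off P. After translating
   so that gh lies in C[f], the multiplication table is that of the cubic form
   C0 T^3 - B0 T^2 + C1 T - B1 with root g / C0(f); its coefficients have degree at
   most 2 in f, so f is quadratic over C(g / C0(f)). *)
Lemma weierstrass_place P : place P -> exists P', place P' /\ pole_order P' 2.
Proof.
move=> pP; have vP := place_val pP.
have [h2|g2] := pselect (pole_order P 2); first by exists P.
have g1 := gap1 ff genus_bound effA0 special pP.
have h3 := pole_orders_3 ff genus_bound special pP g1 g2.
have [f [freg f0 Pf]] := h3 0%N; have [g1' [g1reg g10 Pg1]] := h3 1%N.
have [h1' [h1reg h10 Ph1]] := h3 2%N.
have tf : transcendental iota f := pole_transcendental pP (isT : (0 < 3)%N) Pf f0.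
pose M g h (a b c : nat) z := exists A B C : {poly CC},
  [/\ (size A <= a)%N, (size B <= b)%N, (size C <= c)%N &
      z = A `@ f + B `@ f * g + C `@ f * h].
have MR g h N z : regular_off P g -> g != 0 -> P g = -4 ->
    regular_off P h -> h != 0 -> P h = -5 -> Lspace P N z ->
    M g h (N %/ 3).+1 ((N - 1) %/ 3)%N ((N - 2) %/ 3)%N z.
  move=> greg g0 Pg hreg h0 Ph; apply: filtration => //.
  - move=> c; exists c%:P, 0, 0; rewrite !size_poly0 evC !ev0 !mul0r !addr0; split=> //.
    by apply: leq_trans (size_polyC_leq1 c) _.
  - move=> c x y [A [B [C [sA sB sC ->]]]] [A' [B' [C' [sA' sB' sC' ->]]]].
    have sz (p q : {poly CC}) n : (size p <= n)%N -> (size q <= n)%N -> (size (p + c *: q)%R <= n)%N.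
      by move=> hp hq; rewrite (leq_trans (size_polyD _ _)) // geq_max hp (leq_trans (size_scale_leq _ _)).
    exists (A + c *: A'), (B + c *: B'), (C + c *: C'); rewrite !sz //; split=> //.
    by rewrite -!mul_polyC !evE; ring.
  move=> n nN hn.
  have n3 : (3 <= n)%N.
    have : n <> 1%N by move=> e; move: hn; rewrite e.
    have : n <> 2%N by move=> e; move: hn; rewrite e.
    lia.
  have fX m : f ^+ m != 0 /\ P (f ^+ m) = - (3 * m)%:Z.
    by rewrite expf_neq0 // (nuX vP) // Pf; split=> //; lia.
  have h3m : n = (3 * (n %/ 3) + n %% 3)%N by rewrite mulnC -divn_eq.
  have [r0|r0] := eqVneq (n %% 3)%N 0%N.
    have [fm0 Pfm] := fX (n %/ 3)%N; exists (f ^+ (n %/ 3)); split=> //.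
    - exists 'X^(n %/ 3), 0, 0; rewrite !size_poly0 size_polyXn !evE !mul0r !addr0; split=> //; lia.
    - exact: regular_offX.
    by rewrite Pfm; lia.
  have [r1|r1] := eqVneq (n %% 3)%N 1%N.
    have [fm0 Pfm] := fX (n %/ 3 - 1)%N; exists (f ^+ (n %/ 3 - 1) * g); split.
    - exists 0, 'X^(n %/ 3 - 1), 0; rewrite !size_poly0 size_polyXn !evE !mul0r addr0 add0r; split=> //; lia.
    - by apply: regular_offM => //; apply: regular_offX.
    - by rewrite mulf_neq0.
    by rewrite (nuM vP) // Pfm Pg; lia.
  have [fm0 Pfm] := fX (n %/ 3 - 1)%N; exists (f ^+ (n %/ 3 - 1) * h); split.
  - exists 0, 0, 'X^(n %/ 3 - 1); rewrite !size_poly0 size_polyXn !evE !mul0r !add0r; split=> //; lia.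
  - by apply: regular_offM => //; apply: regular_offX.
  - by rewrite mulf_neq0.
  by rewrite (nuM vP) // Pfm Ph; lia.
have evle (p : {poly CC}) m : (size p <= m)%N -> vge P (- (3 * m.-1)%:Z) (p `@ f).
  move=> sp; have [->|p0] := eqVneq p 0; first by rewrite ev0 vge0.
  have [|ps0 e] := val_ev_pole vP f0 _ p0; first by rewrite Pf.
  rewrite vgeE // e Pf; have : ((size p).-1 <= m.-1)%N by lia.
  by move: (size p).-1 m.-1 => i j; lia.
have Lsp N z : regular_off P z -> z != 0 -> - N%:Z <= P z -> Lspace P N z.
  by move=> hz z0 Pz; split=> //; rewrite vgeE.
have [|n0 [b0 [c0 [sn0 sb0 sc0 gh1]]]] := MR g1' h1' 9%N (g1' * h1') g1reg g10 Pg1 h1reg h10 Ph1.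
  by apply: Lsp; [exact: regular_offM|rewrite mulf_neq0|rewrite (nuM vP) // Pg1 Ph1].
pose g := g1' - c0 `@ f; pose h := h1' - b0 `@ f; pose nn := n0 + b0 * c0.
have ghE : g * h = nn `@ f.
  by rewrite /g /h /nn !evE mulrBl !mulrBr gh1; ring.
have [g0 Pg] : g != 0 /\ P g = -4.
  rewrite -Pg1; apply: (val_addl vP) => //; rewrite (vgeN vP) Pg1.
  exact: (vgeW _ (evle _ _ sc0)).
have [h0 Ph] : h != 0 /\ P h = -5.
  rewrite -Ph1; apply: (val_addl vP) => //; rewrite (vgeN vP) Ph1.
  exact: (vgeW _ (evle _ _ sb0)).
have greg : regular_off P g by apply: regular_offB => //; apply: regular_off_ev.
have hreg : regular_off P h by apply: regular_offB => //; apply: regular_off_ev.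
have {}MR N z := @MR g h N z greg g0 Pg hreg h0 Ph.
clearbody g h nn.
have [|A [B [C [sA sB sC g2E]]]] := MR 8%N (g ^+ 2).
  by apply: Lsp; [exact: regular_offX|rewrite expf_neq0|rewrite (nuX vP) // Pg].
have [|A' [B' [C' [sA' sB' sC' h2E]]]] := MR 10%N (h ^+ 2).
  by apply: Lsp; [exact: regular_offX|rewrite expf_neq0|rewrite (nuX vP) // Ph].
(* 8 = 3 + 5: in the expansion of [g ^+ 2] only a term [f * h] can have its pole order. For [h ^+ 2]
   below, likewise, 10 = 6 + 4 asks for [f ^+ 2 * g]. *)
have szC : size C = 2.
  apply/eqP; rewrite eqn_leq sC ltnNge; apply/negP => sC1.
  have : vge P (-7) (g ^+ 2).
    rewrite g2E !(vgeD vP) ?(vgeW _ (evle _ _ sA)) //.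
      by apply: vgeW (vgeM vP (evle _ _ sB) (vge_refl P g)); rewrite Pg.
    by apply: vgeW (vgeM vP (evle _ _ sC1) (vge_refl P h)); rewrite Ph.
  by rewrite vgeE ?expf_neq0 // (nuX vP) // Pg.
have szB' : size B' = 3.
  apply/eqP; rewrite eqn_leq sB' ltnNge; apply/negP => sB2.
  have : vge P (-9) (h ^+ 2).
    rewrite h2E !(vgeD vP) ?(vgeW _ (evle _ _ sA')) //.
      by apply: vgeW (vgeM vP (evle _ _ sB2) (vge_refl P g)); rewrite Pg.
    by apply: vgeW (vgeM vP (evle _ _ sC') (vge_refl P h)); rewrite Ph.
  by rewrite vgeE ?expf_neq0 // (nuX vP) // Ph.
(* The three terms have pole orders congruent to 0, 1 and 2 modulo 3. *)
have indep (a b c : {poly CC}) : a `@ f + b `@ f * g + c `@ f * h = 0 -> [/\ a = 0, b = 0 & c = 0].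
  have ord (p : {poly CC}) : p `@ f != 0 -> exists n : nat, P (p `@ f) = - (3 * n)%:Z.
    move=> pf; have p0 : p != 0 by apply: contraNneq pf => ->; rewrite ev0.
    have [|_ ->] := val_ev_pole vP f0 _ p0; first by rewrite Pf.
    by exists (size p).-1; rewrite Pf mulrN -PoszM mulnC.
  have ordg : b `@ f * g != 0 -> exists n : nat, P (b `@ f * g) = - (3 * n + 4)%:Z.
    rewrite mulf_eq0 negb_or => /andP[/[dup] nz /ord[n bn] _]; exists n.
    by rewrite (nuM vP) // bn Pg; clear; lia.
  have ordh : c `@ f * h != 0 -> exists n : nat, P (c `@ f * h) = - (3 * n + 5)%:Z.
    rewrite mulf_eq0 negb_or => /andP[/[dup] nz /ord[n bn] _]; exists n.
    by rewrite (nuM vP) // bn Ph; clear; lia.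
  move=> e; have [|||/tf -> /eqP + /eqP] := three_terms vP e.
  - by move=> /ord[i ->] /ordg[j ->]; clear; lia.
  - by move=> /ord[i ->] /ordh[j ->]; clear; lia.
  - by move=> /ordg[i ->] /ordh[j ->]; clear; lia.
  rewrite !mulf_eq0 (negPf g0) (negPf h0) !orbF => /eqP/tf -> /eqP/tf ->.
  by [].
(* Associativity: the two ways to compute [g * g * h] are compared on the basis 1, [g], [h]. *)
have [_ nnE AE] : [/\ B * nn + C * A' = 0, C * B' - nn = 0 & A + C * C' = 0].
  apply: indep; rewrite !evE.
  transitivity ((A `@ f + B `@ f * g + C `@ f * h) * h - g * (nn `@ f)
    + B `@ f * (nn `@ f - g * h) + C `@ f * (A' `@ f + B' `@ f * g + C' `@ f * h - h ^+ 2)); first ring.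
  by rewrite -g2E -h2E -ghE; ring.
have {}nnE : nn = C * B' by rewrite (subr0_eq nnE).
have {}AE : A = - (C * C') by apply/eqP; rewrite -addr_eq0 AE.
have C0 : C != 0 by rewrite -size_poly_eq0 szC.
have Cf0 : C `@ f != 0 by apply: transcendental_ev_neq0.
pose x := g / C `@ f.
have Px : P x = -1.
  by rewrite (nuf vP) // Pg; have [|_ ->] := val_ev_pole vP f0 _ C0; rewrite ?szC Pf.
have gE : g = C `@ f * x by rewrite /x mulrCA mulfV // mulr1.
clearbody x.
have hE : h = C `@ f * x ^+ 2 - B `@ f * x + C' `@ f.
  have e : C `@ f * h = g ^+ 2 + C `@ f * C' `@ f - B `@ f * g.
    by rewrite g2E AE !evE; ring.
  by apply: (mulfI Cf0); rewrite e gE; ring.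
have cubic : C `@ f * x ^+ 3 - B `@ f * x ^+ 2 + C' `@ f * x - B' `@ f = 0.
  apply: (mulfI Cf0); rewrite mulr0.
  transitivity (g * h - (C * B') `@ f); first by rewrite hE gE evM; ring.
  by rewrite -nnE ghE subrr.
have tx : transcendental iota x.
  apply: nonconst_transcendental => c; apply/eqP => xE.
  have nc : c != 0.
    by apply: contraNneq g0 => ec; rewrite gE xE ec rmorph0 mulr0.
  by move: Px; rewrite xE (nuC vP).
have lin (p : {poly CC}) : (size p <= 2)%N -> p `@ f = iota p`_0 + iota p`_1 * f.
  move=> sp; rewrite (@horner_coef_wide _ 2) ?size_map_poly // !big_ord_recl big_ord0.
  by rewrite !coef_map /= expr0 mulr1 expr1 addr0.
have quadr : B' `@ f = iota B'`_0 + iota B'`_1 * f + iota B'`_2 * f ^+ 2.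
  rewrite (@horner_coef_wide _ 3) ?size_map_poly ?szB' // !big_ord_recl big_ord0.
  by rewrite !coef_map /= expr0 mulr1 expr1 addr0 addrA.
(* As an equation for [f] the cubic reads [d2 f^2 + Lp f + Mp = 0], and [U = 2 d2 f + Lp] is a
   square root of its discriminant. *)
pose Lp : {poly CC} := (B'`_1)%:P - ((C`_1)%:P * 'X ^+ 3 - (B`_1)%:P * 'X ^+ 2 + (C'`_1)%:P * 'X).
pose Mp : {poly CC} := (B'`_0)%:P - ((C`_0)%:P * 'X ^+ 3 - (B`_0)%:P * 'X ^+ 2 + (C'`_0)%:P * 'X).
pose d2 := B'`_2; pose U := iota d2 * f *+ 2 + Lp `@ x.
have d20 : d2 != 0 by have := lead_coef_eq0 B'; rewrite lead_coefE szB' -size_poly_eq0 szB' => ->.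
pose D := Lp ^+ 2 - d2%:P * Mp *+ 4.
have UD : U ^+ 2 = D `@ x.
  move: cubic; rewrite (lin C) // (lin B) // (lin C') // quadr => cubic.
  rewrite /U /D !evE; apply/eqP; rewrite -subr_eq0; apply/eqP.
  transitivity (- (4%:R * iota d2) * ((iota C`_0 + iota C`_1 * f) * x ^+ 3 -
    (iota B`_0 + iota B`_1 * f) * x ^+ 2 + (iota C'`_0 + iota C'`_1 * f) * x
    - (iota B'`_0 + iota B'`_1 * f + iota B'`_2 * f ^+ 2))); last by rewrite cubic mulr0.
  by rewrite /d2; ring.
have sf : subfield iota (quad (Cx x) U).
  apply: quad_subfield; first exact: Cx_subfield.
  by rewrite UD; apply: (sf_ev (Cx_subfield iota x)); apply: Cx_gen.
have Cq z : Cx x z -> quad (Cx x) U z by exact: (quad_base (Cx_subfield iota x)).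
have Sx : quad (Cx x) U x by apply/Cq/Cx_gen.
have SU : quad (Cx x) U U by exact: (quad_gen (Cx_subfield iota x)).
have Sf : quad (Cx x) U f.
  have -> : f = (U - Lp `@ x) / (iota d2 * 2%:R).
    have two0 : 2%:R != 0 :> K by exact: (natK_neq0 iota 1).
    have id20 : iota d2 != 0 by rewrite iota_eq0.
    by rewrite /U addrK; field; rewrite id20 two0.
  apply: (sf_div sf); first by apply: (sfB sf) => //; apply: (sf_ev sf).
  by apply: (sfM sf); [apply: (sfC sf)|apply: (sf_nat sf)].
have Sev p : quad (Cx x) U (p `@ f) by apply: (sf_ev sf).
have Sg : quad (Cx x) U g by rewrite gE; apply: (sfM sf).
have Sh : quad (Cx x) U h.
  rewrite hE; apply: (sfD sf) => //; apply: (sfB sf); apply: (sfM sf) => //.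
  exact: (sfX sf).
have gen z : quad (Cx x) U z.
  have [q [q0 hq]] := denominators ff pP freg tf z.
  have qf0 : q `@ f != 0 by apply: transcendental_ev_neq0.
  have [N hN] := vge_some_nat P (z * q `@ f).
  have [a [b [c [_ _ _ e]]]] := MR N _ (conj hq hN).
  rewrite -(mulfK qf0 z); apply: (sf_div sf) => //; rewrite e.
  by apply: (sfD sf); [apply: (sfD sf) => //|]; apply: (sfM sf).
have [genx|[U' [D' [D1 [c [UD' DE D1c gen']]]]]] := reduce_discriminant tx UD gen.
  by case: g1; apply: (rational_pole1 pP tx Px genx).
exact: (simple_root_pole2 tx UD' DE D1c gen').
Qed.

End GenusTwoModel.

Theorem genus2_model (K : fieldType) (iota : {rmorphism CC -> K}) :
  function_field iota -> genus_eq iota 2 ->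
  exists (s u : K) (es : seq CC), [/\ transcendental iota s, size es = 5, uniq es,
      u ^+ 2 = (map_poly iota (\prod_(e <- es) ('X - e%:P))).[s]
      & forall z, quad (Cx iota s) u z].
Proof.
move=> ff [bound [A [effA [degA special]]]].
have special' : ~ dimge iota (in_LA iota A) (deg_eff A).
  have e : (deg_eff A + 1 - 2).+1 = deg_eff A by clear -degA; lia.
  by move: special; rewrite e.
have [P pP] : exists P, is_place iota P.
  case: A effA degA {special special'} => [_|a A [pA _] _].
    by rewrite /deg_eff big_nil.
  by exists a.1; apply: (pA 0%N).
have [P' [pP' h2]] := weierstrass_place ff bound effA special' pP.
exact: (weierstrass_model ff bound effA special' pP' h2).
Qed.

(** * Tripling on a cubic curve *)

(* On y^2 = cf x, cpsi is the 3-division polynomial, and the triple of (x, y) is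
   (cN / cpsi^2, y cOm / cpsi^3). *)
Section TriplingPolynomials.
Variable R : comPzRingType.
Implicit Types a b x : R.

Definition cf a b x : R := x ^+ 3 + a * x + b.
Definition cH a x : R := 3%:R * x ^+ 2 + a.
Definition cpsi a b x : R := 12%:R * x * cf a b x - cH a x ^+ 2.
Definition cN a b x : R := x * cpsi a b x ^+ 2 - 8%:R * cf a b x * cH a x * cpsi a b x
  + 64%:R * cf a b x ^+ 3.
Definition cOm a b x : R := - cpsi a b x ^+ 3
  - 4%:R * (16%:R * cf a b x ^+ 2 - cH a x * cpsi a b x)
         * (8%:R * cf a b x ^+ 2 - cH a x * cpsi a b x).

Lemma tripling_curve a b x : cf a b x * cOm a b x ^+ 2 =
  cN a b x ^+ 3 + a * cN a b x * cpsi a b x ^+ 4 + b * cpsi a b x ^+ 6.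
Proof. by rewrite /cN /cOm /cpsi /cf /cH; ring. Qed.

End TriplingPolynomials.

Section TriplingDerivatives.
Variables a b : CC.
Local Notation f := (cf a%:P b%:P 'X).
Local Notation H := (cH a%:P 'X).
Local Notation psi := (cpsi a%:P b%:P 'X).
Local Notation N := (cN a%:P b%:P 'X).
Local Notation Om := (cOm a%:P b%:P 'X).

Lemma deriv_nat (R : nzRingType) (n : nat) : (n%:R : {poly R})^`() = 0.
Proof. by rewrite -polyC_natr derivC. Qed.
Let dE := (derivXn, deriv_exp, derivD, derivB, derivN, derivM, derivX, derivC, deriv_nat).

Lemma deriv_f : f^`() = H.
Proof. by rewrite /cf /cH !dE /=; ring. Qed.

(** With this, a root of [psi] that is not a root of [f] is simple. *)
Lemma deriv_psi : psi^`() = 12%:R * f.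
Proof. by rewrite /cpsi /cf /cH !dE /=; ring. Qed.

(** Tripling multiplies the invariant differential [dx / y] by 3: the derivative of the abscissa
    [N / psi^2] is [3 Om / psi^3], three times the quotient of the ordinates. *)
Lemma deriv_N : N^`() * psi - 2%:R * N * psi^`() = 3%:R * Om.
Proof. by rewrite /cOm /cN /cpsi /cf /cH !dE /=; ring. Qed.

(** The same fact for the ordinate [y Om / psi^3]: with [X = N / psi^2] its derivative is
    [3 (3 X^2 + a) / (2 y)], and [2 y psi^4] clears the denominators. *)
Lemma deriv_Om : (H * Om + 2%:R * f * Om^`()) * psi - 6%:R * f * Om * psi^`() =
  3%:R * (3%:R * N ^+ 2 + a%:P * psi ^+ 4).
Proof. by rewrite /cOm /cN /cpsi /cf /cH !dE /=; ring. Qed.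

End TriplingDerivatives.

(** * Degrees and leading coefficients of the tripling polynomials *)

Section LeadingTerms.
Implicit Types p q : {poly CC}.

(** [c] may be 0, so that sums need no case distinction; once [c] is known to be nonzero,
    [lead_at_size] gives the degree. *)
Definition lead_at p (n : nat) (c : CC) : Prop := (size p <= n.+1)%N /\ p`_n = c.

Lemma lead_atD p q n c c' : lead_at p n c -> lead_at q n c' -> lead_at (p + q) n (c + c').
Proof.
move=> [sp <-] [sq <-]; split; last by rewrite coefD.
by rewrite (leq_trans (size_polyD _ _)) // geq_max sp.
Qed.
Lemma lead_atN p n c : lead_at p n c -> lead_at (- p) n (- c).
Proof. by move=> [sp <-]; split; rewrite ?size_polyN ?coefN. Qed.
Lemma lead_atM p q m n c c' : lead_at p m c -> lead_at q n c' ->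
  lead_at (p * q) (m + n)%N (c * c').
Proof.
move=> [sp <-] [sq <-]; split.
  apply: leq_trans (size_polyMleq _ _) _.
  by rewrite -subn1 leq_subLR add1n -addnS -addSn leq_add.
have mn : (m < (m + n).+1)%N by lia.
rewrite coefM (bigD1 (Ordinal mn)) //= big1 ?addr0 ?addKn // => i im.
have [lt|ge] := ltnP i m; last by rewrite [p`_i]nth_default ?mul0r // (leq_trans sp) // ltn_neqAle eq_sym im.
by rewrite [q`_ _]nth_default ?mulr0 // (leq_trans sq) //; lia.
Qed.
Lemma lead_atX p n c k : lead_at p n c -> lead_at (p ^+ k) (k * n)%N (c ^+ k).
Proof.
move=> h; elim: k => [|k IH]; first by split; rewrite ?size_poly1 ?coef1.
by rewrite !exprS mulSn; apply: lead_atM.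
Qed.
Lemma lead_atC c : lead_at c%:P 0 c.
Proof. by split; rewrite ?size_polyC_leq1 ?coefC. Qed.
Lemma lead_at_nat n : lead_at n%:R 0 n%:R.
Proof. by rewrite -polyC_natr; apply: lead_atC. Qed.
Lemma lead_at_var : lead_at 'X 1 1.
Proof. by split; rewrite ?size_polyX ?coefX. Qed.
Lemma lead_at_low p m n c : (m < n)%N -> lead_at p m c -> lead_at p n 0.
Proof.
move=> mn [sp _]; split; first by rewrite (leq_trans sp) // ltnS ltnW.
by rewrite nth_default // (leq_trans sp).
Qed.

Lemma lead_at_size p n c : c != 0 -> lead_at p n c -> size p = n.+1.
Proof.
move=> c0 [sp pc]; apply/eqP; rewrite eqn_leq sp ltnNge; apply: contra c0 => h.
by rewrite -pc nth_default.
Qed.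

Variables a b : CC.
Local Notation f := (cf a%:P b%:P 'X).
Local Notation H := (cH a%:P 'X).
Local Notation psi := (cpsi a%:P b%:P 'X).
Local Notation N := (cN a%:P b%:P 'X).
Local Notation Om := (cOm a%:P b%:P 'X).

Lemma lead_f : lead_at f 3 1.
Proof.
have := lead_atD (lead_atD (lead_atX 3 lead_at_var)
  (lead_at_low (isT : 1 < 3)%N (lead_atM (lead_atC a) lead_at_var)))
  (lead_at_low (isT : 0 < 3)%N (lead_atC b)).
by rewrite expr1n !addr0.
Qed.
Lemma lead_H : lead_at H 2 3%:R.
Proof.
have := lead_atD (lead_atM (lead_at_nat 3) (lead_atX 2 lead_at_var))
  (lead_at_low (isT : 0 < 2)%N (lead_atC a)).
by rewrite expr1n mulr1 addr0.
Qed.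
Lemma lead_psi : lead_at psi 4 3%:R.
Proof.
have := lead_atD (lead_atM (lead_atM (lead_at_nat 12) lead_at_var) lead_f)
  (lead_atN (lead_atX 2 lead_H)).
by congr (lead_at _ _ _); ring.
Qed.
Lemma lead_N : lead_at N 9 1.
Proof.
have := lead_atD (lead_atD (lead_atM lead_at_var (lead_atX 2 lead_psi))
  (lead_atN (lead_atM (lead_atM (lead_atM (lead_at_nat 8) lead_f) lead_H) lead_psi)))
  (lead_atM (lead_at_nat 64) (lead_atX 3 lead_f)).
by congr (lead_at _ _ _); ring.
Qed.
Lemma lead_slope : lead_at (16%:R * f ^+ 2 - H * psi) 6 7%:R.
Proof.
have := lead_atD (lead_atM (lead_at_nat 16) (lead_atX 2 lead_f)) (lead_atN (lead_atM lead_H lead_psi)).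
by congr (lead_at _ _ _); ring.
Qed.
Lemma lead_Om : lead_at Om 12 1.
Proof.
have := lead_atD (lead_atN (lead_atX 3 lead_psi))
  (lead_atN (lead_atM (lead_atM (lead_at_nat 4) lead_slope)
   (lead_atD (lead_atM (lead_at_nat 8) (lead_atX 2 lead_f)) (lead_atN (lead_atM lead_H lead_psi))))).
by congr (lead_at _ _ _); ring.
Qed.
(** Divided by [2 y psi] this is [y - tn x], the intercept of the chord through [(x, y)] and its
    double. Its coefficient [2 * 3 - 7] is not 0, which fixes the pole order at the origin
    exactly. *)
Lemma lead_tangent : lead_at (2%:R * f * psi - 'X * (16%:R * f ^+ 2 - H * psi)) 7 (-1).
Proof.
have := lead_atD (lead_atM (lead_atM (lead_at_nat 2) lead_f) lead_psi)
  (lead_atN (lead_atM lead_at_var lead_slope)).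
by congr (lead_at _ _ _); ring.
Qed.
End LeadingTerms.

Section Tripling.
Variable K : fieldType.
Implicit Types A B C D x y : K.

(* (tX, tY) is 3 (x, y) and (ts, tYs) is (C, D) + 3 (x, y); tn is the slope of the chord
   through (x, y) and 2 (x, y), and - tl that of the chord through (C, D) and 3 (x, y). *)
Definition tX A B x := cN A B x / cpsi A B x ^+ 2.
Definition tY A B x y := y * cOm A B x / cpsi A B x ^+ 3.
Definition tn A B x y := (16%:R * cf A B x ^+ 2 - cH A x * cpsi A B x) / (2%:R * y * cpsi A B x).
Definition tl A B C D x y := (D - tY A B x y) / (tX A B x - C).
Definition ts A B C D x y := tl A B C D x y ^+ 2 - tX A B x - C.
Definition tYs A B C D x y := tl A B C D x y * (ts A B C D x y - C) - D.

Lemma tX_curve A B x y : y ^+ 2 = cf A B x -> cpsi A B x != 0 ->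
  tY A B x y ^+ 2 = cf A B (tX A B x).
Proof.
move=> yx p0; rewrite /tY expr_div_n exprMn yx tripling_curve /tX [cf _ _ (_ / _)]/cf.
by field.
Qed.

Lemma translate_curve A B C D X Y l : D ^+ 2 = cf A B C -> Y ^+ 2 = cf A B X ->
  X != C -> l * (X - C) = D - Y ->
  (l * (l ^+ 2 - X - C - C) - D) ^+ 2 = cf A B (l ^+ 2 - X - C).
Proof.
move=> DC YX XC lE; have XC0 : X - C != 0 by rewrite subr_eq0.
have YE : Y = D - l * (X - C) by rewrite lE; ring.
(* The two points on the curve determine [A] and [B]; once these are eliminated, the claim is a
   polynomial identity. *)
have BE : B = D ^+ 2 - C ^+ 3 - A * C by rewrite DC /cf; ring.
have AE : A = - l * (2%:R * D - l * (X - C)) - X ^+ 2 - X * C - C ^+ 2.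
  apply: (mulfI XC0); apply/eqP; rewrite -subr_eq0; apply/eqP.
  transitivity (cf A B X - Y ^+ 2); last by rewrite YX subrr.
  by rewrite /cf BE YE; ring.
by rewrite BE AE /cf; ring.
Qed.

(* Y is the chord through (x, y) and its double, of slope n, met with the curve. *)
Lemma tY_chord A B x y : y ^+ 2 = cf A B x -> y != 0 -> cpsi A B x != 0 -> 2%:R != 0 :> K ->
  tY A B x y = - y - tn A B x y * (tX A B x - x).
Proof.
move=> yx y0 p0 two0; rewrite /tY /tn /tX.
apply: (mulfI (mulf_neq0 two0 y0)).
transitivity (2%:R * y ^+ 2 * cOm A B x / cpsi A B x ^+ 3).
  by field.
transitivity (- 2%:R * y ^+ 2 - (16%:R * cf A B x ^+ 2 - cH A x * cpsi A B x) / cpsi A B x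
   * (cN A B x / cpsi A B x ^+ 2 - x)); last by field; rewrite p0 two0 y0.
rewrite yx /cN; have := p0; set p := cpsi A B x; set f := cf A B x; set h := cH A x => {}p0.
by rewrite /cOm -/p -/f -/h; field.
Qed.
End Tripling.

(** * Orders of the coordinates of 3 (x, y) and of (c, d) + 3 (x, y) *)

Section LocalOrders.
Variables (K : fieldType) (iota : {rmorphism CC -> K}).
Local Notation "p `@ x" := ((map_poly iota p).[x]) (at level 10).
Variables (a b : CC).
Local Notation A := (iota a).
Local Notation B := (iota b).
Local Notation fP := (cf a%:P b%:P 'X).
Local Notation HP := (cH a%:P 'X).
Local Notation psiP := (cpsi a%:P b%:P 'X).
Local Notation NP := (cN a%:P b%:P 'X).
Local Notation OmP := (cOm a%:P b%:P 'X).

Let eE := (evMn, evXn, evD, evN, evM, ev1, evC, evX).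
Lemma ev_f x : fP `@ x = cf A B x.
Proof. by rewrite /cf !eE. Qed.
Lemma ev_H x : HP `@ x = cH A x.
Proof. by rewrite /cH !eE. Qed.
Lemma ev_psi x : psiP `@ x = cpsi A B x.
Proof. by rewrite /cpsi !(ev_f, ev_H, eE). Qed.
Lemma ev_N x : NP `@ x = cN A B x.
Proof. by rewrite /cN !(ev_f, ev_H, ev_psi, eE). Qed.
Lemma ev_Om x : OmP `@ x = cOm A B x.
Proof. by rewrite /cOm !(ev_f, ev_H, ev_psi, eE). Qed.

Let hE := (hornerMn, horner_exp, hornerD, hornerN, hornerM, hornerX, hornerC).
Lemma horner_f r : fP.[r] = cf a b r.
Proof. by rewrite /cf !hE. Qed.
Lemma horner_H r : HP.[r] = cH a r.
Proof. by rewrite /cH !hE. Qed.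
Lemma horner_psi r : psiP.[r] = cpsi a b r.
Proof. by rewrite /cpsi !(horner_f, horner_H, hE). Qed.
Lemma horner_N r : NP.[r] = cN a b r.
Proof. by rewrite /cN !(horner_f, horner_H, horner_psi, hE). Qed.
Lemma horner_Om r : OmP.[r] = cOm a b r.
Proof. by rewrite /cOm !(horner_f, horner_H, horner_psi, hE). Qed.

Variable v : K -> int.
Hypothesis vv : is_val iota v.

Lemma lead_order (p : {poly CC}) n l x : lead_at p n l -> l != 0 -> x != 0 -> v x < 0 ->
  p `@ x != 0 /\ v (p `@ x) = n%:Z * v x.
Proof.
move=> lp l0 x0 vx; have sp := lead_at_size l0 lp.
have p0 : p != 0 by rewrite -size_poly_eq0 sp.
by have [? ->] := val_ev_pole vv x0 vx p0; rewrite sp.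
Qed.

Lemma cubic_pole x y : y ^+ 2 = cf A B x -> x != 0 -> v x < 0 ->
  y != 0 /\ exists k : int, [/\ 0 < k, v x = - 2 * k & v y = - 3 * k].
Proof.
move=> yx x0 vx; have [f0 vf] := lead_order (lead_f a b) (oner_neq0 _) x0 vx.
rewrite ev_f -yx in f0 vf.
have y0 : y != 0 by apply: contraNneq f0 => ->; rewrite expr0n.
split=> //; move: vf; rewrite (nuX vv) // => vf; exists (v x - v y); split; clear -vf vx; lia.
Qed.

Section Translation.
Variables (c d : CC) (X Y l : K) (j : int).
Hypotheses (d0 : d != 0) (YX : Y ^+ 2 = cf A B X) (DC : d ^+ 2 = cf a b c).
Hypotheses (j0 : 0 < j) (X0 : X != 0) (Y0 : Y != 0) (vX : v X = - 2 * j) (vY : v Y = - 3 * j).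
Hypothesis lE : l * (X - iota c) = iota d - Y.
Variables (s Ys : K).
Hypotheses (sE : s = l ^+ 2 - X - iota c) (YsE : Ys = l * (s - iota c) - iota d).

(** Translation by [(c, d)] is unramified: if [(X, Y)] is close to the origin, with local parameter
    of order [j], then [s - c] behaves like [- 2 d Y / X^2], which has order [j] because [d] is not
    0. *)
Lemma translate_near_zero : [/\ X != iota c, v (X - iota c) = - 2 * j, l != 0 & v l = - j] /\
  [/\ s != iota c, v (s - iota c) = j & vge v j (Ys - iota d)].
Proof.
have [XC vXC] : X - iota c != 0 /\ v (X - iota c) = - 2 * j.
  rewrite -vX; apply: (val_addl vv) => //; rewrite (vgeN vv).
  by apply: (vgeW _ (vgeC vv c)); rewrite vX; clear -j0; lia.
have [YD vYD] : iota d - Y != 0 /\ v (iota d - Y) = - 3 * j.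
  rewrite addrC -vY -(nuN vv Y); apply: (val_addl vv); first by rewrite oppr_eq0.
  by apply: (vgeW _ (vgeC vv d)); rewrite (nuN vv) vY; clear -j0; lia.
have l0 : l != 0 by apply: contraNneq YD => l0; rewrite -lE l0 mul0r.
have vl : v l = - j.
  by have := congr1 v lE; rewrite (nuM vv) // vXC vYD; clear; lia.
have scE : (s - iota c) * (X - iota c) ^+ 2 =
    - (2%:R * iota d) * Y + iota (3%:R * c ^+ 2 + a) * X + iota (b + d ^+ 2 - 2%:R * c ^+ 3).
  transitivity ((l * (X - iota c)) ^+ 2 - (X + 2%:R * iota c) * (X - iota c) ^+ 2).
    by rewrite sE; ring.
  rewrite lE !(rmorphD, rmorphB, rmorphM, rmorphXn, rmorph_nat).
  transitivity (Y ^+ 2 + iota d ^+ 2 - 2%:R * iota d * Y - (X + 2%:R * iota c) * (X - iota c) ^+ 2); first ring.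
  by rewrite YX /cf; ring.
have dY0 : - (2%:R * iota d) * Y != 0.
  by rewrite mulf_neq0 // oppr_eq0 mulf_neq0 ?iota_eq0 // (natK_neq0 iota 1).
have vdY : v (- (2%:R * iota d) * Y) = - 3 * j.
  have two0 : 2%:R != 0 :> K by exact: (natK_neq0 iota 1).
  have id0 : iota d != 0 by rewrite iota_eq0.
  rewrite (nuM vv) ?oppr_eq0 ?mulf_neq0 // (nuN vv) (nuM vv) // (nu_natr vv 1) (nuC vv) //.
  by rewrite vY !add0r.
have [R0 vR] : (s - iota c) * (X - iota c) ^+ 2 != 0 /\ v ((s - iota c) * (X - iota c) ^+ 2) = - 3 * j.
  rewrite scE -vdY -addrA; apply: (val_addl vv) => //; rewrite vdY.
  apply: (vgeD vv); last by apply: (vgeW _ (vgeC vv _)); clear -j0; lia.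
  apply: (vgeMl vv); first exact: (vgeC vv).
  by rewrite vgeE // vX; clear -j0; lia.
have s0 : s - iota c != 0 by apply: contraNneq R0 => ->; rewrite mul0r.
have vs : v (s - iota c) = j.
  by move: vR; rewrite (nuM vv) ?expf_neq0 // (nuX vv) // vXC; clear; lia.
split; [by split; first by rewrite -subr_eq0|split; [by rewrite -subr_eq0|exact: vs|]].
have Ys2 : Ys ^+ 2 = cf A B s.
  rewrite YsE sE; apply: (translate_curve _ YX _ lE); last by rewrite -subr_eq0.
  by rewrite -rmorphXn DC /cf !(rmorphD, rmorphM, rmorphXn).
have lsE : Ys + iota d = l * (s - iota c) by rewrite YsE subrK.
have Yd0 : Ys + iota d != 0 by rewrite lsE mulf_neq0.
have vYd : v (Ys + iota d) = 0 by rewrite lsE (nuM vv) // vl vs; clear; lia.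
(* [Ys + d = l (s - c)] is a unit, so [Ys - d] has the order of [Ys^2 - d^2 = f(s) - f(c)]. *)
apply: (vge_mulK vv Yd0); rewrite vYd addr0.
have -> : (Ys - iota d) * (Ys + iota d) =
    (s ^+ 2 + s * iota c + iota c ^+ 2 + A) * (s - iota c).
  transitivity (Ys ^+ 2 - iota (d ^+ 2)); first by rewrite rmorphXn; ring.
  by rewrite Ys2 DC /cf !(rmorphD, rmorphM, rmorphXn); ring.
apply: (vgeMl vv); last by rewrite vgeE // vs.
have sreg : vge v 0 s by apply: (@res_reg _ _ _ vv s c); rewrite vgeE // vs; clear -j0; lia.
by rewrite !(vgeD vv) ?(vgeX0 vv) ?(vgeM0 vv) ?(vgeC vv) // ?(vgeX0 vv) ?(vgeC vv).
Qed.
End Translation.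

Variables x y : K.
Hypothesis yx : y ^+ 2 = cf A B x.
Local Notation X := (tX A B x).
Local Notation Y := (tY A B x y).
Local Notation n := (tn A B x y).

Let two0 : 2%:R != 0 :> K. Proof. exact: natK_neq0 iota 1. Qed.

Lemma tripling_pole : x != 0 -> v x < 0 -> exists k : int,
  [/\ 0 < k, v x = - 2 * k, v y = - 3 * k & y != 0] /\
  [/\ cpsi A B x != 0, v (cpsi A B x) = - 8 * k, X != 0 & Y != 0] /\
  [/\ v X = - 2 * k, v Y = - 3 * k, vge v (- k) n & y - n * x != 0 /\ v (y - n * x) = - 3 * k].
Proof.
move=> x0 vx; have [y0 [k [k0 vxk vyk]]] := cubic_pole yx x0 vx; exists k.
have three0 : 3%:R != 0 :> CC by exact: CC_nat_neq0 2.
have seven0 : 7%:R != 0 :> CC by exact: CC_nat_neq0 6.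
have [p0 vp] := lead_order (lead_psi a b) three0 x0 vx; rewrite ev_psi in p0 vp.
have [N0 vN] := lead_order (lead_N a b) (oner_neq0 _) x0 vx; rewrite ev_N in N0 vN.
have [Om0 vOm] := lead_order (lead_Om a b) (oner_neq0 _) x0 vx; rewrite ev_Om in Om0 vOm.
have [S0 vS] := lead_order (lead_slope a b) seven0 x0 vx.
have m10 : (-1 : CC) != 0 by rewrite oppr_eq0 oner_neq0.
have [T0 vT] := lead_order (lead_tangent a b) m10 x0 vx.
rewrite !(ev_f, ev_H, ev_psi, eE) in S0 vS T0 vT.
have d0 : 2%:R * y * cpsi A B x != 0 by rewrite !mulf_neq0.
have vd : v (2%:R * y * cpsi A B x) = - 11 * k.
  by rewrite !(nuM vv) ?mulf_neq0 // (nu_natr vv 1) vp vyk vxk; clear; lia.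
split; first by split.
split; first split=> //.
- by rewrite vp vxk; clear; lia.
- by rewrite mulf_neq0 // invr_eq0 expf_neq0.
- by rewrite !mulf_neq0 // invr_eq0 expf_neq0.
split.
- by rewrite (nuf vv) ?expf_neq0 // (nuX vv) // vN vp vxk; clear; lia.
- by rewrite (nuf vv) ?mulf_neq0 ?expf_neq0 // (nuM vv) // (nuX vv) // vOm vp vxk vyk; clear; lia.
- apply: (vge_div vv) => //; rewrite vd vgeE // vS vxk; clear; lia.
have -> : y - n * x = (2%:R * cf A B x * cpsi A B x -
    x * (16%:R * cf A B x ^+ 2 - cH A x * cpsi A B x)) / (2%:R * y * cpsi A B x).
  by rewrite /tn -yx; field; rewrite p0 two0 y0.
rewrite mulf_neq0 ?invr_eq0 //; split=> //.
by rewrite (nuf vv) // vT vd vxk; clear; lia.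
Qed.

Section Finite.
Variable x0 : CC.
Hypotheses (xx0 : x != iota x0) (hx : vge v 1 (x - iota x0)).
Hypothesis sep : forall r, cf a b r = 0 -> cH a r != 0.

(** For [l] a square root of [f(x0)], one of [y - l] and [y + l] has positive order because their
    product has. *)
Let res_y : exists2 y0 : CC, y0 ^+ 2 = cf a b x0 & vge v 1 (y - iota y0).
Proof.
have [l hl] := @solve_monicpoly CC 2 (fun i => if i == 0%N then cf a b x0 else 0) isT.
move: hl; rewrite !big_ord_recl big_ord0 /= mulr1 mul0r !addr0 => hl.
have : vge v 1 ((y - iota l) * (y + iota l)).
  rewrite -subr_sqr yx -rmorphXn hl -ev_f -horner_f.
  exact: (res_ev vv).
have [e|n1] := eqVneq (y - iota l) 0; first by exists l; rewrite ?e ?vge0.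
have [e|n2] := eqVneq (y + iota l) 0.
  by exists (- l); rewrite ?sqrrN // rmorphN opprK e vge0.
rewrite vgeE ?mulf_neq0 // (nuM vv) // => h.
have [h1|h1] := leP 1 (v (y - iota l)); first by exists l; rewrite ?vgeE.
exists (- l); rewrite ?sqrrN // rmorphN opprK vgeE //. move: h h1; move: (v (y - iota l)) (v (y + iota l)) => p q; clear; lia.
Qed.

Lemma y_regular : vge v 0 y.
Proof. by have [y0 _ hy] := res_y; apply: (res_reg vv hy). Qed.

Lemma y_unit : cf a b x0 != 0 -> y != 0 /\ v y = 0.
Proof.
move=> f0; have [y0 y0E hy] := res_y; apply: (val_unit_const vv) hy.
by apply: contraNneq f0 => e; rewrite -y0E e expr0n.
Qed.

Lemma x_branch : cf a b x0 = 0 -> y != 0 -> v (x - iota x0) = 2 * v y.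
Proof.
move=> f0 y0; have [||_ ve] := val_ev_simple vv (p := fP) xx0 hx.
- by rewrite horner_f.
- by rewrite deriv_f horner_H sep.
by rewrite -ve ev_f -yx (nuX vv).
Qed.

Lemma psi_order : cpsi a b x0 = 0 -> [/\ cf a b x0 != 0, cpsi A B x != 0 &
   v (cpsi A B x) = v (x - iota x0)].
Proof.
move=> p0; have f0 : cf a b x0 != 0.
  apply/eqP => f0; have := sep f0; move/eqP: p0.
  by rewrite /cpsi f0 mulr0 sub0r oppr_eq0 expf_eq0 /= => ->.
have [||px vp] := val_ev_simple vv (p := psiP) xx0 hx.
- by rewrite horner_psi.
- by rewrite deriv_psi hornerM horner_f hornerMn hornerC mulf_neq0 // CC_nat_neq0.
by rewrite ev_psi in px vp.
Qed.

(** At a root of [psi] the values [64 f^3] of [N] and [- 512 f^4] of [Om] are not 0, so the orders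
    of [X] and [Y] come from their denominators alone. *)
Lemma tripling_torsion : cpsi a b x0 = 0 -> let g := v (x - iota x0) in
  [/\ 0 < g, y != 0, v y = 0, cpsi A B x != 0 & v (cpsi A B x) = g] /\
  [/\ X != 0, Y != 0, v X = - 2 * g, v Y = - 3 * g & vge v (- g) n].
Proof.
move=> p0 g; have [f0 px0 vp] := psi_order p0.
have g0 : 0 < g by move: hx; rewrite vgeE ?subr_eq0 // -/g; clear; lia.
have [y0 vy] := y_unit f0.
have [N0 vN] : cN A B x != 0 /\ v (cN A B x) = 0.
  rewrite -ev_N; apply: (val_ev_unit vv hx).
  rewrite horner_N /cN p0 expr0n !mulr0 subr0 add0r mulf_neq0 ?expf_neq0 //.
  exact: CC_nat_neq0.
have [Om0 vOm] : cOm A B x != 0 /\ v (cOm A B x) = 0.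
  rewrite -ev_Om; apply: (val_ev_unit vv hx).
  rewrite horner_Om /cOm p0 expr0n !mulr0 !subr0 oppr0 add0r oppr_eq0.
  by rewrite !mulf_neq0 ?expf_neq0 // CC_nat_neq0.
split; first by split.
split; rewrite ?mulf_neq0 ?invr_eq0 ?expf_neq0 //.
- by rewrite (nuf vv) ?expf_neq0 // (nuX vv) // vN vp; clear; lia.
- by rewrite (nuf vv) ?mulf_neq0 ?expf_neq0 // (nuM vv) // (nuX vv) // vOm vy vp; clear; lia.
apply: (vge_div vv); first by rewrite !mulf_neq0.
rewrite !(nuM vv) ?mulf_neq0 // (nu_natr vv 1) vy vp -/g !add0r addNr.
rewrite (_ : _ - _ = (16%:R * fP ^+ 2 - HP * psiP) `@ x).
  exact: (vge_ev vv _ (res_reg vv hx)).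
by rewrite !(ev_f, ev_H, ev_psi, eE).
Qed.

(** The slope [n] itself has a pole at the 2-torsion points, where [y] vanishes; hence the product
    [y * n]. *)
Lemma tripling_regular : cpsi a b x0 != 0 -> y != 0 ->
  [/\ cpsi A B x != 0, v (cpsi A B x) = 0, vge v 0 X, vge v 0 Y & vge v 0 (y * n)].
Proof.
move=> p0 y0; have [px0 vp] : cpsi A B x != 0 /\ v (cpsi A B x) = 0.
  by rewrite -ev_psi; apply: (val_ev_unit vv hx); rewrite horner_psi.
have xr := res_reg vv hx.
split=> //.
- apply: (vge_div vv); first by rewrite expf_neq0.
  by rewrite (nuX vv) // vp mulr0 addr0 -ev_N (vge_ev vv).
- apply: (vge_div vv); first by rewrite expf_neq0.
  by rewrite (nuX vv) // vp mulr0 addr0 (vgeM0 vv) ?y_regular // -ev_Om (vge_ev vv).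
have -> : y * n = (16%:R * cf A B x ^+ 2 - cH A x * cpsi A B x) / (2%:R * cpsi A B x).
  by rewrite /tn; field; rewrite px0 two0 y0.
apply: (vge_div vv); first by rewrite mulf_neq0.
rewrite (nuM vv) // (nu_natr vv 1) vp !addr0.
rewrite (_ : _ - _ = (16%:R * fP ^+ 2 - HP * psiP) `@ x).
  exact: (vge_ev vv _ xr).
by rewrite !(ev_f, ev_H, ev_psi, eE).
Qed.

(* The tripling map is unramified: one of X - X(x0), Y vanishes at the point to the
   same order as a local parameter of the curve at (x, y). *)
Lemma tripling_unramified (V : int -> Prop) : int_subgroup V -> cpsi a b x0 != 0 -> y != 0 ->
  (forall r, X != iota r -> V (v (X - iota r))) -> (Y != 0 -> V (v Y)) ->
  V (v (x - iota x0)) /\ V (v y).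
Proof.
move=> sV p0 y0 VX VY; have [px0 vp] : cpsi A B x != 0 /\ v (cpsi A B x) = 0.
  by rewrite -ev_psi; apply: (val_ev_unit vv hx); rewrite horner_psi.
have V0 : V 0 by case: sV.
have three0 : 3%:R != 0 :> CC by exact: CC_nat_neq0 2.
have vYOm : cOm A B x != 0 -> V (v y + v (cOm A B x)).
  move=> Om0; have := VY; rewrite /tY mulf_neq0 ?mulf_neq0 ?invr_eq0 ?expf_neq0 //.
  move=> /(_ isT); rewrite (nuf vv) ?mulf_neq0 ?expf_neq0 // (nuX vv) // vp mulr0 subr0.
  by rewrite (nuM vv).
(* At a 2-torsion point [y] is the local parameter, and [Om] takes the nonzero value [- 3 H^6]. *)
have [f0|f0] := eqVneq (cf a b x0) 0.
  have Om0 : cOm a b x0 != 0.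
    have : cH a x0 != 0 by apply: sep.
    have pE : cpsi a b x0 = - cH a x0 ^+ 2 by rewrite /cpsi f0; ring.
    rewrite /cOm f0 pE => h0.
    rewrite (_ : _ - _ = - 3%:R * cH a x0 ^+ 6); last by ring.
    by rewrite mulf_neq0 ?oppr_eq0 ?expf_neq0.
  have [Omx vOm] : cOm A B x != 0 /\ v (cOm A B x) = 0.
    by rewrite -ev_Om; apply: (val_ev_unit vv hx); rewrite horner_Om.
  have Vy : V (v y) by have := vYOm Omx; rewrite vOm addr0.
  by split=> //; rewrite x_branch //; apply: (sgM _ sV).
have [_ vy] := y_unit f0; split; last by rewrite vy.
(* If [3 (x, y)] is a 2-torsion point, [Y] is the parameter: [Om] has a simple zero by [deriv_Om],
   for otherwise the value of [X] would be a double root of [f]. *)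
have [Om0|Om0] := eqVneq (cOm a b x0) 0.
  have [||Omx vOm] := val_ev_simple vv (p := OmP) xx0 hx.
  - by rewrite horner_Om.
  - apply/eqP => Om'; have := congr1 (fun p : {poly CC} => p.[x0]) (deriv_Om a b).
    rewrite !(horner_f, horner_Om, horner_psi, horner_H, horner_N, hE, Om', Om0).
    rewrite !mulr0 !mul0r addr0 mul0r subr0 => /esym/eqP.
    rewrite mulf_eq0 (negPf three0) /=.
    move=> /eqP h; have := tripling_curve a b x0; rewrite Om0 expr0n mulr0 => h'.
    have := @sep (cN a b x0 / cpsi a b x0 ^+ 2).
    rewrite {1}/cf (_ : _ + b = (cN a b x0 ^+ 3 + a * cN a b x0 * cpsi a b x0 ^+ 4 + b * cpsi a b x0 ^+ 6) / cpsi a b x0 ^+ 6); last by field.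
    rewrite -h' mul0r => /(_ erefl)/eqP; apply.
    rewrite /cH (_ : _ + a = (3%:R * cN a b x0 ^+ 2 + a * cpsi a b x0 ^+ 4) / cpsi a b x0 ^+ 4); last by field.
    by rewrite h mul0r.
  rewrite ev_Om in Omx vOm.
  by have := vYOm Omx; rewrite vy add0r vOm.
(* In the remaining case [X - r], with [r] the value of [X] at [x0], has a simple zero by
   [deriv_N]. *)
pose r := cN a b x0 / cpsi a b x0 ^+ 2.
pose R : {poly CC} := NP - r%:P * psiP ^+ 2.
have Rx0 : R.[x0] = 0.
  rewrite /R !(horner_N, horner_psi, hE).
  by rewrite /r; field.
have R'x0 : R^`().[x0] != 0.
  have := congr1 (fun p : {poly CC} => p.[x0]) (deriv_N a b).
  rewrite !(horner_N, horner_psi, horner_Om, hE) => e.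
  have : 3%:R * cOm a b x0 != 0 by rewrite mulf_neq0.
  rewrite -e; apply: contraNneq.
  rewrite /R derivB derivM derivC mul0r add0r deriv_exp /=.
  rewrite !(horner_psi, hE) => /eqP.
  rewrite subr_eq0 => /eqP ->; rewrite /r; apply/eqP.
  by field.
have [Rn0 vR] := val_ev_simple vv xx0 hx Rx0 R'x0.
have RE : R `@ x = (X - iota r) * cpsi A B x ^+ 2.
  rewrite /R !(ev_N, ev_psi, eE) /tX.
  by field.
have Xr : X - iota r != 0 by apply: contraNneq Rn0; rewrite RE => ->; rewrite mul0r.
have := VX r; rewrite -subr_eq0 => /(_ Xr).
by move: vR; rewrite RE (nuM vv) ?expf_neq0 // (nuX vv) // vp mulr0 addr0 => ->.
Qed.

End Finite.
End LocalOrders.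

Section Chords.
Variables (K : fieldType) (A B C D x y : K).
Hypotheses (yx : y ^+ 2 = cf A B x) (y0 : y != 0) (p0 : cpsi A B x != 0) (two0 : 2%:R != 0 :> K).
Hypothesis XC : tX A B x != C.

Lemma tlE : tl A B C D x y * (tX A B x - C) = D - tY A B x y.
Proof. by rewrite /tl mulfVK // subr_eq0. Qed.

(** The lines of slopes [tl] through [(C, - D)] and [tn] through [(x, y)] meet in [- 3 (x, y)]. The
    right-hand side is the difference of their heights over the abscissa [C], so the coordinates of
    [3 (x, y)] no longer occur in it. *)
Lemma tl_sub_tn : (tl A B C D x y - tn A B x y) * (tX A B x - C) = D + y + tn A B x y * (C - x).
Proof. by rewrite mulrBl tlE (tY_chord yx y0 p0 two0); ring. Qed.
End Chords.

(** * The place at infinity of C(x, y) *)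

Section AtInfinity.
Variables (E : fieldType) (iE : {rmorphism CC -> E}) (a b c d : CC) (x y : E).
Local Notation "p `@ x" := ((map_poly iE p).[x]) (at level 10).
Local Notation A := (iE a).
Local Notation B := (iE b).
Local Notation C := (iE c).
Local Notation D := (iE d).
Hypotheses (tx : transcendental iE x) (yx : y ^+ 2 = cf A B x).
Hypothesis gen : forall z, quad (Cx iE x) y z.
Hypotheses (d0 : d != 0) (DC : d ^+ 2 = cf a b c).

Lemma place_at_infinity : exists P, is_place iE P /\ P x = -2.
Proof.
have x0 : x != 0 by have := transcendental_nonconst 0 tx; rewrite rmorph0.
have tt : transcendental iE x^-1.
  apply: nonconst_transcendental => r; apply/eqP => e.
  by have := transcendental_nonconst r^-1 tx; rewrite fmorphV -e invrK eqxx.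
(* In terms of [1 / x] and [r = y / x^2] the curve is [r^2 = (1 / x) D1(1 / x)], with a simple root
   at 0. *)
pose D1 : {poly CC} := 1 + a%:P * 'X ^+ 2 + b%:P * 'X ^+ 3.
have D10 : D1.[0] != 0.
  by rewrite /D1 !(horner_exp, hornerD, hornerM, hornerX, hornerC) !expr0n !mulr0 !addr0 oner_eq0.
pose r := y * x^-1 ^+ 2.
have sf := Cx_subfield iE x^-1.
have rD : r ^+ 2 = (('X - 0%:P) * D1) `@ x^-1.
  rewrite evM evXC rmorph0 /D1 !(evXn, evD, evM, ev1, evC, evX) /r exprMn yx /cf.
  by field.
have gen' z : quad (Cx iE x^-1) r z.
  have sq : subfield iE (quad (Cx iE x^-1) r).
    by apply: quad_subfield => //; rewrite rD; apply: (sf_ev sf); apply: Cx_gen.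
  have Cq z' : Cx iE x^-1 z' -> quad (Cx iE x^-1) r z' by exact: (quad_base sf).
  have Qx : quad (Cx iE x^-1) r x by rewrite -{2}(invrK x); apply: (sfV sq); apply/Cq/Cx_gen.
  apply: (quad_sub sq _ _ (gen z)); last by move=> y'; apply: (Cx_sub sq).
  have -> : y = r * x ^+ 2 by rewrite /r; field.
  by apply: (sfM sq); [exact: (quad_gen sf)|exact: (sfX sq)].
have [P [pP Px]] := ramified_place tt D10 erefl rD gen'.
exists P; split=> //; move: Px; rewrite rmorph0 subr0 (nuV (place_val pP)) //.
by move/eqP; rewrite eqr_oppLR => /eqP.
Qed.

(** These are the orders at the origin of the elliptic curve. Their parities help to separate [r]
    from [C(x, y)] and [w] from [C(x, y, r)], and the exact pole of [tl - tn] shows that the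
    sections are not 0. *)
Lemma orders_at_infinity : exists P, is_place iE P /\
  [/\ cpsi A B x != 0, P (cpsi A B x) = -8, tX A B x != C &
      ts A B C D x y != C /\ P (ts A B C D x y - C) = 1] /\
  [/\ vge P 0 (tYs A B C D x y), tl A B C D x y - tn A B x y != 0 &
      P (tl A B C D x y - tn A B x y) = -1].
Proof.
have [P [pP Px]] := place_at_infinity; have vP := place_val pP.
have x0 : x != 0 by have := transcendental_nonconst 0 tx; rewrite rmorph0.
have [|k [[k0 vx vy y0] [[p0 vp X0 Y0] [vX vY vn [T0 vT]]]]] := tripling_pole vP yx x0; first by rewrite Px.
have k1 : k = 1 by move: vx; rewrite Px; clear; lia.
subst k.
have two0 : 2%:R != 0 :> E by exact: natK_neq0 iE 1.
have XC : tX A B x != C.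
  by apply/eqP => e; have := vgeC vP c; rewrite -e vgeE // vX.
have [[_ vXC l0 vl] [sC vs vYs]] := translate_near_zero vP d0 (tX_curve yx p0) DC (isT : 0 < 1 :> int)
  X0 Y0 vX vY (tlE D y XC) erefl erefl.
exists P; split=> //; split.
  by split=> //; rewrite vp.
have XC0 : tX A B x - C != 0 by rewrite subr_eq0.
have [R0 vR] : y - tn A B x y * x + (D + tn A B x y * C) != 0 /\
   P (y - tn A B x y * x + (D + tn A B x y * C)) = P (y - tn A B x y * x).
  apply: (val_addl vP) => //; rewrite vT; apply: (vgeD vP).
    by apply: (vgeW _ (vgeC vP d)).
  by rewrite [_ * C]mulrC; apply: (vgeMl vP); [exact: (vgeC vP)|apply: (vgeW _ vn)].
have lnE := tl_sub_tn D yx y0 p0 two0 XC.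
have RE : D + y + tn A B x y * (C - x) = y - tn A B x y * x + (D + tn A B x y * C) by ring.
have ln0 : tl A B C D x y - tn A B x y != 0.
  by apply: contraNneq R0 => e; rewrite -RE -lnE e mul0r.
split=> //.
- have := vgeC vP d => hd.
  by rewrite -(subrK D (tYs A B C D x y)); apply: (vgeD vP) => //; apply: vgeW vYs.
have := congr1 P lnE; rewrite (nuM vP) // RE vR vT vXC.
by clear; lia.
Qed.
End AtInfinity.

(** * The cover *)

Section Morphisms.
Variables (F G : fieldType) (j : {rmorphism F -> G}).
Let jE := (rmorph_nat j, rmorphXn j, rmorphD j, rmorphN j, rmorphM j, fmorphV j).
Lemma map_cf a b x : j (cf a b x) = cf (j a) (j b) (j x).
Proof. by rewrite /cf !jE. Qed.
Lemma map_cH a x : j (cH a x) = cH (j a) (j x).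
Proof. by rewrite /cH !jE. Qed.
Lemma map_cpsi a b x : j (cpsi a b x) = cpsi (j a) (j b) (j x).
Proof. by rewrite /cpsi /cf /cH !jE. Qed.
Lemma map_cN a b x : j (cN a b x) = cN (j a) (j b) (j x).
Proof. by rewrite /cN /cpsi /cf /cH !jE. Qed.
Lemma map_cOm a b x : j (cOm a b x) = cOm (j a) (j b) (j x).
Proof. by rewrite /cOm /cpsi /cf /cH !jE. Qed.
Lemma map_tX a b x : j (tX a b x) = tX (j a) (j b) (j x).
Proof. by rewrite /tX rmorphM fmorphV rmorphXn map_cN map_cpsi. Qed.
Lemma map_tY a b x y : j (tY a b x y) = tY (j a) (j b) (j x) (j y).
Proof. by rewrite /tY !rmorphM fmorphV rmorphXn map_cOm map_cpsi. Qed.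
Lemma map_tn a b x y : j (tn a b x y) = tn (j a) (j b) (j x) (j y).
Proof.
by rewrite /tn rmorphM fmorphV rmorphB !(rmorph_nat, rmorphXn, rmorphM) map_cf map_cH map_cpsi.
Qed.
Lemma map_tl a b c d x y : j (tl a b c d x y) = tl (j a) (j b) (j c) (j d) (j x) (j y).
Proof. by rewrite /tl rmorphM fmorphV !rmorphB map_tX map_tY. Qed.
Lemma map_ts a b c d x y : j (ts a b c d x y) = ts (j a) (j b) (j c) (j d) (j x) (j y).
Proof. by rewrite /ts !rmorphB rmorphXn map_tl map_tX. Qed.
Lemma map_tYs a b c d x y : j (tYs a b c d x y) = tYs (j a) (j b) (j c) (j d) (j x) (j y).
Proof. by rewrite /tYs rmorphB rmorphM rmorphB map_tl map_ts. Qed.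
End Morphisms.

Lemma square_ratio_size (p q g h : {poly CC}) : p != 0 -> q != 0 -> g != 0 -> h != 0 ->
  g * q ^+ 2 = p ^+ 2 * h -> ~~ odd (size g + size h).
Proof.
move=> p0 q0 g0 h0 /(congr1 (fun f : {poly CC} => size f)).
rewrite !expr2 !size_mul ?mulf_neq0 //.
move: p0 q0 g0 h0; rewrite -!size_poly_gt0.
move: (size p) (size q) (size g) (size h) => i k m l; clear; lia.
Qed.

Section Cover.
Variables (KY L : fieldType) (iY : {rmorphism CC -> KY}) (iX : {rmorphism CC -> L}).
Variable phi : {rmorphism KY -> L}.
Hypotheses (ffY : function_field iY) (ffX : function_field iX) (ov : over_CC iY iX phi).
Local Notation "p `@ x" := ((map_poly iX p).[x]) (at level 10).
Variables (a b c d e : CC).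
Hypotheses (d0 : d != 0) (DC : d ^+ 2 = cf a b c) (fe : cf a b e != 0) (ce : c != e).
Hypothesis sep : forall r, cf a b r = 0 -> cH a r != 0.
Local Notation A := (iX a).
Local Notation B := (iX b).
Local Notation C := (iX c).
Local Notation D := (iX d).
Local Notation fP := (cf a%:P b%:P 'X : {poly CC}).
Definition quintic : {poly CC} := fP * (('X - c%:P) * ('X - e%:P)).

Variables (s0 u0 : KY).
Hypotheses (st : transcendental iY s0) (uD : u0 ^+ 2 = (map_poly iY quintic).[s0]).
Hypothesis genY : forall z, quad (Cx iY s0) u0 z.

Variables (x y w r : L).
Hypotheses (tx : transcendental iX x) (yx : y ^+ 2 = cf A B x).
Local Notation s := (phi s0).
Local Notation u := (phi u0).
Local Notation X := (tX A B x).
Local Notation Y3 := (tY A B x y).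
Local Notation n := (tn A B x y).
Local Notation l := (tl A B C D x y).
Local Notation Y := (tYs A B C D x y).
Hypotheses (sE : s = ts A B C D x y) (uE : u = Y * r) (rE : r ^+ 2 = (s - C) * (s - iX e)).
Hypothesis wE : w ^+ 2 = cpsi A B x.
Hypothesis genX : forall z, quad (quad (quad (Cx iX x) y) r) w z.

Let two0 : 2%:R != 0 :> L. Proof. exact: natK_neq0 iX 1. Qed.

Lemma iphi c' : phi (iY c') = iX c'. Proof. exact: ov. Qed.

Lemma ev_phi p z : p `@ (phi z) = phi (map_poly iY p).[z].
Proof.
rewrite -horner_map -map_poly_comp; congr (_.[_]).
by apply: eq_map_poly => c'; rewrite /= ov.
Qed.

Lemma y_neq0 : y != 0.
Proof.
have := transcendental_ev_neq0 tx (p := fP); rewrite ev_f -yx => h.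
have [f0|f0] := eqVneq fP 0.
  by have := lead_at_size (oner_neq0 _) (lead_f a b); rewrite f0 size_poly0.
by apply: contraNneq (h f0) => ->; rewrite expr0n.
Qed.

Lemma psi_neq0 : cpsi A B x != 0.
Proof.
rewrite -ev_psi; apply: transcendental_ev_neq0 => //.
have three0 : 3%:R != 0 :> CC by exact: CC_nat_neq0 2.
by rewrite -size_poly_eq0 (lead_at_size three0 (lead_psi a b)).
Qed.

Lemma w_neq0 : w != 0.
Proof. by apply: contraNneq psi_neq0 => w0; rewrite -wE w0 expr0n. Qed.

Lemma s_nonconst c' : s != iX c'.
Proof. by rewrite -iphi (inj_eq (fmorph_inj phi)) transcendental_nonconst. Qed.

Let sc0 c' : s - iX c' != 0. Proof. by rewrite subr_eq0 s_nonconst. Qed.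
Let xc0 c' : x - iX c' != 0. Proof. by rewrite subr_eq0 transcendental_nonconst. Qed.

Lemma r_neq0 : r != 0.
Proof. by have := mulf_neq0 (sc0 c) (sc0 e); rewrite -rE; apply: contraNneq => ->; rewrite expr0n. Qed.

Lemma u2E : u ^+ 2 = cf A B s * ((s - C) * (s - iX e)).
Proof. by rewrite -rmorphXn uD -ev_phi /quintic !evM !evXC ev_f. Qed.

Lemma fs_neq0 : cf A B s != 0.
Proof.
rewrite -ev_f ev_phi fmorph_eq0 (transcendental_ev_neq0 st) //.
by rewrite -size_poly_eq0 (lead_at_size (oner_neq0 _) (lead_f a b)).
Qed.

Lemma u_neq0 : u != 0.
Proof.
by have := mulf_neq0 fs_neq0 (mulf_neq0 (sc0 c) (sc0 e)); rewrite -u2E; apply: contraNneq => ->; rewrite expr0n.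
Qed.

Lemma Y_curve : Y ^+ 2 = cf A B s.
Proof.
apply: (mulIf (expf_neq0 2 r_neq0)); rewrite -exprMn -uE u2E rE //.
Qed.

Lemma Y_neq0 : Y != 0.
Proof. by apply: contraNneq fs_neq0 => Y0; rewrite -Y_curve Y0 expr0n. Qed.

Lemma lsE : l * (s - C) = Y + D.
Proof. by rewrite sE /tYs subrK. Qed.

Lemma DC' : D ^+ 2 = cf A B C.
Proof. by rewrite -rmorphXn DC /cf !(rmorphD, rmorphM, rmorphXn). Qed.

(* If tX = C then l = 0 by the convention z / 0 = 0, so s would be constant. *)
Lemma X_neqC : X != C.
Proof.
apply/eqP => XC; have := s_nonconst (- (2%:R * c)); rewrite sE /ts /tl XC subrr invr0 mulr0.
by rewrite expr0n sub0r -opprD rmorphN rmorphM rmorph_nat mulr2n mulrDl !mul1r eqxx.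
Qed.

Lemma X3_E : X = l ^+ 2 - s - C.
Proof. by rewrite sE /ts; ring. Qed.
Lemma Y3_E : Y3 = D - l * (X - C).
Proof. by rewrite (tlE D y X_neqC); ring. Qed.

Local Notation E1 := (quad (Cx iX x) y).
Local Notation E2 := (quad E1 r).

Lemma E1_subfield : subfield iX E1.
Proof.
apply: quad_subfield; first exact: Cx_subfield.
by rewrite yx -ev_f; apply: (sf_ev (Cx_subfield iX x)); apply: Cx_gen.
Qed.
Lemma E1_x : E1 x.
Proof. by apply: (quad_base (Cx_subfield iX x)); apply: Cx_gen. Qed.
Lemma E1_y : E1 y.
Proof. exact: (quad_gen (Cx_subfield iX x)). Qed.
Lemma E1_poly p : E1 (p `@ x).
Proof. exact: (sf_ev E1_subfield p E1_x). Qed.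
Lemma E1_C c' : E1 (iX c'). Proof. exact: (sfC E1_subfield). Qed.
Lemma E1_f : E1 (cf A B x). Proof. by rewrite -ev_f; apply: E1_poly. Qed.
Lemma E1_H : E1 (cH A x). Proof. by rewrite -(ev_H iX); apply: E1_poly. Qed.
Lemma E1_psi : E1 (cpsi A B x). Proof. by rewrite -ev_psi; apply: E1_poly. Qed.
Lemma E1_X : E1 X.
Proof.
apply: (sf_div E1_subfield); first by rewrite -ev_N; apply: E1_poly.
exact: (sfX E1_subfield _ E1_psi).
Qed.
Lemma E1_Y3 : E1 Y3.
Proof.
apply: (sf_div E1_subfield); last exact: (sfX E1_subfield _ E1_psi).
by apply: (sfM E1_subfield E1_y); rewrite -ev_Om; apply: E1_poly.
Qed.
Lemma E1_n : E1 n.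
Proof.
apply: (sf_div E1_subfield); last first.
  apply: (sfM E1_subfield _ E1_psi); apply: (sfM E1_subfield _ E1_y).
  exact: (sf_nat E1_subfield).
apply: (sfB E1_subfield); last exact: (sfM E1_subfield E1_H E1_psi).
by apply: (sfM E1_subfield); [exact: (sf_nat E1_subfield)|exact: (sfX E1_subfield _ E1_f)].
Qed.
Lemma E1_l : E1 l.
Proof.
apply: (sf_div E1_subfield); apply: (sfB E1_subfield); try exact: E1_C.
  exact: E1_Y3.
exact: E1_X.
Qed.
Lemma E1_s : E1 s.
Proof.
rewrite sE; apply: (sfB E1_subfield); last exact: E1_C.
by apply: (sfB E1_subfield); [exact: (sfX E1_subfield _ E1_l)|exact: E1_X].
Qed.
Lemma E1_s_sub c' : E1 (s - iX c').
Proof. by apply: (sfB E1_subfield); [exact: E1_s|exact: E1_C]. Qed.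
Lemma E1_Y : E1 Y.
Proof.
rewrite /tYs -sE; apply: (sfB E1_subfield); last exact: E1_C.
by apply: (sfM E1_subfield); [exact: E1_l|exact: E1_s_sub].
Qed.
Lemma E1_r2 : E1 (r ^+ 2).
Proof. by rewrite rE; apply: (sfM E1_subfield); apply: E1_s_sub. Qed.
Lemma E2_subfield : subfield iX E2.
Proof. exact: (quad_subfield E1_subfield E1_r2). Qed.
Lemma E2_w2 : E2 (w ^+ 2).
Proof. by rewrite wE; apply: (quad_base E1_subfield); exact: E1_psi. Qed.

Lemma quinticE p : quintic.[p] = cf a b p * ((p - c) * (p - e)).
Proof. by rewrite /quintic !hornerM !hornerXsubC horner_f. Qed.
Lemma quintic_c : quintic.[c] = 0. Proof. by rewrite quinticE subrr mul0r mulr0. Qed.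
Lemma quintic_e : quintic.[e] = 0. Proof. by rewrite quinticE subrr !mulr0. Qed.
Lemma fc_neq0 : cf a b c != 0.
Proof. by rewrite -DC expf_neq0. Qed.

Lemma quintic_simple p : quintic.[p] = 0 -> quintic^`().[p] != 0.
Proof.
have ce0 : c - e != 0 by rewrite subr_eq0.
have ec0 : e - c != 0 by rewrite subr_eq0 eq_sym.
have DE : quintic^`().[p] = cH a p * ((p - c) * (p - e)) + cf a b p * ((p - e) + (p - c)).
  rewrite /quintic derivM deriv_f derivM !derivXsubC mul1r mulr1.
  by rewrite !(horner_H, horner_f, hornerD, hornerM, hornerN, hornerX, hornerC).
rewrite quinticE DE => /eqP; rewrite !mulf_eq0 !subr_eq0 => /orP[/eqP f0|/orP[]/eqP pE].
- rewrite f0 mul0r addr0 !mulf_neq0 ?sep // subr_eq0.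
    by apply: contraTneq fc_neq0 => <-; rewrite f0 eqxx.
  by apply: contraTneq fe => <-; rewrite f0 eqxx.
- by rewrite pE subrr mul0r mulr0 add0r addr0 mulf_neq0 ?fc_neq0.
by rewrite pE subrr !mulr0 add0r add0r mulf_neq0.
Qed.

Lemma size_quintic : size quintic = 6.
Proof.
have := lead_atM (lead_f a b) (lead_atM (lead_atD lead_at_var (lead_at_low (isT : 0 < 1)%N (lead_atN (lead_atC c))))
   (lead_atD lead_at_var (lead_at_low (isT : 0 < 1)%N (lead_atN (lead_atC e))))).
by rewrite !addr0 !mulr1 => /(lead_at_size (oner_neq0 _)).
Qed.

(** * One place of the cover: unramifiedness, and the poles of the sections *)

Section OnePlace.
Variable P : L -> int.
Hypothesis pP : is_place iX P.
Let vP : is_val iX P. Proof. exact: place_val pP. Qed.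

(** The three cases are those of the image of [P] on [y^2 = f(x)]: the origin, a nonzero 3-torsion
    point, any other point. [k] and [g] are the orders at [P] of a local parameter of that curve; in
    the first two cases [P] lies over [(c, d)]. *)
Definition at_zero (k : int) : Prop :=
  [/\ 0 < k, P x = - 2 * k, P y = - 3 * k, P w = - 4 * k & x != 0] /\
  [/\ X != 0, Y3 != 0, P X = - 2 * k, P Y3 = - 3 * k & vge P (- k) n] /\
  [/\ vge P (- k) l, P (s - C) = k & vge P k (Y - D)].

Definition at_torsion (x0 : CC) (g : int) : Prop :=
  [/\ 0 < g, vge P 1 (x - iX x0), P (x - iX x0) = g, P y = 0 & 2 * P w = g] /\
  [/\ X != 0, Y3 != 0, P X = - 2 * g & P Y3 = - 3 * g] /\
  [/\ vge P g (l - n), P (s - C) = g & vge P g (Y - D)].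

Definition at_general (x0 : CC) : Prop :=
  [/\ vge P 1 (x - iX x0), cpsi a b x0 != 0, P w = 0 & vge P 0 y] /\
  [/\ vge P 0 X, vge P 0 Y3 & vge P 0 (y * n)].

Lemma place_cases : (exists k, at_zero k) \/ (exists x0 g, at_torsion x0 g) \/
  (exists x0, at_general x0).
Proof.
have x0 : x != 0 by have := xc0 0; rewrite rmorph0 subr0.
have y0 := y_neq0; have w0 := w_neq0; have p0 := psi_neq0.
have lXC := tlE D y X_neqC.
have Ysdef : Y = l * (s - C) - D by rewrite lsE addrK.
have sdef : s = l ^+ 2 - X - C by rewrite sE.
have P2w : 2 * P w = P (cpsi A B x) by rewrite -wE (nuX vP).
have [vx|vx] := ltP (P x) 0.
  left; have [k [[k0 vxk vyk _] [[_ vp X0 Y0] [vX vY vn _]]]] := tripling_pole vP yx x0 vx.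
  have [[XC vXC l0 vl] [sC vs vYs]] :=
    translate_near_zero vP d0 (tX_curve yx p0) DC k0 X0 Y0 vX vY lXC sdef Ysdef.
  have vw : P w = - 4 * k by move: P2w; rewrite vp; clear; lia.
  exists k; split; first by [].
  by split; [|split; [rewrite vgeE // vl|exact: vs|exact: vYs]].
right; have [x1 hx] : exists x1, vge P 1 (x - iX x1).
  by apply: (residue_exists ffX pP); rewrite vgeE.
have xx1 : x != iX x1 by rewrite -subr_eq0 xc0.
have [q0|q0] := eqVneq (cpsi a b x1) 0; [left|right; exists x1].
  have [[g0 _ vy _ vp] [X0 Y0 vX vY vn]] := tripling_torsion vP yx xx1 hx sep q0.
  set g := P (x - iX x1) in g0 vp vX vY vn.
  have [[XC vXC l0 vl] [sC vs vYs]] :=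
    translate_near_zero vP d0 (tX_curve yx p0) DC g0 X0 Y0 vX vY lXC sdef Ysdef.
  exists x1, g; split; first by split=> //; rewrite P2w.
  split; first by [].
  split; [|exact: vs|exact: vYs].
  have XC0 : X - C != 0 by rewrite subr_eq0.
  (* Both [l] and [n] have a pole here, but by [tl_sub_tn] their difference times [X - C] has order
     at least [- g], and [X - C] has order [- 2 g]. *)
  apply: (vge_mulK vP XC0); rewrite vXC (tl_sub_tn D yx y0 p0 two0 XC).
  have hg : g - 2 * g <= 0 by move: g0; clear; lia.
  have ge1 : g + - 2 * g = - g + 0 by clear; lia.
  have -> : g + - 2 * g = - g by rewrite ge1 addr0.
  apply: (vgeD vP).
    apply: (vgeD vP); first by apply: (vgeW _ (vgeC vP d)); rewrite oppr_le0 ltW.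
    by rewrite vgeE // vy oppr_le0 ltW.
  rewrite [n * _]mulrC; apply: (vgeMl vP) => //; apply: (vgeB vP); first exact: (vgeC vP).
  exact: (res_reg vP hx).
have [_ vp vX vY vyn] := tripling_regular vP yx hx q0 y0.
split; [split=> //|by []].
  by move: P2w; rewrite vp; clear; lia.
exact: (y_regular vP yx hx).
Qed.

Let imphi (z : L) : Prop := exists a', z = phi a'.
Let imphi_subfield : subfield iX imphi.
Proof.
split=> [c'|_ _ [a1 ->] [a2 ->]|_ _ [a1 ->] [a2 ->]|_ [a1 ->]].
- by exists (iY c'); rewrite iphi.
- by exists (a1 - a2); rewrite rmorphB.
- by exists (a1 * a2); rewrite rmorphM.
by exists a1^-1; rewrite fmorphV.
Qed.

Definition value_group (m : int) : Prop := exists2 a', a' != 0 & P (phi a') = m.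
Local Notation V := value_group.

Lemma value_group_subgroup : int_subgroup V.
Proof.
split; first by exists 1; rewrite ?oner_eq0 // rmorph1 (nu1 vP).
move=> _ _ [a1 a10 <-] [a2 a20 <-]; exists (a1 / a2); first by rewrite mulf_neq0 ?invr_eq0.
by rewrite rmorphM fmorphV (nuf vP) ?fmorph_eq0.
Qed.

Lemma value_group_phi a' : a' != 0 -> V (P (phi a')).
Proof. by exists a'. Qed.

Lemma shift_unit p q : p != q -> vge P 1 (s - iX p) -> s - iX q != 0 /\ P (s - iX q) = 0.
Proof.
move=> pq hs; apply: (@val_unit_const _ _ _ vP (p - q)); first by rewrite subr_eq0.
by rewrite rmorphB; have -> : s - iX q - (iX p - iX q) = s - iX p by ring.
Qed.

Lemma shift_pole q : P s < 0 -> P (s - iX q) = P s.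
Proof.
move=> Ps; have s_0 : s != 0 by have := sc0 0; rewrite rmorph0 subr0.
have [] // := val_addl vP (y := - iX q) s_0.
by rewrite (vgeN vP); apply: (vgeW _ (vgeC vP q)); move: Ps; clear; lia.
Qed.

Lemma P2r : 2 * P r = P (s - C) + P (s - iX e).
Proof. by rewrite -(nuM vP) // -rE (nuX vP) ?r_neq0. Qed.

Lemma P2u : 2 * P u = P (cf A B s) + (P (s - C) + P (s - iX e)).
Proof. by rewrite -!(nuM vP) ?mulf_neq0 ?fs_neq0 // -u2E (nuX vP) ?u_neq0. Qed.

Lemma fs_unit p : cf a b p != 0 -> vge P 1 (s - iX p) -> P (cf A B s) = 0.
Proof. by move=> fp hs; rewrite -ev_f; have [] := val_ev_unit vP hs (p := fP) _; rewrite ?horner_f. Qed.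

Lemma r_order_branch p : (p == c) || (p == e) -> vge P 1 (s - iX p) -> P r = P u.
Proof.
move=> pce hs; have fp : cf a b p != 0.
  by case/orP: pce => /eqP ->; [exact: fc_neq0|].
have := P2u; rewrite (fs_unit fp hs) add0r -P2r; clear; lia.
Qed.

(** Adjoining [r] does not ramify: over [c] and [e] the quotient [u / r] is a unit, at infinity [r]
    has the order of [s], and elsewhere [r] is a unit. *)
Lemma value_group_r : V (P r).
Proof.
have V0 : V 0 by case: value_group_subgroup.
have [Ps|Ps] := ltP (P s) 0.
  have -> : P r = P s by have := P2r; rewrite !shift_pole //; clear; lia.
  by apply: value_group_phi; have := s_nonconst 0; rewrite rmorph0 fmorph_eq0.
have [|p hs] := residue_exists (z := s) ffX pP; first by rewrite /vge Ps orbT.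
have [pce|] := boolP ((p == c) || (p == e)).
  by rewrite (r_order_branch pce hs); apply: value_group_phi; have := u_neq0; rewrite fmorph_eq0.
rewrite negb_or => /andP[pc pe].
have [_ e1] := shift_unit pc hs; have [_ e2] := shift_unit pe hs.
have -> // : P r = 0 by have := P2r; rewrite e1 e2; clear; lia.
Qed.

Let S1 := quad imphi r.
Let S1_subfield : subfield iX S1.
Proof.
apply: quad_subfield; first exact: imphi_subfield.
by rewrite rE; exists ((s0 - iY c) * (s0 - iY e)); rewrite rmorphM !rmorphB !iphi.
Qed.
Let S1_orders z : S1 z -> z != 0 -> V (P z).
Proof.
apply: (quad_orders imphi_subfield value_group_subgroup vP).
- by rewrite rE; exists ((s0 - iY c) * (s0 - iY e)); rewrite rmorphM !rmorphB !iphi.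
- by move=> _ [a1 ->]; rewrite fmorph_eq0; apply: value_group_phi.
by move=> _; apply: value_group_r.
Qed.
Let S1phi z : S1 (phi z).
Proof. by apply: (quad_base imphi_subfield); exists z. Qed.
Let S1r : S1 r. Proof. exact: (quad_gen imphi_subfield). Qed.
Let S1Y : S1 Y.
Proof.
have -> : Y = u / r by rewrite uE mulfK ?r_neq0.
by apply: (sf_div S1_subfield).
Qed.
Let S1l : S1 l.
Proof.
have -> : l = (Y + D) / (s - C) by rewrite -lsE mulfK.
apply: (sf_div S1_subfield); first by apply: (sfD S1_subfield) => //; apply: (sfC S1_subfield).
by apply: (sfB S1_subfield) => //; apply: (sfC S1_subfield).
Qed.
Let S1X : S1 X.
Proof.
rewrite X3_E; apply: (sfB S1_subfield); last exact: (sfC S1_subfield).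
by apply: (sfB S1_subfield) => //; apply: (sfX S1_subfield).
Qed.
Let S1Y3 : S1 Y3.
Proof.
rewrite Y3_E; apply: (sfB S1_subfield); first exact: (sfC S1_subfield).
apply: (sfM S1_subfield) => //; apply: (sfB S1_subfield) => //; exact: (sfC S1_subfield).
Qed.

Lemma torsion_r_order x0 g : at_torsion x0 g -> P r = P w.
Proof.
move=> [[g0 _ _ _ Pw] [_ [_ vs _]]].
have hs : vge P 1 (s - C) by rewrite vgeE // vs; move: g0; clear; lia.
have [_ e2] := shift_unit ce hs.
by have := P2r; rewrite vs e2; move: Pw; clear; lia.
Qed.

(* The orders of elements of KY already fill Z: each of x, y, r, w has its order in the
   value group of phi(KY) enlarged by the previous ones, so P is unramified over KY. *)
Lemma value_group_full m : V m.
Proof.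
have sV := value_group_subgroup; have V0 : V 0 by case: (sV).
have [z z0 <-] := place_uniformizer m pP.
have [Vx [Vy Vw]] : (forall p : {poly CC}, p `@ x != 0 -> V (P (p `@ x))) /\ V (P y) /\ V (P w).
  case: place_cases => [[k [[k0 vx vy vw x0] [[X0 Y0 vX vY _] _]]]|].
    have Vk : V k.
      (* The quotient of the coordinates of [3 (x, y)] is a local parameter at the origin, and it
         lies in [KY(r)]. *)
      have -> : k = P (X / Y3) by rewrite (nuf vP) // vX vY; clear; lia.
      by apply: S1_orders; [apply: (sf_div S1_subfield)|rewrite mulf_neq0 ?invr_eq0].
    have VM (i : nat) : V (- i%:Z * k) by rewrite mulNr; apply: (sgN sV); apply: (sgM _ sV).
    rewrite vy vw; split; last by split; [exact: (VM 3%N)|exact: (VM 4%N)].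
    move=> p; apply: (ev_orders_pole sV vP x0); first by rewrite vx; move: k0; clear; lia.
    by rewrite vx; apply: (VM 2%N).
  case=> [[x1 [g h]]|[x1 [[hx q0 vw _] _]]].
    have [[g0 hx vx vy Pw] [[X0 Y0 vX vY] _]] := h.
    have Vg : V g.
      have -> : g = P (X / Y3) by rewrite (nuf vP) // vX vY; clear; lia.
      by apply: S1_orders; [apply: (sf_div S1_subfield)|rewrite mulf_neq0 ?invr_eq0].
    rewrite vy -(torsion_r_order h); split; last by split=> //; apply: value_group_r.
    move=> p; apply: (ev_orders_finite sV vP _ hx); first by rewrite -subr_eq0 xc0.
    by rewrite vx.
  have xx1 : x != iX x1 by rewrite -subr_eq0 xc0.
  have [||Vx Vy] := tripling_unramified vP yx xx1 hx sep sV q0 y_neq0.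
  - move=> c' Xc'; apply: S1_orders; last by rewrite subr_eq0.
    by apply: (sfB S1_subfield) => //; apply: (sfC S1_subfield).
  - by move=> Y0; apply: S1_orders.
  rewrite vw; split; last by split.
  by move=> p; apply: (ev_orders_finite sV vP xx1 hx Vx).
have sC := Cx_subfield iX x.
have V1 z1 : E1 z1 -> z1 != 0 -> V (P z1).
  apply: (quad_orders sC sV vP) => //.
    by rewrite yx -ev_f; apply: (sf_ev sC); apply: Cx_gen.
  by move=> z2; apply: (Cx_orders sV vP Vx).
have V2 z2 : E2 z2 -> z2 != 0 -> V (P z2).
  by apply: (quad_orders E1_subfield sV vP E1_r2 V1) => _; apply: value_group_r.
by apply: (quad_orders E2_subfield sV vP E2_w2 V2 _ (genX z) z0).
Qed.

Definition below (z : KY) : int := P (phi z).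

Lemma below_place : is_place iY below.
Proof.
rewrite /below; split=> [z1 z2 z10 z20|z1 z2 z10 z20 z120|c' c'0|m].
- by rewrite rmorphM (nuM vP) ?fmorph_eq0.
- by have [_ + _] := vP; rewrite rmorphD; apply; rewrite -?rmorphD fmorph_eq0.
- by rewrite iphi (nuC vP).
by have [a1 a10 <-] := value_group_full m; exists a1.
Qed.

Lemma vge_below k z : vge below k z = vge P k (phi z).
Proof. by rewrite /vge fmorph_eq0. Qed.

Lemma below_centre z c' : vge below 1 (z - iY c') = vge P 1 (phi z - iX c').
Proof. by rewrite vge_below rmorphB iphi. Qed.

Lemma branch_order p : quintic.[p] = 0 -> vge P 1 (s - iX p) -> P u = 1.
Proof.
move=> Dp hs; have [h _] := branch_centre st uD genY Dp (quintic_simple Dp).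
by apply: (h below below_place); rewrite below_centre.
Qed.

Lemma unramified_order p up : up != 0 -> vge P 1 (s - iX p) -> vge P 1 (u - iX up) ->
  P (s - iX p) = 1.
Proof.
move=> up0 hs hu; have [h _] := unramified_centre st uD genY p up0.
rewrite -iphi -rmorphB; apply: (h below).
by split; rewrite ?below_centre //; exact: below_place.
Qed.

Lemma infinity_order : P s < 0 -> P s = -2.
Proof.
move=> Ps; have [h _] := infinity_centre st uD genY (m := 2) size_quintic.
exact: (h below below_place Ps).
Qed.

Lemma Y_regular : vge P 0 s -> vge P 0 Y.
Proof.
move=> hs; rewrite -(vge_sqr vP) Y_curve mulr0 -ev_f; exact: (vge_ev vP).
Qed.
Lemma r_regular : vge P 0 s -> vge P 0 r.
Proof.
move=> hs; rewrite -(vge_sqr vP) rE mulr0; apply: (vgeM0 vP); apply: (vgeB vP) => //; exact: (vgeC vP).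
Qed.
Lemma l_regular : vge P 0 s -> vge P 0 X -> vge P 0 l.
Proof.
move=> hs hX; rewrite -(vge_sqr vP) mulr0.
have -> : l ^+ 2 = s + X + C by rewrite sE /ts; ring.
by rewrite !(vgeD vP) // (vgeC vP).
Qed.

Lemma orders_over_infinity : P s < 0 -> vge P (-3) Y /\ vge P (-1) l.
Proof.
move=> Ps; have s_0 : s != 0 by have := sc0 0; rewrite rmorph0 subr0.
have [Y0 [k [k0 vs vY]]] := cubic_pole vP Y_curve s_0 Ps.
have k1 : k = 1 by move: vs; rewrite infinity_order //; clear; lia.
have vY3 : vge P (-3) Y by rewrite vgeE // vY k1.
split=> //; apply: (vge_mulK vP (sc0 c)).
rewrite lsE shift_pole // infinity_order //; apply: (vgeD vP) => //.
by apply: (vgeW _ (vgeC vP d)).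
Qed.

Lemma res_of z : vge P 0 z -> exists c', vge P 1 (z - iX c').
Proof. exact: residue_exists. Qed.

Lemma yw_general x0 z : at_general x0 -> vge P 0 z -> vge P 0 (y / w * z).
Proof.
move=> [[_ _ vw hy] _] hz; apply: (vgeM0 vP) => //.
by apply: (vge_div vP w_neq0); rewrite vw.
Qed.

Lemma yn_general x0 : at_general x0 -> vge P 0 (y / w * n).
Proof.
move=> [[_ _ vw _] [_ _ hyn]]; rewrite mulrAC; apply: (vge_div vP w_neq0).
by rewrite vw.
Qed.

Lemma yw_zero k z : at_zero k -> vge P (- k) z -> vge P 0 (y / w * z).
Proof.
move=> [[k0 _ vy vw _] _] hz; rewrite -(subrr k); apply: (vgeM vP) => //.
apply: (vge_div vP w_neq0); rewrite vw vgeE ?y_neq0 // vy; move: k0; clear; lia.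
Qed.

(** Here [y] is a unit and [w] vanishes, so a factor [G] has to vanish to the order of [w]; at the
    origin, by [yw_zero], it may instead have a pole of order [k]. *)
Lemma yw_torsion x0 g k z : at_torsion x0 g -> vge P (P w + k) z -> vge P k (y / w * z).
Proof.
move=> [[_ _ _ vy _] _] hz; rewrite (_ : k = - P w + (P w + k)); last by rewrite addKr.
by apply: (vgeM vP) => //; apply: (vge_div vP w_neq0); rewrite addNr vgeE ?y_neq0 ?vy.
Qed.

(** The poles of [y / w] lie over the nonzero 3-torsion points, hence over [c]. They are simple
    because there [w] has the order of [r], hence that of [u], which is 1. *)
Lemma regular_at_c : vge P 0 (y / w) \/ (vge P 1 (s - C) /\ vge P (-1) (y / w)).
Proof.
have [[k h]|[[x0 [g h]]|[x0 h]]] := place_cases.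
- left; rewrite -[y / w]mulr1; apply: (yw_zero h).
  by have [[k0 _ _ _ _] _] := h; apply: (vgeW _ (vge1 vP)); rewrite oppr_le0 ltW.
- right; have [[g0 _ _ _ vw] [_ [_ vs _]]] := h.
  have hs : vge P 1 (s - C) by rewrite vgeE // vs; move: g0; clear; lia.
  split=> //; rewrite -[y / w]mulr1; apply: (yw_torsion h).
  rewrite -(torsion_r_order h) (r_order_branch (p := c) _ hs) ?eqxx //.
  by rewrite (branch_order _ hs) ?quintic_c // addrN (vge1 vP).
by left; rewrite -[y / w]mulr1; apply: (yw_general h); exact: (vge1 vP).
Qed.

(** [r] cancels the pole of [y / w] at the torsion points, and over [e] it has order 1 while [s - e]
    has order 2. *)
Lemma regular_at_e : vge P 0 (y / w * (r / (s - iX e))) \/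
  (vge P 1 (s - iX e) /\ vge P (-1) (y / w * (r / (s - iX e)))).
Proof.
have [[k h]|[[x0 [g h]]|[x0 h]]] := place_cases.
- left; apply: (yw_zero h); have [[k0 _ _ _ _] [_ [_ vs _]]] := h.
  have hs : vge P 1 (s - C) by rewrite vgeE // vs; move: k0; clear; lia.
  have [se0 ve] := shift_unit ce hs.
  apply: (vge_div vP se0); rewrite ve addr0; apply: (vgeW _ (r_regular (res_reg vP hs))).
  by rewrite oppr_le0 ltW.
- left; apply: (yw_torsion h); have [[g0 _ _ _ vw] [_ [_ vs _]]] := h.
  have hs : vge P 1 (s - C) by rewrite vgeE // vs; move: g0; clear; lia.
  have [se0 ve] := shift_unit ce hs.
  apply: (vge_div vP se0); rewrite ve !addr0 -(torsion_r_order h).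
  exact: vge_refl.
have [Ps|Ps] := ltP (P s) 0.
  left; apply: (yw_general h); apply: (vge_div vP (sc0 e)); rewrite add0r vgeE ?r_neq0 //.
  by have := P2r; rewrite !shift_pole //; clear; lia.
have hs0 : vge P 0 s by rewrite /vge Ps orbT.
have [p hs] := res_of hs0.
have [pe|pe] := eqVneq p e; last first.
  left; apply: (yw_general h); have [se0 ve] := shift_unit pe hs.
  by apply: (vge_div vP se0); rewrite ve addr0; apply: r_regular.
rewrite pe in hs; right; split=> //.
rewrite mulrA; apply: (vge_div vP (sc0 e)).
have ec : e != c by rewrite eq_sym.
have [_ vc] := shift_unit ec hs.
have vr : P r = P u by rewrite (r_order_branch (p := e) _ hs) ?eqxx ?orbT.
have r1 : P r = 1 by rewrite vr (branch_order _ hs) ?quintic_e.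
have -> : -1 + P (s - iX e) = 0 + P r.
  by have := P2r; rewrite vc r1; clear; lia.
by apply: (vgeM vP); [rewrite -[y / w]mulr1; apply: (yw_general h); exact: (vge1 vP)|exact: vge_refl].
Qed.

(** [l - n] vanishes at the torsion points and [y] absorbs the poles of [n] at the 2-torsion points.
    What remains is the simple pole of [l] at the poles of [s]. *)
Lemma regular_at_infinity : vge P 0 (y / w * (l - n)) \/
  (P s < 0 /\ vge P (-1) (y / w * (l - n))).
Proof.
have [[k h]|[[x0 [g h]]|[x0 h]]] := place_cases.
- left; apply: (yw_zero h); have [_ [[_ _ _ _ hn] [hl _ _]]] := h.
  exact: (vgeB vP).
- left; apply: (yw_torsion h); have [[g0 _ _ _ vw] [_ [hln _ _]]] := h.
  by apply: (vgeW _ hln); move: g0 vw; clear; lia.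
have hn := yn_general h; rewrite mulrBr.
have [Ps|Ps] := ltP (P s) 0; last first.
  left; apply: (vgeB vP) => //; apply: (yw_general h).
  by have [_ [hX _ _]] := h; apply: l_regular => //; rewrite /vge Ps orbT.
right; split=> //; apply: (vgeB vP); last by apply: vgeW hn.
have [_ hl] := orders_over_infinity Ps.
rewrite mulrC -[-1]addr0; apply: (vgeM vP) => //.
by rewrite -[y / w]mulr1; apply: (yw_general h); exact: (vge1 vP).
Qed.

Section Generic.
Variables (p up : CC).
Hypotheses (pc : p != c) (pe : p != e) (upE : up ^+ 2 = quintic.[p]).
Let k := up / ((p - c) * (p - e)).
(** Each term repairs one defect. [k] makes the numerator vanish at the conjugate point [u = - up]
    over [p]. Subtracting [l] cancels the pole of [Y / (s - p)] at infinity, and [n] goes with [l]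
    to remove its pole at the torsion points. There [s = c], [Y = d] and [r = 0], and the constant
    makes the value 0. *)
Definition generic_factor : L :=
  (Y + iX k * r) / (s - iX p) + iX (d / (p - c)) - (l - n).

Let pc0 : p - c != 0. Proof. by rewrite subr_eq0. Qed.
Let pe0 : p - e != 0. Proof. by rewrite subr_eq0. Qed.

Lemma upE' : up ^+ 2 = cf a b p * ((p - c) * (p - e)).
Proof. by rewrite upE quinticE. Qed.

(* Y + k r vanishes to the order of s - p at the points where u = - up. *)
Lemma conjugate_cancel : up != 0 -> vge P 1 (s - iX p) -> vge P 1 (u + iX up) ->
  vge P 0 ((Y + iX k * r) / (s - iX p)).
Proof.
move=> up0 hs hu.
have fp0 : cf a b p != 0.
  by apply: contraNneq up0 => fp; rewrite -sqrf_eq0 upE' fp mul0r.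
have [Y1 hY] := res_of (Y_regular (res_reg vP hs)).
have [r1 hr] := res_of (r_regular (res_reg vP hs)).
have uY : Y1 * r1 = - up.
  apply: (res_uniq vP (resM vP hY hr)); rewrite -uE rmorphN opprK //.
have Y12 : Y1 ^+ 2 = cf a b p.
  have h1 := resM vP hY hY; rewrite -!expr2 Y_curve in h1.
  by apply: (res_uniq vP h1); rewrite -ev_f -horner_f; apply: (res_ev vP).
have Y10 : Y1 != 0 by rewrite -sqrf_eq0 Y12.
have kE : k * r1 = - Y1.
  have r12 : r1 ^+ 2 = (p - c) * (p - e).
    apply: (mulfI (expf_neq0 2 Y10)); rewrite -exprMn uY sqrrN upE' Y12 //.
  have r10 : r1 != 0 by rewrite -sqrf_eq0 r12 mulf_neq0.
  rewrite /k -r12; apply: (mulIf r10); rewrite mulNr uY opprK.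
  by field.
have hm : vge P 1 (Y - iX k * r - iX (Y1 *+ 2)).
  have hk : vge P 1 (iX k * r - iX (k * r1)).
    by rewrite rmorphM -mulrBr; apply: (vgeMl vP) => //; exact: (vgeC vP).
  have -> : Y - iX k * r - iX (Y1 *+ 2) = (Y - iX Y1) - (iX k * r - iX (k * r1)).
    by rewrite kE mulr2n rmorphD rmorphN; ring.
  exact: (vgeB vP).
have Y20 : Y1 *+ 2 != 0 by rewrite -mulr_natl mulf_neq0 // (CC_nat_neq0 1).
have [m0 vm] := val_unit_const vP Y20 hm.
apply: (vge_div vP (sc0 p)); apply: (vge_mulK vP m0); rewrite vm addr0 add0r.
(* [Y + k r] is multiplied by the unit [Y - k r]: the product is a polynomial in [s] that vanishes
   at [p]. *)
pose q : {poly CC} := fP - (k ^+ 2)%:P * (('X - c%:P) * ('X - e%:P)).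
have qs : (Y + iX k * r) * (Y - iX k * r) = q `@ s.
  rewrite /q !(evB, evM, evC, evX, ev_f) -Y_curve -rE rmorphXn; ring.
have qp : root q p.
  rewrite /root /q !(hornerD, hornerN, hornerM, hornerX, hornerC, horner_f).
  have -> : k ^+ 2 * ((p - c) * (p - e)) = cf a b p.
    by rewrite /k expr_div_n upE'; field; rewrite pc0 pe0.
  by rewrite subrr.
have /factor_theorem[q' qE] := qp.
rewrite qs qE evM evXC; apply: (vgeMl vP); last exact: vge_refl.
exact: (vge_ev vP _ (res_reg vP hs)).
Qed.

Lemma regular_generic : vge P 0 (y / w * generic_factor) \/
  [/\ vge P 1 (s - iX p), vge P 1 (u - iX up) & vge P (-1) (y / w * generic_factor)].
Proof.
have cp : c != p by rewrite eq_sym.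
have pC0 : iX p - C != 0 by rewrite -rmorphB fmorph_eq0.
have [[j h]|[[x0 [g h]]|[x0 h]]] := place_cases.
- left; apply: (yw_zero h); have [[j0 _ _ _ _] [[_ _ _ _ hn] [hl vs _]]] := h.
  have hs : vge P 1 (s - C) by rewrite vgeE // vs; move: j0; clear; lia.
  have [sp0 vp] := shift_unit cp hs; have sreg := res_reg vP hs.
  have mj : - j <= 0 by rewrite oppr_le0 ltW.
  apply: (vgeB vP); last exact: (vgeB vP).
  apply: (vgeD vP); last by apply: (vgeW mj); exact: (vgeC vP).
  apply: (vgeW mj); apply: (vge_div vP sp0); rewrite vp addr0.
  apply: (vgeD vP); first exact: Y_regular.
  by apply: (vgeMl vP); [exact: (vgeC vP)|exact: r_regular].
- left; apply: (yw_torsion h); have [[g0 _ _ _ vw] [_ [hln vs hYd]]] := h.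
  have hs : vge P 1 (s - C) by rewrite vgeE // vs; move: g0; clear; lia.
  have [sp0 vp] := shift_unit cp hs.
  have wg : P w + 0 <= g by move: g0 vw; clear; lia.
  apply: (vgeB vP); last exact: (vgeW wg).
  (* Over a common denominator the numerator is a combination of [Y - D], [r] and [s - C], each of
     which vanishes at least to the order of [w]. *)
  have -> : (Y + iX k * r) / (s - iX p) + iX (d / (p - c)) =
     ((Y - D) * (iX p - C) + iX k * (iX p - C) * r + D * (s - C)) / ((s - iX p) * (iX p - C)).
    have -> : iX (d / (p - c)) = D / (iX p - C) by rewrite fmorph_div rmorphB.
    by field; rewrite pC0 sp0.
  apply: (vge_div vP); first by rewrite mulf_neq0.
  rewrite (nuM vP) // vp -[iX p - C]rmorphB (nuC vP) // !addr0.
  apply: (vgeD vP); first apply: (vgeD vP).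
  + by rewrite mulrC; apply: (vgeMl vP); [exact: (vgeC vP)|apply: vgeW hYd; rewrite -[P w]addr0].
  + apply: (vgeMl vP); first by apply: (vgeM0 vP); exact: (vgeC vP).
    by rewrite -(torsion_r_order h) vge_refl.
  by apply: (vgeMl vP); [exact: (vgeC vP)|rewrite vgeE // vs -[P w]addr0].
have hn := yn_general h; have hyw := yw_general h.
have GE : y / w * generic_factor = y / w * ((Y + iX k * r) / (s - iX p) - l)
    + y / w * iX (d / (p - c)) + y / w * n.
  by rewrite /generic_factor; ring.
have reg m : m <= 0 -> vge P m (y / w * ((Y + iX k * r) / (s - iX p) - l)) ->
    vge P m (y / w * generic_factor).
  move=> m0 hm; rewrite GE; apply: (vgeD vP); last by apply: vgeW hn.
  by apply: (vgeD vP) => //; apply: (vgeW m0); apply: hyw; exact: (vgeC vP).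
have [Ps|Ps] := ltP (P s) 0.
  left; apply: reg => //; apply: hyw.
  have [hY hl] := orders_over_infinity Ps; have vs := infinity_order Ps.
  (* The leading parts of [Y / (s - p)] and [l = (Y + D) / (s - C)] cancel at infinity. *)
  have -> : (Y + iX k * r) / (s - iX p) - l =
     iX k * (r / (s - iX p)) + (Y * (iX p - C) - D * (s - iX p)) / ((s - iX p) * (s - C)).
    have -> : l = (Y + D) / (s - C) by rewrite -lsE mulfK.
    by field; rewrite !sc0.
  apply: (vgeD vP).
    apply: (vgeMl vP); first exact: (vgeC vP).
    apply: (vge_div vP (sc0 p)); rewrite add0r vgeE ?r_neq0 //.
    by have := P2r; rewrite !shift_pole //; clear; lia.
  apply: (vge_div vP); first by rewrite mulf_neq0.
  rewrite (nuM vP) // !shift_pole // vs.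
  apply: (vgeB vP).
    rewrite mulrC -rmorphB; apply: (vgeMl vP); first exact: (vgeC vP).
    by apply: vgeW hY.
  by apply: (vgeMl vP); [exact: (vgeC vP)|rewrite vgeE // shift_pole // vs].
have hs0 : vge P 0 s by rewrite /vge Ps orbT.
have lreg : vge P 0 l by have [_ [hX _ _]] := h; apply: l_regular.
have numreg : vge P 0 (Y + iX k * r).
  apply: (vgeD vP); first exact: Y_regular.
  by apply: (vgeMl vP); [exact: (vgeC vP)|exact: r_regular].
have hyw' m z : m <= 0 -> vge P m z -> vge P m (y / w * (z - l)).
  move=> m0 hz; rewrite -[m]add0r; apply: (vgeM vP).
    by rewrite -[y / w]mulr1; apply: hyw; exact: (vge1 vP).
  by apply: (vgeB vP) => //; apply: vgeW lreg.
have [p' hs] := res_of hs0.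
have [pp|pp] := eqVneq p' p; last first.
  left; apply: reg => //; apply: hyw' => //.
  by have [sp0 vp] := shift_unit pp hs; apply: (vge_div vP sp0); rewrite vp addr0.
rewrite pp in hs.
(* At a branch point [k] is 0, and [Y / (s - p)] has order 1 - 2. *)
have [up0|up0] := eqVneq up 0.
  have Dp : quintic.[p] = 0 by rewrite -upE up0 expr0n.
  have Pu := branch_order Dp hs.
  right; split=> //; first by rewrite up0 rmorph0 subr0 vgeE ?u_neq0 // Pu.
  apply: reg => //; apply: hyw' => //.
  have [_ vc] := shift_unit pc hs; have [_ ve] := shift_unit pe hs.
  have vr : P r = 0 by have := P2r; rewrite vc ve; clear; lia.
  have vY : P Y = 1 by rewrite -Pu uE (nuM vP) ?Y_neq0 ?r_neq0 // vr addr0.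
  have [_ vsp] := branch_orders st uD Dp (quintic_simple Dp) below_place (ltac:(by rewrite below_centre)).
  have {}vsp : P (s - iX p) = 2 by move: vsp; rewrite /below rmorphB iphi Pu.
  rewrite /k up0 mul0r rmorph0 mul0r addr0; apply: (vge_div vP (sc0 p)).
  by rewrite vsp vgeE ?Y_neq0 // vY.
have ureg : vge P 0 u by rewrite uE; apply: (vgeM0 vP); [exact: Y_regular|exact: r_regular].
have [u1 hu] := res_of ureg.
have u12 : u1 ^+ 2 = up ^+ 2.
  have h1 := resM vP hu hu; rewrite -!expr2 in h1.
  apply: (res_uniq vP h1); rewrite upE -rmorphXn uD -ev_phi.
  exact: (res_ev vP).
have /orP[/eqP e1|/eqP e1] : (u1 == up) || (u1 == - up) by rewrite -eqf_sqr u12.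
  right; rewrite -e1 in up0 *; split=> //; apply: reg => //; apply: hyw' => //.
  apply: (vge_div vP (sc0 p)); rewrite (unramified_order up0 hs hu).
  by [].
left; apply: reg => //; apply: hyw' => //; apply: conjugate_cancel => //.
by move: hu; rewrite e1 rmorphN opprK.
Qed.
End Generic.

End OnePlace.

Lemma cover_etale : etale iY iX phi.
Proof.
move=> P pP; exists (below P); split; first exact: below_place.
by split=> // z z0; rewrite mul1r.
Qed.

(** A valuation of [C(x, y)] alone is enough for the arguments below, which compare orders of
    elements of that field; it need not be extended to [L]. *)
Lemma E1_at_infinity : exists (E : fieldType) (iE : {rmorphism CC -> E})
    (j : {rmorphism E -> L}) (P : E -> int) (s' Y' ln' psi' : E),
  [/\ forall c', j (iE c') = iX c', forall z, E1 z -> exists z', z = j z' & is_val iE P] /\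
  [/\ j s' = s, j Y' = Y, j ln' = l - n & j psi' = cpsi A B x] /\
  [/\ s' - iE c != 0, P (s' - iE c) = 1 & vge P 0 Y'] /\
  [/\ psi' != 0, P psi' = -8, ln' != 0 & P ln' = -1].
Proof.
have [E [iE [j [jE [surj inS]]]]] := subfield_type E1_subfield.
have [x' xE] := surj _ E1_x; have [y' yE] := surj _ E1_y.
have jev p : j (map_poly iE p).[x'] = p `@ x.
  rewrite -horner_map -map_poly_comp xE; congr (_.[_]).
  by apply: eq_map_poly => c'; rewrite /= jE.
have tx' : transcendental iE x' by move=> p px; apply: tx; rewrite -jev px rmorph0.
have yx' : y' ^+ 2 = cf (iE a) (iE b) x'.
  by apply: (fmorph_inj j); rewrite rmorphXn map_cf !jE -xE -yE.
have Cx' z : Cx iX x z -> exists2 z', Cx iE x' z' & z = j z'.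
  move=> [p [q [q0 ->]]]; exists ((map_poly iE p).[x'] / (map_poly iE q).[x']).
    by exists p, q; split=> //; rewrite -(fmorph_eq0 j) jev.
  by rewrite fmorph_div !jev.
have gen' z : quad (Cx iE x') y' z.
  have [a1 [b1 [/Cx'[a' Ca ->] /Cx'[b' Cb ->] zE]]] := inS z.
  exists a', b'; split=> //; apply: (fmorph_inj j).
  by rewrite zE yE rmorphD rmorphM.
have [P [pP [[p0 vp XC [sC vs]] [hY ln0 vln]]]] := orders_at_infinity tx' yx' gen' d0 DC.
exists E, iE, j, P, (ts (iE a) (iE b) (iE c) (iE d) x' y'), (tYs (iE a) (iE b) (iE c) (iE d) x' y'),
  (tl (iE a) (iE b) (iE c) (iE d) x' y' - tn (iE a) (iE b) x' y'), (cpsi (iE a) (iE b) x').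
split; first by split=> //; exact: place_val pP.
split; first by rewrite map_ts map_tYs rmorphB map_tl map_tn map_cpsi !jE -xE -yE sE.
by split; split=> //; rewrite subr_eq0.
Qed.

Lemma s_minus_e_order (E : fieldType) (iE : {rmorphism CC -> E}) (P : E -> int) (s' : E) q :
  is_val iE P -> c != q -> s' - iE c != 0 -> P (s' - iE c) = 1 ->
  s' - iE q != 0 /\ P (s' - iE q) = 0.
Proof.
move=> vP cq sc vs; apply: (@val_unit_const _ _ _ vP (c - q)); first by rewrite subr_eq0.
rewrite rmorphB; have -> : s' - iE q - (iE c - iE q) = s' - iE c by ring.
by rewrite vgeE // vs.
Qed.

Lemma r_notin_E1 : ~ E1 r.
Proof.
have [E [iE [j [P [s' [Y' [ln' [psi' [[jE surj vP] [[js _ _ _] [[sc vs _] _]]]]]]]]]]] := E1_at_infinity.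
move=> /surj[r' rr']; have [se ve] := s_minus_e_order vP ce sc vs.
have r'2 : r' ^+ 2 = (s' - iE c) * (s' - iE e).
  by apply: (fmorph_inj j); rewrite rmorphXn -rr' rE rmorphM !rmorphB js !jE.
have r'0 : r' != 0 by have := r_neq0; rewrite rr' fmorph_eq0.
by have := congr1 P r'2; rewrite (nuX vP) // (nuM vP) // vs ve; clear; lia.
Qed.

(** At the origin [psi] has order -8, while [z^2 r^2] has odd order. *)
Lemma psi_neq_square_r2 z : E1 z -> cpsi A B x <> z ^+ 2 * r ^+ 2.
Proof.
have [E [iE [j [P [s' [Y' [ln' [psi' [[jE surj vP] [[js _ _ jpsi] [[sc vs _] [p0 vp _ _]]]]]]]]]]]] := E1_at_infinity.
move=> /surj[z' zz'] psiE; have [se ve] := s_minus_e_order vP ce sc vs.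
have e' : psi' = z' ^+ 2 * ((s' - iE c) * (s' - iE e)).
  by apply: (fmorph_inj j); rewrite jpsi psiE rE rmorphM rmorphXn rmorphM !rmorphB js !jE -zz'.
have z'0 : z' != 0 by apply: contraNneq p0 => z'0; rewrite e' z'0 expr0n mul0r.
have := congr1 P e'; rewrite vp (nuM vP) ?expf_neq0 ?mulf_neq0 // (nuX vP) // (nuM vP) // vs ve.
by clear; lia.
Qed.

Lemma f_poly_neq0 : fP != 0.
Proof. by rewrite -size_poly_eq0 (lead_at_size (oner_neq0 _) (lead_f a b)). Qed.

Lemma size_psi : size (cpsi a%:P b%:P 'X) = 5.
Proof.
have three0 : 3%:R != 0 :> CC by exact: CC_nat_neq0 2.
by rewrite (lead_at_size three0 (lead_psi a b)).
Qed.

Lemma ratio_square (g h : {poly CC}) z : g != 0 -> Cx iX x z -> g `@ x = z ^+ 2 * h `@ x ->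
  exists p q : {poly CC}, [/\ p != 0, q != 0 & g * q ^+ 2 = p ^+ 2 * h].
Proof.
move=> g0 [p [q [q0 ->]]] gE; exists p, q.
have e' : g * q ^+ 2 = p ^+ 2 * h.
  apply/eqP; rewrite -subr_eq0; apply/eqP; apply: tx; rewrite evB !(evXn, evM) gE.
  by field.
have qn0 : q != 0 by apply: contraNneq q0 => ->; rewrite ev0.
split=> //; apply: contraTneq g0 => p0; move/eqP: e'; rewrite p0 expr0n mul0r mulf_eq0.
by rewrite expf_eq0 (negPf qn0) orbF => ->.
Qed.

Lemma y_notin_Cx : ~ Cx iX x y.
Proof.
move=> Cy; have [|p [q [p0 q0 e']]] := ratio_square (h := 1) f_poly_neq0 Cy.
  by rewrite ev1 mulr1 ev_f yx.
have := square_ratio_size p0 q0 f_poly_neq0 (oner_neq0 _) e'.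
by rewrite (lead_at_size (oner_neq0 _) (lead_f a b)) size_poly1.
Qed.

(** A square root [z1 + z2 y] must have [z1 = 0] or [z2 = 0]. The degrees 4 and 3 exclude
    [psi = z2^2 f] by parity. For [psi = z1^2] parity says nothing, and a simple root of [psi]
    decides. *)
Lemma psi_nonsquare_E1 z : E1 z -> cpsi A B x <> z ^+ 2.
Proof.
move=> [z1 [z2 [C1 C2 ->]]] psiE.
have psi0 : cpsi a%:P b%:P 'X != 0 by rewrite -size_poly_eq0 size_psi.
have sC := Cx_subfield iX x.
have Cpsi : Cx iX x (cpsi A B x) by rewrite -ev_psi; apply: (sf_ev sC); apply: Cx_gen.
have Cf : Cx iX x (cf A B x) by rewrite -ev_f; apply: (sf_ev sC); apply: Cx_gen.
have e1 : 2%:R * z1 * z2 * y = cpsi A B x - z1 ^+ 2 - z2 ^+ 2 * cf A B x.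
  by rewrite psiE -yx; ring.
have [z12|z12] := eqVneq (2%:R * z1 * z2) 0; last first.
  apply: y_notin_Cx; rewrite -(mulKf z12 y) e1; apply: (sfM sC).
    by apply: (sfV sC); apply: (sfM sC) => //; apply: (sfM sC) => //; apply: (sf_nat sC).
  apply: (sfB sC); last by apply: (sfM sC) => //; apply: (sfX sC).
  by apply: (sfB sC) => //; apply: (sfX sC).
move/eqP: z12; rewrite !mulf_eq0 (negPf two0) /= => /orP[]/eqP z0.
  have [|p [q [p0 q0 e']]] := ratio_square (h := fP) psi0 C2.
    by rewrite ev_psi ev_f psiE z0 add0r exprMn yx.
  have := square_ratio_size p0 q0 psi0 f_poly_neq0 e'.
  by rewrite size_psi (lead_at_size (oner_neq0 _) (lead_f a b)).
have [|p [q [p0 q0 e']]] := ratio_square (h := 1) psi0 C1.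
  by rewrite ev_psi ev1 mulr1 psiE z0 mul0r addr0.
have [x1 /[dup] rx1 /factor_theorem[psi1 psi1E]] : exists x1, root (cpsi a%:P b%:P 'X) x1.
  by apply/closed_rootP; rewrite size_psi.
have psi1x1 : ~~ root psi1 x1.
  have fx1 : cf a b x1 != 0.
    apply/eqP => f0; have := sep f0; move: rx1; rewrite /root horner_psi.
    by rewrite /cpsi f0 mulr0 sub0r oppr_eq0 expf_eq0 /= => ->.
  have := congr1 (fun p : {poly CC} => p^`().[x1]) psi1E.
  rewrite deriv_psi derivM derivXsubC mulr1 -polyC_natr hornerM horner_f hornerC.
  by rewrite hornerD hornerM hornerXsubC subrr mulr0 add0r /root => <-; rewrite mulf_neq0 // CC_nat_neq0.
move: e' => /(congr1 (mup x1)); rewrite mulr1 !expr2 !mupM ?mulf_neq0 //.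
have -> : mup x1 (cpsi a%:P b%:P 'X) = 1%N.
  by rewrite psi1E mupMr //; have := @mup_XsubCX _ 1 x1 x1; rewrite expr1 eqxx.
by move: (mup x1 p) (mup x1 q) => i k; clear; lia.
Qed.

Lemma w_notin_E2 : ~ E2 w.
Proof.
move=> [z1 [z2 [C1 C2 wz]]].
have psiE : cpsi A B x = (z1 + z2 * r) ^+ 2 by rewrite -wE wz.
have sf := E1_subfield.
have e1 : 2%:R * z1 * z2 * r = cpsi A B x - z1 ^+ 2 - z2 ^+ 2 * r ^+ 2.
  by rewrite psiE; ring.
have [z12|z12] := eqVneq (2%:R * z1 * z2) 0; last first.
  apply: r_notin_E1; rewrite -(mulKf z12 r) e1; apply: (sfM sf).
    by apply: (sfV sf); apply: (sfM sf) => //; apply: (sfM sf) => //; apply: (sf_nat sf).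
  apply: (sfB sf); last by apply: (sfM sf); [exact: (sfX sf)|exact: E1_r2].
  by apply: (sfB sf); [exact: E1_psi|exact: (sfX sf)].
move/eqP: z12; rewrite !mulf_eq0 (negPf two0) /= => /orP[]/eqP z0.
  by apply: (psi_neq_square_r2 C2); rewrite psiE z0 add0r exprMn.
by apply: (psi_nonsquare_E1 C1); rewrite psiE z0 mul0r addr0.
Qed.

Lemma quotient_nonconst G c' : E2 G -> G != 0 -> y / w * G != iX c'.
Proof.
move=> EG G0; apply/eqP => e'.
have yG : y * G = iX c' * w by rewrite -e'; field; rewrite w_neq0.
have c'0 : c' != 0.
  apply/eqP => c0; move/eqP: yG; rewrite c0 rmorph0 mul0r mulf_eq0.
  by rewrite (negPf y_neq0) (negPf G0).
have ic0 : iX c' != 0 by rewrite fmorph_eq0.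
apply: w_notin_E2; rewrite -(mulKf ic0 w) -yG.
have sf := E2_subfield.
apply: (sfM sf); first by apply: (sfV sf); exact: (sfC sf).
by apply: (sfM sf) => //; apply: (quad_base E1_subfield); exact: E1_y.
Qed.

Lemma E2_base z : E1 z -> E2 z.
Proof. exact: (quad_base E1_subfield). Qed.
Lemma E2_r : E2 r.
Proof. exact: (quad_gen E1_subfield). Qed.

Lemma ln_neq0 : l - n != 0.
Proof.
have [E [iE [j [P [s' [Y' [ln' [psi' [_ [[_ _ jln _] [_ [_ _ ln0 _]]]]]]]]]]]] := E1_at_infinity.
by rewrite -jln fmorph_eq0.
Qed.

Lemma E2_ln : E2 (l - n).
Proof. by apply: E2_base; apply: (sfB E1_subfield); [exact: E1_l|exact: E1_n]. Qed.

Lemma E2_generic p up : E2 (generic_factor p up).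
Proof.
have sf := E2_subfield; rewrite /generic_factor; apply: (sfB sf); last exact: E2_ln.
apply: (sfD sf); last exact: (sfC sf).
apply: (sf_div sf); last by apply: E2_base; exact: E1_s_sub.
apply: (sfD sf); first by apply: E2_base; exact: E1_Y.
by apply: (sfM sf); [exact: (sfC sf)|exact: E2_r].
Qed.

(** If [k] is not 0, a vanishing factor would express [r] in [C(x, y)]; if [k] is 0, it would make
    [l - n] regular at the origin, where it has a simple pole. *)
Lemma generic_neq0 p up : p != c -> p != e -> generic_factor p up != 0.
Proof.
move=> pc pe; apply/eqP => G0.
have cp : c != p by rewrite eq_sym.
have sf := E1_subfield; move: G0; rewrite /generic_factor; set k := up / _ => G0.
have [k0|k0] := eqVneq k 0; last first.
  have ik0 : iX k != 0 by rewrite fmorph_eq0.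
  apply: r_notin_E1; rewrite -(mulKf ik0 r).
  have -> : iX k * r = (l - n - iX (d / (p - c))) * (s - iX p) - Y.
    apply/eqP; rewrite -subr_eq0; apply/eqP.
    transitivity (((Y + iX k * r) / (s - iX p) + iX (d / (p - c)) - (l - n)) * (s - iX p)).
      by move: (iX (d / _)) (iX k) => d' k'; field; rewrite sc0.
    by rewrite G0 mul0r.
  apply: (sfM sf); first by apply: (sfV sf); exact: (sfC sf).
  apply: (sfB sf); last exact: E1_Y.
  apply: (sfM sf); last exact: E1_s_sub.
  apply: (sfB sf); last exact: (sfC sf).
  by apply: (sfB sf); [exact: E1_l|exact: E1_n].
have [E [iE [j [P [s' [Y' [ln' [psi' [[jE surj vP] [[js jY jln _] [[sc vs hY] [_ _ ln0 vln]]]]]]]]]]]] := E1_at_infinity.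
have [sp vsp] := s_minus_e_order vP cp sc vs.
have e' : ln' = Y' / (s' - iE p) + iE (d / (p - c)).
  apply: (fmorph_inj j); rewrite jln rmorphD fmorph_div rmorphB js jY !jE.
  by apply/eqP; rewrite -subr_eq0 -opprB oppr_eq0; move: G0; rewrite k0 rmorph0 mul0r addr0 => ->.
have : vge P 0 ln'.
  rewrite e'; apply: (vgeD vP); last exact: (vgeC vP).
  by apply: (vge_div vP sp); rewrite vsp addr0.
by rewrite vgeE // vln.
Qed.

Lemma pencil_of_section q F : is_place iY q -> (forall c', F != iX c') ->
  (forall P, is_place iX P -> vge P 0 F \/ (same_place (below P) q /\ vge P (-1) F)) ->
  exists x1 x2 : L, in_L_fiber iX phi q x1 /\ in_L_fiber iX phi q x2 /\
    forall c1 c2 : CC, iX c1 * x1 + iX c2 * x2 = 0 -> c1 = 0 /\ c2 = 0.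
Proof.
move=> pq nc hF; have F0 : F != 0 by have := nc 0; rewrite rmorph0.
exists 1, F; split; last split.
- by right=> P pP; left; rewrite (nu1 (place_val pP)).
- right=> P pP; have [h|[h1 h2]] := hF P pP; first by left; move: h; rewrite vgeE.
  right; exists 1%N; split; last by move: h2; rewrite vgeE //; clear; lia.
  by split=> // z z0; rewrite mul1r; apply: h1.
move=> c1 c2; have [->|c20] := eqVneq c2 0.
  by rewrite mulr1 rmorph0 mul0r addr0 => /eqP; rewrite fmorph_eq0 => /eqP ->.
have ic2 : iX c2 != 0 by rewrite fmorph_eq0.
move=> h; have := nc (- c1 / c2); rewrite fmorph_div rmorphN.
suff -> : F = - iX c1 / iX c2 by rewrite eqxx.
apply: (mulfI ic2); rewrite mulrCA mulfV // mulr1; apply/eqP.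
by rewrite -addr_eq0 addrC -[iX c1]mulr1 h.
Qed.

(** The cases are those in which a place of [KY] is determined in different ways: infinity, the
    branch points, where the value of [s] suffices, and the other points, where the value of [u] is
    needed as well. *)
Lemma cover_prill : prill_exceptional iY iX phi.
Proof.
move=> q pq; have vq := place_val pq.
have qcentre c' P : vge (below P) 1 (s0 - iY c') = vge P 1 (s - iX c').
  by rewrite /vge /below rmorphB iphi -(fmorph_eq0 phi) rmorphB iphi.
have ucentre c' P : vge (below P) 1 (u0 - iY c') = vge P 1 (u - iX c').
  by rewrite /vge /below rmorphB iphi -(fmorph_eq0 phi) rmorphB iphi.
have [qs|qs] := ltP (q s0) 0.
  apply: (pencil_of_section pq (F := y / w * (l - n))) => [c'|P pP].
    exact: (quotient_nonconst _ E2_ln ln_neq0).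
  have [h|[Ps h]] := regular_at_infinity pP; [by left|right; split=> //].
  have [_ h'] := infinity_centre st uD genY (m := 2) size_quintic.
  by apply: h' => //; exact: below_place.
have [|p hp] := residue_exists (z := s0) ffY pq; first by rewrite /vge qs orbT.
have branch F : quintic.[p] = 0 -> (forall c', F != iX c') ->
    (forall P, is_place iX P -> vge P 0 F \/ (vge P 1 (s - iX p) /\ vge P (-1) F)) ->
    exists x1 x2 : L, in_L_fiber iX phi q x1 /\ in_L_fiber iX phi q x2 /\
    forall c1 c2 : CC, iX c1 * x1 + iX c2 * x2 = 0 -> c1 = 0 /\ c2 = 0.
  move=> Dp nc hF; apply: (pencil_of_section pq nc) => P pP.
  have [h|[hs h]] := hF P pP; [by left|right; split=> //].
  have [_ h'] := branch_centre st uD genY Dp (quintic_simple Dp).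
  by apply: h' => //; rewrite ?qcentre //; exact: below_place.
have [pc|pc] := eqVneq p c.
  apply: (branch (y / w)) => [|c'|P pP]; first by rewrite pc quintic_c.
    rewrite -[y / w]mulr1; apply: quotient_nonconst; last exact: oner_neq0.
    by apply: E2_base; apply: (sf1 E1_subfield).
  by rewrite pc; exact: regular_at_c.
have [pe|pe] := eqVneq p e.
  apply: (branch (y / w * (r / (s - iX e)))) => [|c'|P pP]; first by rewrite pe quintic_e.
    apply: quotient_nonconst; last by rewrite mulf_neq0 ?invr_eq0 ?r_neq0.
    apply: (sf_div E2_subfield); first exact: E2_r.
    by apply: E2_base; exact: E1_s_sub.
  by rewrite pe; exact: regular_at_e.
have ureg : vge q 0 u0.
  rewrite -(vge_sqr vq) uD mulr0; apply: (vge_ev vq); exact: (res_reg vq hp).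
have [up hup] := residue_exists ffY pq ureg.
have upE : up ^+ 2 = quintic.[p].
  have h1 := resM vq hup hup; rewrite -!expr2 uD in h1.
  by apply: (res_uniq vq h1); exact: (res_ev vq).
have nc c' : y / w * generic_factor p up != iX c'.
  by apply: quotient_nonconst; [exact: E2_generic|exact: generic_neq0].
have [up0|up0] := eqVneq up 0.
  apply: (branch _ _ nc); first by rewrite -upE up0 expr0n.
  move=> P pP; have [h|[hs _ h]] := regular_generic pP pc pe upE; [by left|by right].
apply: (pencil_of_section pq nc) => P pP.
have [h|[hs hu h]] := regular_generic pP pc pe upE; [by left|right; split=> //].
have [_ h'] := unramified_centre st uD genY p up0.
by apply: h' => //; split; rewrite ?qcentre ?ucentre //; exact: below_place.
Qed.

End Cover.

(** * Construction of the cover *)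

Lemma CC_sqrt (z : CC) : exists r, r ^+ 2 = z.
Proof.
have /closed_rootP[r] : size ('X^2 - z%:P : {poly CC}) != 1%N by rewrite size_XnsubC.
by rewrite /root hornerD hornerN hornerXn hornerC subr_eq0 => /eqP; exists r.
Qed.

Lemma adjoin_sqrt (F : fieldType) (g : F) :
  exists (L : fieldType) (phi : {rmorphism F -> L}) (r : L),
    [/\ r ^+ 2 = phi g, finite_ext phi & forall x, exists q : {poly F}, x = (map_poly phi q).[r]].
Proof.
have [|L [phi [r [rr fe gen]]]] := @adjoin_root F ('X^2 - g%:P); first by rewrite size_XnsubC.
exists L, phi, r; split=> //; apply/eqP; move: rr.
by rewrite rmorphB /= map_polyXn map_polyC /root hornerD hornerN hornerXn hornerC subr_eq0.
Qed.

Lemma subfield_adjoin (F M L : fieldType) (iota : {rmorphism CC -> L}) (S : L -> Prop)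
    (f : {rmorphism F -> M}) (g : {rmorphism M -> L}) (x : M) (q : {poly F}) :
  subfield iota S -> (forall z, S (g (f z))) -> S (g x) -> S (g (map_poly f q).[x]).
Proof.
move=> sS Sf Sx; elim/poly_ind: q => [|q k IH]; first by rewrite rmorph0 horner0 rmorph0; apply: (sf0 sS).
rewrite rmorphD rmorphM /= map_polyX map_polyC hornerMXaddC rmorphD rmorphM.
by apply: (sfD sS); [apply: (sfM sS)|apply: Sf].
Qed.

Section Preimage.
Variables (L : fieldType) (iX : {rmorphism CC -> L}).
Variables (a b c d : CC).
Hypotheses (d0 : d != 0) (DC : d ^+ 2 = cf a b c).
Hypothesis sep : forall r, cf a b r = 0 -> cH a r != 0.
Local Notation A := (iX a).
Local Notation B := (iX b).
Local Notation C := (iX c).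
Local Notation D := (iX d).
Variables (s Y l X x : L).
Hypotheses (snc : forall k, s != iX k) (Ys : Y ^+ 2 = cf A B s).
Hypotheses (lE : l * (s - C) = Y + D) (XE : X = l ^+ 2 - s - C).
Hypothesis xX : cN A B x = X * cpsi A B x ^+ 2.
Let Z := D - l * (X - C).

Let sC0 : s - C != 0. Proof. by rewrite subr_eq0. Qed.
Let DC' : D ^+ 2 = cf A B C. Proof. by rewrite -map_cf -DC rmorphXn. Qed.

(** [(X, Z)] is [(s, Y) - (c, d)], found from the chord through [(s, Y)] and [(c, - d)]. *)
Lemma inverse_translate : Z ^+ 2 = cf A B X.
Proof.
have sC : s != C by [].
have lE' : l * (s - C) = D - (- Y) by rewrite lE opprK addrC.
rewrite XE -(translate_curve DC' _ sC lE') ?sqrrN // /Z XE; ring.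
Qed.

Lemma l_nonconst k : X = iX k -> forall k', l != iX k'.
Proof.
move=> Xk k'; apply/eqP => lk; have /eqP := snc (k' ^+ 2 - k - c); apply.
by rewrite !rmorphB rmorphXn -lk -Xk XE; ring.
Qed.

(* If X were c, then l = - f'(c) / 2 d would be the slope of the tangent at (c, - d). *)
Lemma X_nonconst k : X != iX k.
Proof.
apply/eqP => Xk; have lnc := l_nonconst Xk.
have [kc|kc] := eqVneq k c; last first.
  have [k' k'2] := CC_sqrt (cf a b k).
  have kc0 : iX k - C != 0 by rewrite -rmorphB fmorph_eq0 subr_eq0.
  have : (Z == iX k') || (Z == - iX k').
    by rewrite -eqf_sqr inverse_translate Xk -map_cf -k'2 rmorphXn.
  have lZ : l = (D - Z) / (iX k - C) by rewrite /Z Xk; field.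
  case/orP=> /eqP ZE; rewrite ZE in lZ.
    by have /eqP := lnc ((d - k') / (k - c)); apply; rewrite fmorph_div !rmorphB.
  by have /eqP := lnc ((d + k') / (k - c)); apply; rewrite fmorph_div !(rmorphB, rmorphD) lZ opprK.
have D0 : D != 0 by rewrite fmorph_eq0.
have two0 : 2%:R != 0 :> L by exact: natK_neq0 iX 1.
have l2 : l ^+ 2 = s + 2%:R * C.
  have -> : l ^+ 2 = X + s + C by rewrite XE; ring.
  by rewrite Xk kc; ring.
have YE : Y = l * (s - C) - D by rewrite lE addrK.
have BE : B = D ^+ 2 - C ^+ 3 - A * C by rewrite DC' /cf; ring.
have e1 : (s - C) * (2%:R * D * l + (3%:R * C ^+ 2 + A)) = 0.
  transitivity (l ^+ 2 * (s - C) ^+ 2 + D ^+ 2 - (l * (s - C) - D) ^+ 2 + (s - C) * (3%:R * C ^+ 2 + A)).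
    by ring.
  by rewrite -YE Ys l2 /cf BE; ring.
have e2 : 2%:R * D * l + (3%:R * C ^+ 2 + A) = 0.
  by move/eqP: e1; rewrite mulf_eq0 (negPf sC0) => /eqP.
have /eqP := lnc (- (3%:R * c ^+ 2 + a) / (2%:R * d)); apply.
rewrite fmorph_div rmorphN rmorphD !(rmorph_nat, rmorphXn, rmorphM).
by apply: (mulfI (mulf_neq0 two0 D0)); rewrite -(addrK (3%:R * C ^+ 2 + A) (_ * l)) e2; field; rewrite D0.
Qed.

(** A constant [x] would make the abscissa of [3 (x, y)] constant, unless [psi] vanishes at it; then
    [N = 64 f^3] vanishes too, and [f] has a multiple root. *)
Lemma x_transcendental : transcendental iX x.
Proof.
apply: nonconst_transcendental => k; apply/eqP => xk.
have := xX; rewrite xk -map_cN -map_cpsi -rmorphXn.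
have [p0|p0] := eqVneq (cpsi a b k) 0.
  rewrite p0 expr0n rmorph0 mulr0 => /eqP; rewrite fmorph_eq0 /cN p0 expr0n !mulr0 subr0 add0r.
  have n0 : 64%:R != 0 :> CC by exact: CC_nat_neq0 63.
  rewrite mulf_eq0 (negPf n0) expf_eq0 /= => /eqP f0.
  by have := sep f0; move/eqP: p0; rewrite /cpsi f0 mulr0 sub0r oppr_eq0 expf_eq0 /= => ->.
have ip0 : iX (cpsi a b k ^+ 2) != 0 by rewrite fmorph_eq0 expf_neq0.
move=> e1; have /eqP := X_nonconst (cN a b k / cpsi a b k ^+ 2); apply.
by rewrite fmorph_div e1 mulfK.
Qed.

(** [y] is not adjoined but solved for in [Z = y Om / psi^3]; [tripling_curve] then puts [(x, y)] on
    the curve. *)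
Lemma tripling_preimage : exists y,
  [/\ y ^+ 2 = cf A B x, s = ts A B C D x y & Y = tYs A B C D x y].
Proof.
have tx := x_transcendental.
have p0 : cpsi A B x != 0.
  rewrite -ev_psi; apply: transcendental_ev_neq0 => //.
  by rewrite -size_poly_eq0 size_psi.
have O0 : cOm A B x != 0.
  rewrite -ev_Om; apply: transcendental_ev_neq0 => //.
  by rewrite -size_poly_eq0 (lead_at_size (oner_neq0 _) (lead_Om a b)).
have Xx : tX A B x = X by rewrite /tX xX mulfK // expf_neq0.
pose y := Z * cpsi A B x ^+ 3 / cOm A B x.
have Yx : tY A B x y = Z by rewrite /tY /y; field; rewrite O0 p0.
have lx : tl A B C D x y = l.
  have XC0 : X - C != 0 by rewrite subr_eq0 X_nonconst.
  by rewrite /tl Xx Yx /Z; field.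
have sx : ts A B C D x y = s by rewrite /ts lx Xx XE; ring.
exists y; split=> //; last by rewrite /tYs sx lx lE addrK.
have := tripling_curve A B x; rewrite xX => e1.
apply: (mulIf (expf_neq0 2 O0)); rewrite e1 /y exprMn.
rewrite exprVn mulfVK ?expf_neq0 // exprMn inverse_translate /cf; ring.
Qed.
End Preimage.

Section Existence.
Variables (KY : fieldType) (iY : {rmorphism CC -> KY}) (a b c d e : CC) (s0 u0 : KY).
Hypotheses (d0 : d != 0) (DC : d ^+ 2 = cf a b c).
Hypothesis sep : forall r, cf a b r = 0 -> cH a r != 0.
Hypotheses (st : transcendental iY s0) (uD : u0 ^+ 2 = (map_poly iY (quintic a b c e)).[s0]).
Hypothesis genY : forall z, quad (Cx iY s0) u0 z.

Lemma tripling_cover : exists (L : fieldType) (phi : {rmorphism KY -> L}) (x y w r : L),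
  let iX : {rmorphism CC -> L} := phi \o iY in
  [/\ finite_ext phi, transcendental iX x & y ^+ 2 = cf (iX a) (iX b) x] /\
  [/\ phi s0 = ts (iX a) (iX b) (iX c) (iX d) x y,
      phi u0 = tYs (iX a) (iX b) (iX c) (iX d) x y * r,
      r ^+ 2 = (phi s0 - iX c) * (phi s0 - iX e) & w ^+ 2 = cpsi (iX a) (iX b) x] /\
  forall z, quad (quad (quad (Cx iX x) y) r) w z.
Proof.
(* The adjunctions are [r], [x], [w], in this order. The equation for [x] is [N(x) = X psi(x)^2],
   with [X] the abscissa of [(s, Y) - (c, d)]; its degree 9 is that of tripling. *)
have [L1 [f1 [r1 [r12 fe1 gen1]]]] := adjoin_sqrt ((s0 - iY c) * (s0 - iY e)).
pose l1 := (f1 u0 / r1 + f1 (iY d)) / (f1 s0 - f1 (iY c)).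
pose X1 := l1 ^+ 2 - f1 s0 - f1 (iY c).
pose i1 : {rmorphism CC -> L1} := f1 \o iY.
have [|L2 [f2 [x2 [x2r fe2 gen2]]]] := @adjoin_root L1 (map_poly i1 (cN a%:P b%:P 'X)
     - X1 *: map_poly i1 (cpsi a%:P b%:P 'X ^+ 2)).
  have sN : size (map_poly i1 (cN a%:P b%:P 'X)) = 10%N.
    by rewrite size_map_poly (lead_at_size (oner_neq0 _) (lead_N a b)).
  have sp : (size (X1 *: map_poly i1 (cpsi a%:P b%:P 'X ^+ 2))%R < 10)%N.
    apply: leq_ltn_trans (size_scale_leq _ _) _; rewrite size_map_poly.
    have three0 : 3%:R ^+ 2 != 0 :> CC by rewrite expf_neq0 // (CC_nat_neq0 2).
    by rewrite (lead_at_size three0 (lead_atX 2 (lead_psi a b))).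
  by rewrite size_polyDl ?size_polyN sN.
have [L [f3 [w [w2 fe3 gen3]]]] := adjoin_sqrt (cpsi (f2 (i1 a)) (f2 (i1 b)) x2).
pose phi : {rmorphism KY -> L} := f3 \o (f2 \o f1).
pose iX : {rmorphism CC -> L} := phi \o iY.
pose x := f3 x2; pose r := f3 (f2 r1).
pose s := phi s0; pose u := phi u0.
have nc k : s != iX k.
  by rewrite /iX /= (inj_eq (fmorph_inj phi)) transcendental_nonconst.
have sc0 k : s - iX k != 0 by rewrite subr_eq0.
have rE : r ^+ 2 = (s - iX c) * (s - iX e).
  by rewrite /r -!rmorphXn r12 !(rmorphM, rmorphB).
have r0 : r != 0 by have := mulf_neq0 (sc0 c) (sc0 e); rewrite -rE expf_eq0.
have r10 : r1 != 0 by move: r0; rewrite !fmorph_eq0.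
pose Y := u / r; pose l := (Y + iX d) / (s - iX c); pose X := l ^+ 2 - s - iX c.
have XX : f3 (f2 X1) = X.
  by rewrite /X /l /Y /X1 /l1 !(rmorphXn, rmorphD, rmorphN, rmorphM, fmorphV).

have Ys : Y ^+ 2 = cf (iX a) (iX b) s.
  have evs p : (map_poly iX p).[s] = phi (map_poly iY p).[s0].
    by rewrite -horner_map -map_poly_comp.
  apply: (mulIf (expf_neq0 2 r0)); rewrite -exprMn divfK // rE.
  by rewrite -rmorphXn uD -evs /quintic !evM !evXC ev_f.
have lE : l * (s - iX c) = Y + iX d by rewrite divfK.
have xX : cN (iX a) (iX b) x = X * cpsi (iX a) (iX b) x ^+ 2.
  have := x2r; rewrite /root rmorphB /= map_polyZ -!map_poly_comp hornerD hornerN hornerZ.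
  rewrite -[(_ \o _ : _ -> _)]/((f2 \o i1 : {rmorphism CC -> L2}) : CC -> L2) evXn ev_N ev_psi.
  rewrite subr_eq0 => /eqP /(congr1 f3); rewrite rmorphM rmorphXn map_cN map_cpsi XX.
  exact.
have tx := x_transcendental d0 DC sep nc Ys lE (erefl X) xX.
have [y [yx sE YE]] := tripling_preimage d0 DC sep nc Ys lE (erefl X) xX.
exists L, phi, x, y, w, r.
have w2' : w ^+ 2 = cpsi (iX a) (iX b) x by rewrite w2 map_cpsi.
split; first by split=> //; apply: finite_ext_comp => //; apply: finite_ext_comp.
split; first by split=> //; rewrite -YE /Y divfK.
have sf1 := E1_subfield yx; have sf2 := E2_subfield yx sE rE.
have sf : subfield iX (quad (quad (quad (Cx iX x) y) r) w).
  exact: (quad_subfield sf2 (E2_w2 r yx w2')).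
set S := quad _ w in sf *.
have Sbase z : quad (Cx iX x) y z -> S z.
  by move=> h; apply: (quad_base sf2); apply: (quad_base sf1).
have Sr : S r by apply: (quad_base sf2); exact: (quad_gen sf1).
(* [KY] is recovered from [x], [y] and [r]: [s] and [Y] are rational in [x] and [y], and
   [u = Y r]. *)
have Sphi z : S (phi z).
  have Sev p : S (phi (map_poly iY p).[s0]).
    rewrite -horner_map -map_poly_comp; apply: (sf_ev sf); apply: Sbase.
    exact: (E1_s yx sE).
  have SCx z' : Cx iY s0 z' -> S (phi z').
    by move=> [p [q [_ ->]]]; rewrite fmorph_div; apply: (sf_div sf).
  have [p [q [/SCx Sp /SCx Sq ->]]] := genY z.
  rewrite rmorphD rmorphM; apply: (sfD sf) => //; apply: (sfM sf) => //.
  have -> : phi u0 = Y * r by rewrite /Y divfK.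
  by apply: (sfM sf) => //; apply: Sbase; rewrite YE; exact: (E1_Y yx sE).
move=> z; have [q3 ->] := gen3 z.
apply: (subfield_adjoin (g := idfun : {rmorphism L -> L}) _ sf); last exact: (quad_gen sf2).
move=> z2; have [q2 ->] := gen2 z2.
apply: (subfield_adjoin (g := f3) _ sf); last by apply: Sbase; exact: E1_x.
move=> z1; have [q1 ->] := gen1 z1.
by apply: (subfield_adjoin (g := f3 \o f2 : {rmorphism L1 -> L}) _ sf) => // z0; apply: Sphi.
Qed.
End Existence.

Lemma depressed_cubic (R : comPzRingType) (r1 r2 x : R) :
  cf (r1 * r2 - (r1 + r2) ^+ 2) (r1 * r2 * (r1 + r2)) x =
  (x - r1) * (x - r2) * (x + (r1 + r2)).
Proof. by rewrite /cf; ring. Qed.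

Lemma map_depressed_cubic (R S : comPzRingType) (j : {rmorphism R -> S}) (r1 r2 : R) (x : S) :
  cf (j (r1 * r2 - (r1 + r2) ^+ 2)) (j (r1 * r2 * (r1 + r2))) x =
  (x - j r1) * (x - j r2) * (x + j (r1 + r2)).
Proof. by rewrite !(rmorphXn, rmorphD, rmorphN, rmorphM) depressed_cubic. Qed.

Theorem theorem1p2 :
  forall (KY : fieldType) (iY : {rmorphism CC -> KY}),
    function_field iY -> genus_eq iY 2 ->
    exists (KX : fieldType) (iX : {rmorphism CC -> KX})
           (phi : {rmorphism KY -> KX}),
      [/\ function_field iX, over_CC iY iX phi, finite_ext phi,
          etale iY iX phi & prill_exceptional iY iX phi].
Proof.
move=> KY iY ff g2; have [s [u [es [ts sz un uE gen]]]] := genus2_model ff g2.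
case: es sz un uE => [|e1 [|e2 [|e3 [|e4 [|e5 [|]]]]]] // _ un uE.
have three0 : 3%:R != 0 :> CC by exact: CC_nat_neq0 2.
(* Moving the mean of three of the five roots to 0 removes the square term of their cubic; the other
   two roots become [c] and [e]. *)
pose m : CC := (e1 + e2 + e3) / 3%:R.
pose r1 := e1 - m; pose r2 := e2 - m; pose c := e4 - m; pose e := e5 - m.
have r3 : r1 + r2 = - (e3 - m) by rewrite /r1 /r2 /m; field.
pose a := r1 * r2 - (r1 + r2) ^+ 2; pose b := r1 * r2 * (r1 + r2).
have cfE x : cf a b x = (x - r1) * (x - r2) * (x - (e3 - m)).
  by rewrite depressed_cubic r3.
have neq (x y : CC) : x != y -> (x - m) - (y - m) != 0.
  by move=> xy; rewrite opprB addrA subrK subr_eq0.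
move: un; rewrite /= !inE !negb_or => /and5P[/and4P[n12 n13 n14 n15] /and3P[n23 n24 n25]
  /andP[n34 n35] n45 _].
have n45' : c != e by rewrite -subr_eq0 neq.
have [d dE] := CC_sqrt (cf a b c).
have d0 : d != 0.
  by rewrite -sqrf_eq0 dE cfE !mulf_neq0 // neq // eq_sym.
have fe : cf a b e != 0 by rewrite cfE !mulf_neq0 // neq // eq_sym.
have sep r : cf a b r = 0 -> cH a r != 0.
  have HE : cH a r = (r - r2) * (r - (e3 - m)) + (r - r1) * (r - (e3 - m)) + (r - r1) * (r - r2).
    by rewrite -[e3 - m]opprK -r3 /cH /a; ring.
  rewrite cfE HE => /eqP; rewrite !mulf_eq0 !subr_eq0 => /orP[/orP[]|] /eqP ->.
  - by rewrite subrr !mul0r !addr0 mulf_neq0 // neq.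
  - by rewrite subrr mul0r mulr0 add0r addr0 mulf_neq0 // neq // eq_sym.
  by rewrite subrr !mulr0 !add0r mulf_neq0 // neq // eq_sym.
have st : transcendental iY (s - iY m).
  apply: nonconst_transcendental => k; rewrite subr_eq -rmorphD.
  exact: transcendental_nonconst.
have uD : u ^+ 2 = (map_poly iY (quintic a b c e)).[s - iY m].
  rewrite uE /quintic !evM !evXC ev_f !big_cons big_nil !evM ev1 !evXC mulr1.
  rewrite map_depressed_cubic r3.
  by rewrite !(rmorphD, rmorphN) /=; ring.
have genY z : quad (Cx iY (s - iY m)) u z.
  have sC := Cx_subfield iY (s - iY m).
  have Cs : Cx iY (s - iY m) s.
    by rewrite -{2}[s](subrK (iY m)); apply: (sfD sC); [exact: Cx_gen|exact: (sfC sC)].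
  have [p [q [Cp Cq ->]]] := gen z.
  by exists p, q; split=> //; apply: (Cx_sub sC Cs).
have [L [phi [x [y [w [r [[fe' tx yx] [[sE uE' rE wE] genX]]]]]]]] :=
  tripling_cover d0 dE sep st uD genY.
have ov : over_CC iY (phi \o iY) phi by [].
have ffX : function_field (phi \o iY) := function_field_ext ov fe' ff.
exists L, (phi \o iY), phi; split=> //.
  exact: (cover_etale ffX ov d0 dE fe n45' sep st uD tx yx sE uE' rE wE genX).
exact: (cover_prill ff ffX ov d0 dE fe n45' sep st uD genY tx yx sE uE' rE wE genX).
Qed.
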